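(* Let $\alpha\in(0,1]$, let $\sigma,\eta>0$ be constants and let $f\in H^2(\mathbb{R})$. The solution $u$ to the problem $$(\sigma/\eta)\, D^\alpha_t u(t,x) + D^{2\alpha}_t u(t,x) = \frac{\partial^2}{\partial x^2}\Big[u(t,x) - f(x)\,\mathbf{P}(T^L_1>t)\Big],\qquad t>0,\ x\in\mathbb{R},$$ with $u(0,x)=f(x)$ and, only in the case $\alpha\in(1/2,1]$, also $\frac{\partial u}{\partial t}(0,x)=0$ (for a.e. $x$), admits the representation $$u(t,x)=\mathbf{E}[f(x+Z_t)],\qquad t>0,\ x\in\mathbb{R}.$$
   Context: Fractional derivative. $D^\nu_t$ is the Caputo-Dzhrbashyan derivative: for $\nu\in(0,1)\cup(1,2)$ and $n=\lceil \nu\rceil$, $$D^\nu_t\varphi(t,x)=\frac{1}{\Gamma(n-\nu)}\int_0^t \frac{\partial^n\varphi}{\partial s^n}(s,x)\,(t-s)^{n-\nu-1}\,ds,$$ while $D^1_t=\partial/\partial t$ and $D^2_t=\partial^2/\partial t^2$. Probabilistic objects. - $\{\theta_j\}_{j\ge 0}$ are i.i.d. with $\mathbf{P}(\theta_j=1)=\mathbf{P}(\theta_j=-1)=1/2$. - $e_0=0$ and $\{e_j\}_{j\ge1}$ are i.i.d. with $\mathbf{P}(e_j>t)=e^{-(\sigma/\eta)t}$, $t\ge 0$; $T_n=\sum_{j=0}^n e_j$ (so $T_0=0$), and $N_t=\max\{n\ge0: T_n\le t\}$ is the associated Poisson process. - $H=\{H_t\}_{t\ge0}$ is an $\alpha$-stable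 subordinator with $\mathbf{E}[e^{-\lambda H_t}]=e^{-t\lambda^\alpha}$, $\lambda>0$ (for $\alpha=1$, $H_t=t$), and $L_t=\inf\{s\ge0: H_s>t\}$ is its inverse. - The families $\{\theta_j\}$, $\{e_j\}$ and $H$ are mutually independent. - $N^L_t=N_{L_t}$ and $T^L_n=H_{T_n}$, so that $N^L_t=n$ iff $T^L_n\le t<T^L_{n+1}$ (a.s.). One has $\mathbf{P}(T^L_1>t)=E_\alpha(-(\sigma/\eta)t^\alpha)$, where $E_\alpha(z)=\sum_{k\ge0} z^k/\Gamma(\alpha k+1)$ is the Mittag-Leffler function. - $Z_t=\sum_{j=0}^{N^L_t}\theta_j e_j$, $t\ge 0$. Solution class. The solution is considered in the weighted anisotropic space $H^{2\alpha,1}_\mu((0,\infty)\times\mathbb{R})$ of functions for which $$\|u\|^2_{L^2(\mu)}+\|D^{2\alpha}_tu\|^2_{L^2(\mu)}+\Big\|\frac{\partial u}{\partial x}\Big\|^2_{L^2(\mu)}<\infty,\qquad \|\varphi\|^2_{L^2(\mu)}=\int_0^\infty t^\zeta e^{-\beta t}\|\varphi(t,\cdot)\|^2_{L^2(\mathbb{R})}\,dt,$$ with parameters $\beta>0$, $\zeta>-1$.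
   Formalization: The solution u is also required to be absolutely continuous in t to order n=⌈2α⌉ for a.e. x, with the L²(R)-norm of its n-th time derivative integrable on (0,T]; without this, uniqueness fails, e.g. α=1/2, f=0, ζ>3/2. *)

(* Defs.v *)
From HB Require Import structures.
From mathcomp Require Export all_boot all_order all_algebra.
From mathcomp Require Export all_classical all_reals all_analysis.
Set Implicit Arguments.
Unset Strict Implicit.
Unset Printing Implicit Defensive.
Import Order.TTheory GRing.Theory Num.Theory.
Import numFieldNormedType.Exports.
Local Open Scope classical_set_scope.
Local Open Scope ring_scope.

(* A function u of time and space is written curried, [u t x]; it is defined
   for all real t, but only its values for t >= 0 are ever used. *)

Section Analysis.
Context {R : realType}.
Local Notation mu := (@lebesgue_measure R).
Implicit Types (phi psi w h f : R -> R) (u v g : R -> R -> R).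

Definition Gamma (z : R) : R :=
  \int[mu]_(s in `]0, +oo[) (s `^ (z - 1) * expR (- s)).

Definition order_ceil (nu : R) : nat := `|Num.ceil nu|%N.

Definition caputo (nu : R) phi (t : R) : R :=
  let n := order_ceil nu in
  if nu == n%:R then derive1n n phi t
  else (Gamma (n%:R - nu))^-1 *
       \int[mu]_(s in `[0, t]) (derive1n n phi s * (t - s) `^ (n%:R - nu - 1)).

(* phi is of class AC^n on every interval [0, T] (n >= 1): phi is continuous at
   0 from the right and phi^(n-1) is an indefinite integral of phi^(n), which
   is integrable up to 0. *)
Definition AC_loc (n : nat) phi : Prop :=
  [/\ phi s @[s --> 0^'+] --> phi 0,
      forall k t, (k.+1 < n)%N -> 0 < t -> derivable (derive1n k phi) t 1,
      forall T, 0 < T -> mu.-integrable `]0, T] (EFin \o derive1n n phi) &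
      forall s t, 0 < s -> s <= t ->
        derive1n n.-1 phi t - derive1n n.-1 phi s =
          \int[mu]_(r in `[s, t]) derive1n n phi r].

Definition test_function phi : Prop :=
  (forall k x, derivable (derive1n k phi) x 1) /\
  (exists M, forall x, M < `|x| -> phi x = 0).

Definition weak_deriv (k : nat) w h : Prop :=
  [/\ locally_integrable setT w, locally_integrable setT h &
      forall phi, test_function phi ->
        \int[mu]_x (w x * derive1n k phi x) =
          (-1) ^+ k * \int[mu]_x (h x * phi x)].

(* H^m(R) *)
Definition sobolev (m : nat) f : Prop :=
  f \in Lfun mu 2%:E /\
  forall k, (k <= m)%N -> exists2 h, h \in Lfun mu 2%:E & weak_deriv k f h.

(* Squared norm of v in L^2((0, oo) x R) with weight t^zeta e^(- beta t). *)
Definition weighted_sqnorm (zeta beta : R) v : \bar R :=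
  (\int[mu]_(t in `]0%R, +oo[)
     ((t `^ zeta * expR (- beta * t))%:E * 'N[mu]_2%:E[EFin \o v t] ^+ 2))%E.

Definition strip_measurable v : Prop :=
  measurable_fun [set z : R * R | 0 < z.1] (fun z : R * R => v z.1 z.2).

Definition weighted_L2 (zeta beta : R) v : Prop :=
  strip_measurable v /\ (weighted_sqnorm zeta beta v < +oo)%E.

(* Equality for a.e. (t, x) with t > 0. *)
Definition ae_strip u v : Prop :=
  {ae (mu \x mu)%E, forall z : R * R, 0 < z.1 -> u z.1 z.2 = v z.1 z.2}.

(* u lies in W^{n,1}_loc([0, oo); L^2(R)), i.e. in the domain of the Caputo
   derivatives of order in (n-1, n], for functions of t with values in L^2(R).
   It is expressed through the sections u(., x), so that the values u(0, x) and
   the classical derivatives in t are meaningful for a.e. x. *)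
Definition time_regular (n : nat) u : Prop :=
  {ae mu, forall x, AC_loc n (u^~ x)} /\
  exists g,
    [/\ strip_measurable g,
        ae_strip (fun t x => derive1n n (u^~ x) t) g &
        forall T, 0 < T ->
          (\int[mu]_(t in `]0%R, T]) 'N[mu]_2%:E[EFin \o g t] < +oo)%E].

(* The weighted space H^{nu,1}((0, oo) x R); membership in the
   weighted L^2 space is up to a.e. equality, and d/dx is the weak derivative. *)
Definition anisotropic (nu zeta beta : R) u : Prop :=
  [/\ time_regular (order_ceil nu) u,
      weighted_L2 zeta beta u,
      exists2 v, weighted_L2 zeta beta v &
        ae_strip (fun t x => caputo nu (u^~ x) t) v &
      exists2 v, weighted_L2 zeta beta v &
        {ae mu, forall t, 0 < t -> weak_deriv 1 (u t) (v t)}].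

(* c D_t^alpha u + D_t^(2 alpha) u = d^2/dx^2 [u - f p], t > 0, where the
   right-hand side is a weak derivative and the equality holds a.e. *)
Definition solves_equation (alpha c : R) f (p : R -> R) u : Prop :=
  exists g,
    {ae mu, forall t, 0 < t ->
       weak_deriv 2 (fun x => u t x - f x * p t) (g t)} /\
    ae_strip (fun t x => c * caputo alpha (u^~ x) t
                         + caputo (2 * alpha) (u^~ x) t) g.

Definition initial_conditions (alpha : R) f u : Prop :=
  {ae mu, forall x, u 0 x = f x} /\
  (2^-1 < alpha ->
   {ae mu, forall x, h^-1 * (u h x - u 0 x) @[h --> 0^'+] --> (0 : R)}).

End Analysis.

Section Independence.
Context {d : measure_display} {Om : measurableType d} {R : realType}
  {P : probability Om R}.

(* sigma-algebra generated by the variables X i, i in D *)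
Definition sigma_of (I : Type) (D : set I) (X : I -> {RV P >-> R}) :
    set (set Om) :=
  <<s [set A | exists2 i, D i & exists2 B : set R,
                 measurable B & A = X i @^-1` B] >>.

Definition mutually_independent (I : eqType) (D : set I)
    (F : I -> set (set Om)) : Prop :=
  forall (s : seq I) (A : I -> set Om), uniq s ->
    (forall i, i \in s -> D i /\ F i (A i)) ->
    P (\big[setI/setT]_(i <- s) A i) = (\prod_(i <- s) P (A i))%E.

Definition independent_variables (I : eqType) (D : set I)
    (X : I -> {RV P >-> R}) : Prop :=
  mutually_independent D (fun i => sigma_of [set i] X).

End Independence.
Arguments mutually_independent {d Om R} P {I} D F.

Section Process.
Context {d : measure_display} {Om : measurableType d} {R : realType}
  {P : probability Om R}.
Variables (theta e : nat -> {RV P >-> R}) (H : R -> {RV P >-> R}).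

Definition iid_signs : Prop :=
  independent_variables setT theta /\
  forall j, P [set w | theta j w = 1] = (2^-1)%:E /\
            P [set w | theta j w = -1] = (2^-1)%:E.

Definition exponential_times (c : R) : Prop :=
  [/\ forall w, e 0%N w = 0,
      independent_variables [set j | (0 < j)%N] e,
      forall j w, 0 <= e j w &
      forall j t, (0 < j)%N -> 0 <= t ->
        P [set w | t < e j w] = (expR (- c * t))%:E].

(* Every trajectory starts at 0, is nondecreasing and right-continuous; this
   makes the composed quantities below random variables. For alpha = 1 the
   Laplace transform and right-continuity force H_t = t for all t, a.s. *)
Definition stable_subordinator (alpha : R) : Prop :=
  [/\ forall w, [/\ H 0 w = 0,
        forall s t, 0 <= s -> s <= t -> H s w <= H t w &
        forall t, 0 <= t -> H s w @[s --> t^'+] --> H t w],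
      forall s t (A : set Om) (B : set R), 0 <= s -> s <= t ->
        sigma_of [set r | 0 <= r <= s] H A -> measurable B ->
        P (A `&` [set w | B (H t w - H s w)]) =
          (P A * P [set w | B (H t w - H s w)%R])%E,
      forall s t (B : set R), 0 <= s -> s <= t -> measurable B ->
        P [set w | B (H t w - H s w)] = P [set w | B (H (t - s) w)] &
      forall t lam, 0 <= t -> 0 < lam ->
        ('E_P[fun w => expR (- lam * H t w)] =
          (expR (- t * lam `^ alpha))%:E)%E].

Definition independent_families : Prop :=
  mutually_independent P [set: 'I_3]
    (fun i => nth set0 [:: sigma_of setT theta; sigma_of setT e;
                           sigma_of [set t | 0 <= t] H] i).

Definition arrival (n : nat) (w : Om) : R := \sum_(j < n.+1) e j w.

(* N_t = max {n | T_n <= t}; the default 0 is only used on the null event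
   where this set has no maximum. *)
Definition counting (t : R) (w : Om) : nat :=
  xget 0%N [set n | arrival n w <= t /\
                    forall m, arrival m w <= t -> (m <= n)%N].

Definition inverse_subordinator (t : R) (w : Om) : R :=
  inf [set s | 0 <= s /\ t < H s w].

Definition subordinated_counting (t : R) (w : Om) : nat :=
  counting (inverse_subordinator t w) w.

Definition subordinated_arrival (n : nat) (w : Om) : R := H (arrival n w) w.

Definition random_flight (t : R) (w : Om) : R :=
  \sum_(j < (subordinated_counting t w).+1) theta j w * e j w.

End Process.

(* Main.v *)
(* Write c = sigma/eta, s = l^alpha and q = c/(c+s). Applying the Laplace transform in t turns the
   equation into (c s + s^2)(u^ - f/l) = (u^ - p^ f)'' in the sense of distributions in x, where
   p^ = (1 - q)/l is the transform of P(T^L_1 > t). Convolve with a test function rho. If theta is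
   a random sign and e an exponential variable of rate c, the operator
   K F(x) = E[F(x + theta e) exp(-s e)] satisfies K((c+s)^2 rho - rho'') = c(c+s) rho, so the
   transformed equation becomes the renewal equation U = p^ F + K U, whose only bounded solution is
   p^ sum_n K^n F since K has norm at most q < 1.

   On the probabilistic side E[Y exp(-l H_tau)] = E[Y exp(-s tau)] whenever Y and tau depend on the
   walk only (approximate tau from above by a grid and use right-continuity), and almost surely
   N^L_t = n iff H_{T_n} <= t < H_{T_{n+1}}: the subordinator is unbounded along T_n and does not
   jump there. Hence the Laplace transform of E[F(x + Z_t)] is the same series. Both functions of t
   are right-continuous, so they agree for every t > 0, and shrinking rho gives the claim. *)

From HB Require Import structures.
From mathcomp Require Import ring lra measurable_realfun.
Require Import Defs.
Set Implicit Arguments.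
Unset Strict Implicit.
Unset Printing Implicit Defensive.
Import Order.TTheory GRing.Theory Num.Theory.
Import numFieldNormedType.Exports.
Local Open Scope classical_set_scope.
Local Open Scope ring_scope.

(** The identity for K is a resolvent identity. With m = c + s, a step theta e killed at rate s has
    density (c/2) e^{-m|x|}, so K = c m (m^2 - d^2/dx^2)^{-1}. Since c s + s^2 = m^2 - c m and p^
    m^2 = (c s + s^2)/l, applying K to the transformed equation cancels all but the renewal
    equation. The analytic half is shaped by how little is known of u: almost every section in time,
    and weighted norms. Near t = 0 the weight t^zeta with zeta large gives no integrability, so the
    local W^{n,1} regularity is used there; beyond t = 1 Young's inequality against the weight makes
    transforms converge, but only for 2 l > beta. These bounds concern h = D_t^{2 alpha} u paired
    with a fixed function of x; u and D_t^alpha u are recovered from h by fractional integration.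
    Uniqueness is therefore needed for transforms known on a half-line only. In the probabilistic
    half the obstacle is measurability: the flight is defined path by path, and is replaced by an
    almost surely equal measurable version. *)

Lemma measurable_ind d (T : measurableType d) (R : realType) (b : T -> bool) :
  measurable [set x | b x] -> measurable_fun setT (fun x => (b x)%:R : R).
Proof.
move=> mb; rewrite (_ : (fun x => _) = \1_([set x | b x])); first exact: measurable_indic.
by apply/funext => x; rewrite indicE; congr ((nat_of_bool _)%:R); apply/idP/idP; rewrite inE.
Qed.

(** * Integrability and almost everywhere equality for real-valued functions *)

Section Integration.
Context d (T : measurableType d) (R : realType).
Variable mu : {measure set T -> \bar R}.
Implicit Types f g h : T -> R.

Local Notation intg f := (mu.-integrable setT (EFin \o f)).

Lemma aeS (Q S : T -> Prop) : {ae mu, forall x, Q x} ->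
  (forall x, Q x -> S x) -> {ae mu, forall x, S x}.
Proof. by move=> h QS; apply: filterS h. Qed.

Lemma aeS2 (Q1 Q2 S : T -> Prop) : {ae mu, forall x, Q1 x} ->
  {ae mu, forall x, Q2 x} ->
  (forall x, Q1 x -> Q2 x -> S x) -> {ae mu, forall x, S x}.
Proof. by move=> h1 h2 QS; apply: filterS2 h1 h2. Qed.

Lemma aeS3 (Q1 Q2 Q3 S : T -> Prop) : {ae mu, forall x, Q1 x} ->
  {ae mu, forall x, Q2 x} -> {ae mu, forall x, Q3 x} ->
  (forall x, Q1 x -> Q2 x -> Q3 x -> S x) -> {ae mu, forall x, S x}.
Proof. by move=> h1 h2 h3 QS; apply: filterS3 h1 h2 h3. Qed.

Lemma intgP f : intg f <->
  measurable_fun setT f /\ (\int[mu]_x (`|f x|%:E) < +oo)%E.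
Proof.
split=> [/integrableP[/measurable_EFinP mf fi]|[mf fi]]; first by split.
by apply/integrableP; split => //; exact/measurable_EFinP.
Qed.

Lemma intg_measurable f : intg f -> measurable_fun setT f.
Proof. by move=> /intgP[]. Qed.

Lemma le_intg f g : measurable_fun setT f ->
  (forall x, `|f x| <= g x) -> intg g -> intg f.
Proof.
move=> mf fg ig; apply: (le_integrable measurableT _ _ ig).
  exact/measurable_EFinP.
move=> x _ /=; rewrite lee_fin (le_trans (fg x))//; exact: ler_norm.
Qed.

Lemma intgMbd f g M : intg f -> measurable_fun setT g ->
  (forall x, f x != 0 -> `|g x| <= M) -> intg (fun x => f x * g x).
Proof.
move=> /[dup] /intg_measurable mf fi mg gM.
apply: (@le_intg _ (fun x => `|M| * `|f x|)).
- exact: measurable_funM.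
- move=> x; rewrite normrM mulrC; have [->|fx0] := eqVneq (f x) 0.
    by rewrite normr0 !mulr0.
  by rewrite ler_wpM2r// (le_trans (gM _ fx0))// ler_norm.
- have := integrableZl measurableT `|M| (integrable_norm fi).
  by apply: eq_integrable.
Qed.

Lemma intgD f g : intg f -> intg g -> intg (fun x => f x + g x).
Proof. by move=> fi gi; have := integrableD measurableT fi gi; apply: eq_integrable. Qed.

Lemma intgB f g : intg f -> intg g -> intg (fun x => f x - g x).
Proof. by move=> fi gi; have := integrableB measurableT fi gi; apply: eq_integrable. Qed.

Lemma intgZ k f : intg f -> intg (fun x => k * f x).
Proof. by move=> fi; have := integrableZl measurableT k fi; apply: eq_integrable. Qed.

Lemma intg_norm f : intg f -> intg (fun x => `|f x|).
Proof. exact: integrable_norm. Qed.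

Lemma eq_intg f g : f =1 g -> intg f -> intg g.
Proof. by move=> fg; rewrite (_ : f = g)//; exact/funext. Qed.

Lemma intg_ae f g : measurable_fun setT g -> {ae mu, forall x, f x = g x} ->
  intg f -> intg g.
Proof.
move=> mg fg /intgP[mf fi]; apply/intgP; split => //.
rewrite (@ae_eq_integral _ _ _ mu setT (fun x => `|f x|%:E))//.
- by apply/measurable_EFinP; exact: measurableT_comp.
- by apply/measurable_EFinP; exact: measurableT_comp.
- by apply: filterS fg => x /= -> _.
Qed.

Lemma Rint_ae f g : measurable_fun setT f -> measurable_fun setT g ->
  {ae mu, forall x, f x = g x} -> \int[mu]_x f x = \int[mu]_x g x.
Proof.
move=> mf mg fg; rewrite /Rintegral; congr fine; apply: ae_eq_integral => //.
- exact/measurable_EFinP.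
- exact/measurable_EFinP.
- by apply: filterS fg => x /= -> _.
Qed.

Lemma EFin_Rint f : intg f -> (\int[mu]_x f x)%:E = (\int[mu]_x (f x)%:E)%E.
Proof. by move=> fi; rewrite /Rintegral fineK//; exact: integrable_fin_num. Qed.

Lemma RintZ k f : intg f -> \int[mu]_x (k * f x) = k * \int[mu]_x f x.
Proof. by move=> fi; rewrite RintegralZl. Qed.

Lemma Rint_dominated_cvg (f_ : nat -> T -> R) f g :
  (forall n, measurable_fun setT (f_ n)) -> measurable_fun setT f -> intg g ->
  {ae mu, forall x, f_ ^~ x @ \oo --> f x} ->
  (forall n x, `|f_ n x| <= g x) ->
  (\int[mu]_x f_ n x) @[n --> \oo] --> \int[mu]_x f x.
Proof.
move=> mf_ mf gi ff fg.
have fi : intg f.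
  have := @dominated_convergence _ T R mu setT measurableT
    (fun n => EFin \o f_ n) (EFin \o f) (EFin \o g).
  case => //.
  - by move=> n; exact/measurable_EFinP.
  - exact/measurable_EFinP.
  - by apply: filterS ff => x h _; apply/fine_cvgP; split; [exact: nearW|].
  - by apply: aeW => x n _; rewrite lee_fin.
have fi_ n : intg (f_ n) by exact: (le_intg (mf_ n) (fg n) gi).
have := @dominated_convergence _ T R mu setT measurableT
    (fun n => EFin \o f_ n) (EFin \o f) (EFin \o g).
case => //.
- by move=> n; exact/measurable_EFinP.
- exact/measurable_EFinP.
- by apply: filterS ff => x h _; apply/fine_cvgP; split; [exact: nearW|].
- by apply: aeW => x n _; rewrite lee_fin.
move=> _ _; rewrite -[X in _ --> X]EFin_Rint// => /fine_cvgP[_].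
by apply: cvg_trans; apply: near_eq_cvg; exact: nearW.
Qed.

End Integration.

Notation intg mu f := (integrable mu setT (EFin \o f)).

(** * Uniqueness for the Laplace transform *)

Section Laplace_injectivity.
Context {R : realType}.
Local Notation mu := (@lebesgue_measure R).
Implicit Types phi psi : R -> R.

(** The two estimates of (1 - x)^m, from below here and from above in [expR_powN], decide on which
    side of a the powers (1 - e^{-nt})^m tend to 1 or to 0. *)
Lemma bernoulli_ineq (x : R) m : 0 <= x <= 1 -> 1 - m%:R * x <= (1 - x) ^+ m.
Proof.
move=> /andP[x0 x1]; elim: m => [|m IH]; first by rewrite expr0 mul0r subr0.
rewrite exprS; apply: le_trans (_ : (1 - x) * (1 - m%:R * x) <= _).
  have : 0 <= m%:R * (x * x) by rewrite mulr_ge0// mulr_ge0.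
  by rewrite -addn1 natrD; lra.
by rewrite ler_wpM2l// subr_ge0.
Qed.

Lemma expR_powN (x : R) m : 0 <= x <= 1 -> (1 - x) ^+ m <= expR (- (m%:R * x)).
Proof.
move=> /andP[x0 x1]; rewrite -mulrN expRM_natl; apply: lerXn2r.
- by rewrite nnegrE subr_ge0.
- by rewrite nnegrE expR_ge0.
- by rewrite addrC; have := @expR_ge1Dx R (- x); rewrite addrC.
Qed.

Lemma expRN_le_inv (x : R) : 0 < x -> expR (- x) <= x^-1.
Proof.
move=> x0; rewrite expRN lef_pV2 ?posrE ?expR_gt0//.
by apply: le_trans (expR_ge1Dx x); rewrite lerDr.
Qed.

Lemma cvg0_le (u v : nat -> R) : (forall n, (0 < n)%N -> `|u n| <= v n) ->
  v @ \oo --> (0 : R) -> u @ \oo --> (0 : R).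
Proof.
move=> uv v0; apply/norm_cvg0P.
apply: (squeeze_cvgr _ (cvg_cst _) v0); near=> n.
by rewrite normr_ge0 uv//; near: n; exact: nbhs_infty_gt.
Unshelve. end_near. Qed.

Lemma cvg_expRNn (x : R) : 0 < x -> expR (- (n%:R * x)) @[n --> \oo] --> (0 : R).
Proof.
move=> x0; rewrite (_ : (fun n : nat => _) = (fun n : nat => expR (- x) ^+ n)).
  by apply: cvg_expr; rewrite ger0_norm ?expR_ge0// expR_lt1; lra.
by apply/funext => n; rewrite -mulrN expRM_natl.
Qed.

Lemma cvg_invnM (x : R) : 0 < x -> (n%:R * x)^-1 @[n --> \oo] --> (0 : R).
Proof.
move=> x0; apply/cvgrPdist_lt => e e0.
have h : 0 < (e * x)^-1 by rewrite invr_gt0 mulr_gt0.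
near=> n; have n0 : (e * x)^-1 < n%:R.
  by near: n; have /cvgryPgt := @cvgr_idn R; apply.
have n1 : 0 < n%:R :> R by exact: lt_trans n0.
rewrite sub0r normrN ger0_norm ?invr_ge0 ?mulr_ge0 ?(ltW n1) ?(ltW x0)//.
rewrite invf_plt ?posrE ?mulr_gt0//.
by rewrite -ltr_pdivrMr// -invfM.
Unshelve. all: end_near. Qed.

(* A polynomial in e^{-t} that tends to the indicator of (a, oo); Laplace transforms at the
   integers therefore determine the integrals over such half-lines. *)
Lemma laplace_window (a t : R) : 0 < a -> 0 < t -> t != a ->
  (1 - expR (- (n%:R * t))) ^+ (Num.trunc (expR (n%:R * a))).+1
    @[n --> \oo] --> ((a < t)%R%:R : R).
Proof.
move=> a0 t0; set m := fun n : nat => (Num.trunc (expR (n%:R * a))).+1.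
have m1 n : (m n)%:R <= expR (n%:R * a) + 1.
  rewrite /m -addn1 natrD lerD2r.
  by have /truncn_itv/andP[] := expR_ge0 (n%:R * a).
have m2 n : expR (n%:R * a) <= (m n)%:R.
  by have /truncn_itv/andP[_ /ltW] := expR_ge0 (n%:R * a).
have x01 n : 0 <= expR (- (n%:R * t)) <= 1.
  by rewrite expR_ge0 expR_le1 oppr_le0 mulr_ge0// ltW.
have q0 n : 0 <= (1 - expR (- (n%:R * t))) ^+ m n.
  by rewrite exprn_ge0// subr_ge0; case/andP: (x01 n).
rewrite neq_lt => /orP[ta|at_].
  (* Below a: (1 - x)^m <= e^{-mx} with x = e^{-nt} and m >= e^{na}, so mx >= e^{n(a-t)} >= n(a-t),
     and e^{-y} <= 1/y concludes. *)
  rewrite ltNge (ltW ta)/=; apply: (@cvg0_le _ (fun n : nat => (n%:R * (a - t))^-1)).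
    move=> n n0; rewrite ger0_norm//.
    apply: (le_trans (expR_powN _ (x01 n))).
    have nt : 0 < n%:R * (a - t) by rewrite mulr_gt0 ?subr_gt0// ltr0n.
    apply: le_trans (expRN_le_inv nt); rewrite ler_expR lerN2.
    apply: le_trans (_ : expR (n%:R * (a - t)) <= _).
      by apply: le_trans (expR_ge1Dx _); rewrite lerDr.
    rewrite mulrBr expRD; apply: ler_wpM2r => //; exact: expR_ge0.
  by apply: cvg_invnM; rewrite subr_gt0.
(* Above a: Bernoulli bounds 1 - (1 - x)^m by mx <= (e^{na} + 1) e^{-nt}; the extra 1 comes from
   rounding e^{na} up to an integer. *)
rewrite at_ -[X in _ --> X]subr0.
rewrite (_ : (fun n : nat => _) = (fun n => 1 - (1 - (1 - expR (- (n%:R * t))) ^+ m n))); last first.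
  by apply/funext => n; ring.
apply: cvgB; first exact: cvg_cst.
apply: (@cvg0_le _ (fun n : nat => expR (- (n%:R * (t - a))) + expR (- (n%:R * t)))).
  move=> n _; rewrite ger0_norm; last first.
    rewrite subr_ge0 exprn_ile1// ?subr_ge0 ?lerBlDr ?lerDl; by case/andP: (x01 n).
  have := bernoulli_ineq (m n) (x01 n).
  suff : (m n)%:R * expR (- (n%:R * t)) <= expR (- (n%:R * (t - a))) + expR (- (n%:R * t)) by lra.
  rewrite (_ : - (n%:R * (t - a)) = n%:R * a + - (n%:R * t)); last by ring.
  rewrite expRD -{3}(mul1r (expR _)) -mulrDl; apply: ler_wpM2r => //; exact: expR_ge0.
rewrite -[X in _ --> X](addr0 0); apply: cvgD; apply: cvg_expRNn => //.
by rewrite subr_gt0.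
Qed.

Lemma measurable_expRl (l : R) : measurable_fun setT (fun t : R => expR (- (l * t))).
Proof.
by do 2! apply: measurableT_comp => //; exact: measurable_funM.
Qed.

Lemma ae_neq (a : R) : {ae mu, forall t, t != a}.
Proof.
exists [set a]; split => //; first exact: lebesgue_measure_set1.
by move=> t /= /negP; rewrite negbK => /eqP.
Qed.

(** The induction on m needs every j at once: a new factor 1 - e^{-nt} turns the integral at j into
    the difference of those at j and j + n. Vanishing for t <= 0 keeps all the exponentials at most
    1 where [psi] lives. *)
Lemma laplace_polynomial (psi : R -> R) m n : intg mu psi ->
  (forall t, t <= 0 -> psi t = 0) ->
  (forall j : nat, \int[mu]_t (psi t * expR (- (j%:R * t))) = 0) ->
  forall j : nat,
  \int[mu]_t (psi t * (expR (- (j%:R * t)) * (1 - expR (- (n%:R * t))) ^+ m)) = 0.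
Proof.
move=> ip p0 pj.
have bd (k l : nat) (t : R) : psi t != 0 ->
    `|expR (- (k%:R * t)) * (1 - expR (- (n%:R * t))) ^+ l| <= 1.
  move=> pt; have t0 : 0 < t.
    by rewrite ltNge; apply: contra pt => /p0 ->.
  have e01 (k' : nat) : 0 <= expR (- (k'%:R * t)) <= 1.
    by rewrite expR_ge0 expR_le1 oppr_le0 mulr_ge0// ltW.
  have /andP[k0 k1] := e01 k; have /andP[n0 n1] := e01 n.
  rewrite normrM mulr_ile1 ?normr_ge0//; first by rewrite ger0_norm.
  by rewrite ger0_norm ?exprn_ge0 ?subr_ge0// exprn_ile1 ?subr_ge0// lerBlDr lerDl.
have mb (k l : nat) : measurable_fun setT
    (fun t : R => expR (- (k%:R * t)) * (1 - expR (- (n%:R * t))) ^+ l).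
  apply: measurable_funM; first exact: measurable_expRl.
  by apply: measurable_funX; apply: measurable_funB => //; exact: measurable_expRl.
elim: m => [|m IH] j.
  by rewrite -[RHS](pj j); apply: eq_Rintegral => t _; rewrite expr0 mulr1.
transitivity (\int[mu]_t (psi t * (expR (- (j%:R * t)) * (1 - expR (- (n%:R * t))) ^+ m)
    - psi t * (expR (- ((j + n)%:R * t)) * (1 - expR (- (n%:R * t))) ^+ m))).
  apply: eq_Rintegral => t _.
  rewrite (_ : - ((j + n)%:R * t) = - (j%:R * t) + - (n%:R * t)); last by rewrite natrD; ring.
  by rewrite exprS expRD; ring.
rewrite RintegralB// ?IH ?subrr//.
- exact: (intgMbd ip (mb _ _) (bd _ _)).
- exact: (intgMbd ip (mb _ _) (bd _ _)).
Qed.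

(** Dominated convergence along the window polynomials, which lie in [0, 1] on t > 0 and tend to the
    indicator of (a, oo) except at t = a. *)
Lemma laplace_tail (psi : R -> R) (a : R) : 0 < a -> intg mu psi ->
  (forall t, t <= 0 -> psi t = 0) ->
  (forall j : nat, \int[mu]_t (psi t * expR (- (j%:R * t))) = 0) ->
  \int[mu]_t (psi t * (a < t)%R%:R) = 0.
Proof.
move=> a0 ip p0 pj.
pose q (n : nat) (t : R) := (1 - expR (- (n%:R * t))) ^+ (Num.trunc (expR (n%:R * a))).+1.
have mq n : measurable_fun setT (q n).
  by apply: measurable_funX; apply: measurable_funB => //; exact: measurable_expRl.
have mi : measurable_fun setT (fun t : R => (a < t)%R%:R : R).
  rewrite (_ : (fun t : R => _) = \1_(`]a, +oo[)).
    by apply: measurable_indic; exact: measurable_itv.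
  by apply/funext => t; rewrite indicE mem_setE in_itv/= andbT.
suff : (\int[mu]_t (psi t * q n t)) @[n --> \oo] --> \int[mu]_t (psi t * (a < t)%R%:R).
  rewrite (_ : (fun n : nat => _) = cst 0); last first.
    apply/funext => n /=; rewrite -[RHS](laplace_polynomial (Num.trunc (expR (n%:R * a))).+1 n ip p0 pj 0%N).
    by apply: eq_Rintegral => t _; rewrite mul0r oppr0 expR0 mul1r.
  by move=> /(cvg_unique _ (cvg_cst _)) /= <-.
apply: (Rint_dominated_cvg _ _ (intg_norm ip)).
- by move=> n; apply: measurable_funM; [exact: (intg_measurable ip)|exact: mq].
- by apply: measurable_funM; [exact: (intg_measurable ip)|exact: mi].
- apply: (aeS (ae_neq a)) => t ta.
  have [t0|t0] := leP t 0.
    by rewrite p0// mul0r; under eq_fun do rewrite mul0r; exact: cvg_cst.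
  apply: cvgM; first exact: cvg_cst.
  exact: laplace_window.
- move=> n t; rewrite normrM; have [->|pt] := eqVneq (psi t) 0.
    by rewrite normr0 mul0r.
  rewrite ler_piMr//.
  have t0 : 0 < t by rewrite ltNge; apply: contra pt => /p0 ->.
  have e0 := expR_ge0 (- (n%:R * t)).
  have e1 : expR (- (n%:R * t)) <= 1 by rewrite expR_le1 oppr_le0 mulr_ge0// ltW.
  by rewrite ger0_norm ?exprn_ge0 ?subr_ge0// exprn_ile1 ?subr_ge0// lerBlDr lerDl.
Qed.

(** All integrals of e^{-lt} phi over half-lines (a, oo) with a > 0 vanish, hence also those over
    (a, b]; but right-continuity fixes the sign of [phi] just to the right of a point where it is
    nonzero. Damping by a fixed e^{-lt} with l > [l0] turns the transforms at l + j into transforms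
    at the integers. *)
Lemma laplace_injective (phi : R -> R) (l0 : R) :
  (forall t, t <= 0 -> phi t = 0) ->
  (forall l, l0 < l -> intg mu (fun t => expR (- (l * t)) * phi t)) ->
  (forall l, l0 < l -> \int[mu]_t (expR (- (l * t)) * phi t) = 0) ->
  (forall t, 0 < t -> phi s @[s --> t^'+] --> phi t) ->
  forall t, 0 < t -> phi t = 0.
Proof.
move=> p0 ip pl pc a a0; apply/eqP/negPn/negP => pa.
(* [l] exceeds [l0] and is also positive, so that e^{-lt} is decreasing. *)
pose l := `|l0| + 1; have l00 : l0 < l.
  by rewrite /l (le_lt_trans (ler_norm _))// ltrDl.
have l_gt0 : 0 < l by rewrite /l ltr_wpDl.
pose psi t := expR (- (l * t)) * phi t.
have psi_tail b : 0 < b -> \int[mu]_t (psi t * (b < t)%R%:R) = 0.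
  move=> b0; apply: laplace_tail => //; first exact: ip.
  - by move=> t t0; rewrite /psi p0// mulr0.
  - move=> j; rewrite -[RHS](pl (l + j%:R)); last by rewrite ltr_wpDr.
    apply: eq_Rintegral => t _; rewrite /psi.
  rewrite (_ : - ((l + j%:R) * t) = - (l * t) + - (j%:R * t)); last by ring.
  by rewrite expRD mulrAC.
have [d d0 dP] : exists2 e : R, 0 < e & forall t, a < t < a + e -> 
    `|phi a - phi t| < `|phi a| / 2.
  have h : 0 < `|phi a| / 2 by rewrite divr_gt0// normr_gt0.
  have /cvgrPdist_lt/(_ _ h)[e /= e0 eP] := pc _ a0.
  exists e => // t /andP[at_ te]; apply: eP => //=.
  by rewrite ltr_distlC; apply/andP; split; lra.
pose b := a + d / 2; have ab : a < b by rewrite /b ltrDl divr_gt0.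
have ipsi : intg mu psi by exact: ip.
have mi c : measurable_fun setT (fun t : R => (c < t)%R%:R : R).
  rewrite (_ : (fun t : R => _) = \1_(`]c, +oo[)).
    by apply: measurable_indic; exact: measurable_itv.
  by apply/funext => t; rewrite indicE mem_setE in_itv/= andbT.
have ic c : intg mu (fun t => psi t * (c < t)%R%:R).
  apply: (@intgMbd _ _ _ _ _ _ 1 ipsi); [exact: mi|move=> t _].
  by case: ltP => _; rewrite ?normr1 ?normr0.
have : \int[mu]_t (phi a * (psi t * (a < t)%R%:R - psi t * (b < t)%R%:R)) = 0.
  rewrite RintZ; last exact: intgB.
  by rewrite RintegralB// !psi_tail ?subrr ?mulr0// (lt_trans a0).
suff : 0 < \int[mu]_t (phi a * (psi t * (a < t)%R%:R - psi t * (b < t)%R%:R)).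
  by move=> /[swap] ->; rewrite ltxx.
(* On (a, b] one has phi(a) phi(t) >= phi(a)^2 / 2 and e^{-lt} >= e^{-lb}; [k] is the product of
   these two bounds. *)
pose k := expR (- (l * b)) * (phi a ^+ 2 / 2).
have k0 : 0 < k by rewrite mulr_gt0 ?expR_gt0// divr_gt0// exprn_even_gt0.
apply: lt_le_trans (_ : \int[mu]_t (k * \1_(`]a, b]) t) <= _).
  rewrite RintZ; last exact: integrable_indic_itv.
  rewrite mulr_gt0// /Rintegral integral_indic// setIT/= lebesgue_measure_itv/= lte_fin ab.
  by rewrite /= subr_gt0.
apply: le_Rintegral => //.
- by apply: intgZ; exact: integrable_indic_itv.
- by apply: intgZ; exact: intgB.
suff key (t : R) : k * \1_(`]a, b]) t <=
    phi a * (psi t * (a < t)%R%:R - psi t * (b < t)%R%:R) by move=> t _; exact: key.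
rewrite -mulrBr indicE mem_setE in_itv/=.
have [at_|ta] := ltP a t; last first.
  by rewrite /= mulr0 ltNge (le_trans ta (ltW ab))/= subrr !mulr0.
have [bt|tb] := ltP b t; first by rewrite /= subrr !mulr0.
rewrite /= subr0 !mulr1 /psi mulrCA.
apply: ler_pM; rewrite ?expR_ge0 ?divr_ge0 ?sqr_ge0//.
  by rewrite ler_expR lerN2 ler_pM2l.
have := dP t; rewrite at_ (le_lt_trans tb) ?ltrD2l ?ltr_pdivrMr//; last first.
  by rewrite /b; lra.
move=> /(_ isT) h.
have : phi a * (phi a - phi t) <= `|phi a| * (`|phi a| / 2).
  by rewrite (le_trans (ler_norm _))// normrM ler_wpM2l// ltW.
by rewrite (mulrA `|_| `|_|) -expr2 real_normK ?num_real// expr2; lra.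
Qed.

End Laplace_injectivity.

(** * Fubini, affine changes of variable and convolution on the line *)

Section Fubini_real.
Context d1 d2 (T1 : measurableType d1) (T2 : measurableType d2) (R : realType).
Variables (m1 : {sigma_finite_measure set T1 -> \bar R})
  (m2 : {sigma_finite_measure set T2 -> \bar R}).

(** The integral of a section is by definition the difference of those of its positive and negative
    parts, and Tonelli makes each of them measurable; sections with infinite integral are
    included. *)
Lemma measurable_integral2 (f : T1 * T2 -> \bar R) : measurable_fun setT f ->
  measurable_fun setT (fun x => (\int[m2]_y f (x, y))%E).
Proof.
move=> mf; rewrite (_ : (fun x => _) =
  (fun x => \int[m2]_y f^\+ (x, y) - \int[m2]_y f^\- (x, y))%E).
  apply: emeasurable_funB.
  - exact: (measurable_fun_fubini_tonelli_F (f^\+)%E (measurable_funepos mf) (fun x => funepos_ge0 f x)).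
  - exact: (measurable_fun_fubini_tonelli_F (f^\-)%E (measurable_funeneg mf) (fun x => funeneg_ge0 f x)).
apply/funext => x; rewrite [LHS]integralE.
under eq_integral do rewrite funepos_comp/=.
by under [X in (_ - X)%E = _]eq_integral do rewrite funeneg_comp/=.
Qed.

Lemma measurable_Rint2 (f : T1 * T2 -> R) : measurable_fun setT f ->
  measurable_fun setT (fun x => \int[m2]_y f (x, y)).
Proof.
move=> mf; apply: (measurableT_comp (fine_measurable measurableT)) => //.
by apply: (@measurable_integral2 (EFin \o f)); exact/measurable_EFinP.
Qed.

Lemma prod_intg_ae (f : T1 * T2 -> R) : intg (m1 \x m2)%E f ->
  {ae m1, forall x, intg m2 (fun y => f (x, y))}.
Proof. exact: ae_integrable1. Qed.

Lemma prod_intg_ae2 (f : T1 * T2 -> R) : intg (m1 \x m2)%E f ->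
  {ae m2, forall y, intg m1 (fun x => f (x, y))}.
Proof. exact: ae_integrable2. Qed.

Lemma prod_intgP (f : T1 * T2 -> R) : measurable_fun setT f ->
  (\int[m1]_x \int[m2]_y (`|f (x, y)|%:E) < +oo)%E -> intg (m1 \x m2)%E f.
Proof.
by move=> mf h; apply/integrable12ltyP => //; exact/measurable_EFinP.
Qed.

Lemma prod_intgP2 (f : T1 * T2 -> R) : measurable_fun setT f ->
  (\int[m2]_y \int[m1]_x (`|f (x, y)|%:E) < +oo)%E -> intg (m1 \x m2)%E f.
Proof.
by move=> mf h; apply/integrable21ltyP => //; exact/measurable_EFinP.
Qed.

(** An infinite inner integral is read as 0 by the real integral, so in absolute value the real one
    never exceeds the extended one, which is integrable by Fubini. *)
Lemma intg_Rint2 (f : T1 * T2 -> R) : intg (m1 \x m2)%E f ->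
  intg m1 (fun x => \int[m2]_y f (x, y)).
Proof.
move=> fi; have mf := intg_measurable fi.
have := integrable_fubini_F fi; apply: le_integrable => //.
  by apply/measurable_EFinP; exact: measurable_Rint2.
move=> x _; rewrite /= /Rintegral /fubini_F /=.
by case: (\int[m2]_y _)%E => [r| |] //=; rewrite normr0 leey.
Qed.

Lemma Rint_prod1 (f : T1 * T2 -> R) : intg (m1 \x m2)%E f ->
  \int[m1]_x \int[m2]_y f (x, y) = \int[(m1 \x m2)%E]_z f z.
Proof.
move=> fi; rewrite {1 3}/Rintegral -(integral12_prod_meas1 fi).
congr fine; apply: ae_eq_integral => //.
- by apply/measurable_EFinP; exact: measurable_Rint2 (intg_measurable fi).
- exact: (measurable_fubini_F fi).
- by apply: (aeS (prod_intg_ae fi)) => x ix _ /=; rewrite EFin_Rint.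
Qed.

End Fubini_real.

Section Fubini_swap.
Context d1 d2 (T1 : measurableType d1) (T2 : measurableType d2) (R : realType).
Variables (m1 : {sigma_finite_measure set T1 -> \bar R})
  (m2 : {sigma_finite_measure set T2 -> \bar R}).

Lemma Rint_prod2 (f : T1 * T2 -> R) : intg (m1 \x m2)%E f ->
  \int[m2]_y \int[m1]_x f (x, y) = \int[(m1 \x m2)%E]_z f z.
Proof.
move=> fi; have mf := intg_measurable fi.
rewrite {1 3}/Rintegral -(integral21_prod_meas1 fi).
congr fine; apply: ae_eq_integral => //.
- apply/measurable_EFinP.
  apply: (measurable_Rint2 m1 (f := fun z => f (z.2, z.1))).
  by apply: (measurableT_comp mf); exact: measurable_swap.
- exact: (measurable_fubini_G fi).
- by apply: (aeS (prod_intg_ae2 fi)) => x ix _ /=; rewrite EFin_Rint.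
Qed.

Lemma Rint_fubini (f : T1 * T2 -> R) : intg (m1 \x m2)%E f ->
  \int[m1]_x \int[m2]_y f (x, y) = \int[m2]_y \int[m1]_x f (x, y).
Proof. by move=> fi; rewrite Rint_prod1// Rint_prod2. Qed.

Lemma Rtonelli (f : T1 * T2 -> R) : measurable_fun setT f ->
  (forall z, 0 <= f z) ->
  (\int[m1]_x \int[m2]_y (f (x, y))%:E = \int[m2]_y \int[m1]_x (f (x, y))%:E)%E.
Proof.
move=> mf f0; apply: (fubini_tonelli (m1 := m1) (m2 := m2) (EFin \o f)).
  exact/measurable_EFinP.
by move=> z; rewrite lee_fin.
Qed.

End Fubini_swap.

Section Change_of_variable.
Context {R : realType}.
Local Notation mu := (@lebesgue_measure R).

(** Both sides are measures in A; by uniqueness of Lebesgue measure it is enough to compare them on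
    half-open intervals. *)
Lemma lebesgue_measure_affine (c b : R) (A : set R) : 0 < c -> measurable A ->
  (c%:E * mu ((fun t => c * t + b)%R @^-1` A) = mu A)%E.
Proof.
move=> c0 mA.
have mf : measurable_fun setT (fun t : R => c * t + b : measurableTypeR R)%R.
  by apply: measurable_funD => //; exact: measurable_funM.
have mc x y : (fun t : R => c * t + b)%R @^-1` `]x, y] = `](x - b) / c, (y - b) / c]%classic.
  apply/seteqP; split => t /=; rewrite !in_itv/= ltr_pdivrMr// ler_pdivlMr// (mulrC t).
    by rewrite ltrBlDr lerBrDr.
  by rewrite ltrBlDr lerBrDr.
pose m : {measure set (measurableTypeR R) -> \bar R} := mscale (NngNum (ltW c0))
  (measure_function_pushforward__canonical__measure_function_Measure mu mf).
rewrite -[LHS]/(m A); apply/esym.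
apply: (@lebesgue_measure_unique R m) => // _ [[x y] _ <-] /=.
rewrite -[RHS]/(c%:E * mu ((fun t => c * t + b)%R @^-1` `]x, y]))%E.
rewrite mc !lebesgue_measure_itv/= !lte_fin.
rewrite ltr_pM2r ?invr_gt0// ltrD2r; case: ifP => _; last by rewrite mule0.
by rewrite -!EFinB -EFinM -mulrBl mulrCA mulfV ?gt_eqF// mulr1; congr EFin; ring.
Qed.

Lemma ge0_integral_affine (c b : R) (f : R -> \bar R) : 0 < c ->
  measurable_fun setT f -> (forall x, 0 <= f x)%E ->
  (\int[mu]_t f (c * t + b)%R = (c^-1)%:E * \int[mu]_t f t)%E.
Proof.
move=> c0 mf f0.
have ma : measurable_fun setT (fun t : R => c * t + b : measurableTypeR R)%R.
  by apply: measurable_funD => //; exact: measurable_funM.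
pose m0 : {measure set (measurableTypeR R) -> \bar R} :=
  measure_function_pushforward__canonical__measure_function_Measure mu ma.
pose m : {measure set (measurableTypeR R) -> \bar R} := mscale (NngNum (ltW c0)) m0.
have -> : (\int[mu]_t f t = \int[m]_t f t)%E.
  apply: eq_measure_integral => A mA _.
  exact/esym/lebesgue_measure_affine.
have := @ge0_integral_mscale _ _ _ m0 setT measurableT (NngNum (ltW c0)) f mf (fun x _ => f0 x).
have := @ge0_integral_pushforward _ _ (measurableTypeR R) (measurableTypeR R) _ _ ma mu setT f measurableT mf (fun x _ => f0 x).
rewrite preimage_setT => h1 h2; rewrite [X in (_ = _ * X)%E]h2 [X in (_ = _ * (_ * X))%E]h1.
by rewrite muleA -EFinM mulVf ?gt_eqF// mul1e.
Qed.

(** A positive finite factor distributes over the difference of the positive and negative parts even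
    when these are infinite, which settles the signed case. *)
Lemma integral_affine (c b : R) (f : R -> \bar R) : 0 < c ->
  measurable_fun setT f ->
  (\int[mu]_t f (c * t + b)%R = (c^-1)%:E * \int[mu]_t f t)%E.
Proof.
move=> c0 mf; rewrite [LHS]integralE [in RHS]integralE.
pose a := (fun t : R => c * t + b)%R.
have h1 : (\int[mu]_t (f \o a)^\+ t = (c^-1)%:E * \int[mu]_t f^\+ t)%E.
  rewrite funepos_comp.
  exact: (ge0_integral_affine b c0 (measurable_funepos mf) (fun x => funepos_ge0 f x)).
have h2 : (\int[mu]_t (f \o a)^\- t = (c^-1)%:E * \int[mu]_t f^\- t)%E.
  rewrite funeneg_comp.
  exact: (ge0_integral_affine b c0 (measurable_funeneg mf) (fun x => funeneg_ge0 f x)).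
transitivity ((c^-1)%:E * \int[mu]_t f^\+ t - (c^-1)%:E * \int[mu]_t f^\- t)%E.
  by congr (_ - _)%E; [exact: h1|exact: h2].
have k0 : (0 < (c^-1)%:E)%E by rewrite lte_fin invr_gt0.
case: (integral _ _ _) (integral _ _ _) => [x| |] [y| |] //=;
  rewrite ?(gt0_muley k0) ?(gt0_muleNy k0) -?EFinM -?EFinB -?EFinM ?mulrBr//=;
  by rewrite ?(gt0_muley k0) ?(gt0_muleNy k0).
Qed.

Lemma integral_opp (f : R -> \bar R) : measurable_fun setT f ->
  (\int[mu]_t f (- t)%R = \int[mu]_t f t)%E.
Proof.
have ge0 (g : R -> \bar R) : measurable_fun setT g -> (forall x, 0 <= g x)%E ->
    (\int[mu]_t g (- t)%R = \int[mu]_t g t)%E.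
  move=> mg g0.
  have mo : measurable_fun setT (-%R : R -> measurableTypeR R) by exact: oppr_measurable.
  pose m0 : {measure set (measurableTypeR R) -> \bar R} :=
    measure_function_pushforward__canonical__measure_function_Measure mu mo.
  have -> : (\int[mu]_t g t = \int[m0]_t g t)%E.
    by apply: eq_measure_integral => A mA _; rewrite /= lebesgue_measureN.
  have := @ge0_integral_pushforward _ _ (measurableTypeR R) (measurableTypeR R) _ _ mo mu setT g measurableT mg (fun x _ => g0 x).
  by rewrite preimage_setT => ->.
move=> mf; rewrite [LHS]integralE [in RHS]integralE; congr (_ - _)%E.
  rewrite -[LHS]/(\int[mu]_t (f \o -%R)^\+ t)%E funepos_comp.
  exact: (ge0 _ (measurable_funepos mf) (fun x => funepos_ge0 f x)).
rewrite -[LHS]/(\int[mu]_t (f \o -%R)^\- t)%E funeneg_comp.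
exact: (ge0 _ (measurable_funeneg mf) (fun x => funeneg_ge0 f x)).
Qed.

Lemma measurable_affine (c b : R) : measurable_fun setT (fun t : R => c * t + b).
Proof. by apply: measurable_funD => //; exact: measurable_funM. Qed.

Lemma Rint_affine (c b : R) (f : R -> R) : 0 < c -> measurable_fun setT f ->
  \int[mu]_t f (c * t + b)%R = c^-1 * \int[mu]_t f t.
Proof.
move=> c0 mf; rewrite /Rintegral (integral_affine b c0 (f := EFin \o f)); last exact/measurable_EFinP.
have [->|] := eqVneq (\int[mu]_t (EFin \o f) t)%E +oo%E.
  by rewrite gt0_muley ?lte_fin ?invr_gt0//= mulr0.
have [->|] := eqVneq (\int[mu]_t (EFin \o f) t)%E -oo%E.
  by rewrite gt0_muleNy ?lte_fin ?invr_gt0//= mulr0.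
by case: (\int[mu]_t (EFin \o f) t)%E.
Qed.

Lemma Rint_shift (b : R) (f : R -> R) : measurable_fun setT f ->
  \int[mu]_t f (t + b)%R = \int[mu]_t f t.
Proof.
move=> mf; rewrite -[RHS]mul1r -[in RHS]invr1 -(Rint_affine b _ mf)//.
by under [RHS]eq_Rintegral do rewrite mul1r.
Qed.

Lemma Rint_reflect (b : R) (f : R -> R) : measurable_fun setT f ->
  \int[mu]_t f (b - t)%R = \int[mu]_t f t.
Proof.
move=> mf; rewrite -[RHS](Rint_shift b)// /Rintegral.
rewrite -(integral_opp (f := fun t => (f (t + b))%:E)); last first.
  apply/measurable_EFinP; apply: measurableT_comp => //.
  exact: measurable_funD.
by congr fine; apply: eq_integral => t _; rewrite addrC.
Qed.

Lemma intg_affine (c b : R) (f : R -> R) : 0 < c -> intg mu f ->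
  intg mu (fun t => f (c * t + b)).
Proof.
move=> c0 /intgP[mf fi]; apply/intgP; split.
  by apply: measurableT_comp => //; exact: measurable_affine.
rewrite (integral_affine b c0 (f := fun t => `|f t|%:E)); last first.
  by apply/measurable_EFinP; exact: measurableT_comp.
by rewrite lte_mul_pinfty// lee_fin invr_ge0 ltW.
Qed.

Lemma intg_shift (b : R) (f : R -> R) : intg mu f -> intg mu (fun t => f (t + b)).
Proof.
by move=> fi; apply: eq_intg (intg_affine b ltr01 fi) => t; rewrite mul1r.
Qed.

End Change_of_variable.

Section Rint_total.
Context d (T : measurableType d) (R : realType).
Variable mu : {measure set T -> \bar R}.

(** The real integral sends infinite values to 0, and the extended integral of a measurable function
    is finite only if the function is integrable. This is what lets scalars come out in [RintZm] for
    every measurable function. *)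
Lemma Rint_nonintg (f : T -> R) : measurable_fun setT f -> ~ intg mu f ->
  \int[mu]_x f x = 0.
Proof.
move=> mf nf; rewrite /Rintegral; case E : (integral _ _ _) => [r| |]//=.
exfalso; apply: nf; apply/integrableP; split; first exact/measurable_EFinP.
have /abse_integralP : measurable_fun setT (EFin \o f) by exact/measurable_EFinP.
move=> /(_ mu measurableT) [+ _]; apply.
by rewrite E ltry.
Qed.

Lemma RintZm k (f : T -> R) : measurable_fun setT f ->
  \int[mu]_x (k * f x) = k * \int[mu]_x f x.
Proof.
move=> mf; have [fi|nf] := pselect (intg mu f); first exact: RintZ.
have [->|k0] := eqVneq k 0.
  by rewrite mul0r; under eq_Rintegral do rewrite mul0r; rewrite Rintegral_cst// mul0r.
rewrite (Rint_nonintg mf nf) mulr0 Rint_nonintg//.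
  exact: measurable_funM.
move=> kf; apply: nf; apply: eq_intg (intgZ k^-1 kf) => x.
by rewrite mulrA mulVf// mul1r.
Qed.

Lemma RintMr k (f : T -> R) : measurable_fun setT f ->
  \int[mu]_x (f x * k) = \int[mu]_x f x * k.
Proof.
by move=> mf; rewrite mulrC -RintZm//; apply: eq_Rintegral => x _; rewrite mulrC.
Qed.

End Rint_total.

(** The integral is over the whole line; for a kernel and a function both supported in t > 0 it is
    the usual convolution over (0, t). *)
HB.lock Definition conv {R : realType} (k g : R -> R) (t : R) : R :=
  \int[@lebesgue_measure R]_s (k (t - s) * g s).

Section Convolution.
Context {R : realType}.
Local Notation mu := (@lebesgue_measure R).
Implicit Types k g p q : R -> R.

Lemma convE k g : conv k g = fun t => \int[mu]_s (k (t - s) * g s).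
Proof. by rewrite unlock. Qed.

Lemma measurable_sub2 : measurable_fun setT (fun z : R * R => z.1 - z.2).
Proof. by apply: measurable_funB; [exact: measurable_fst|exact: measurable_snd]. Qed.

Lemma measurable_convM p q : measurable_fun setT p -> measurable_fun setT q ->
  measurable_fun setT (fun z : R * R => p (z.1 - z.2) * q z.2).
Proof.
move=> mp mq; apply: measurable_funM.
  by apply: measurableT_comp => //; exact: measurable_sub2.
by apply: measurableT_comp => //; exact: measurable_snd.
Qed.

Lemma measurable_conv1 p q t : measurable_fun setT p -> measurable_fun setT q ->
  measurable_fun setT (fun s : R => p (t - s) * q s).
Proof.
move=> mp mq; apply: measurable_funM => //.
by apply: measurableT_comp => //; exact: measurable_funB.
Qed.

Lemma measurable_conv p q : measurable_fun setT p -> measurable_fun setT q ->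
  measurable_fun setT (conv p q).
Proof.
move=> mp mq; rewrite convE.
exact: (measurable_Rint2 mu (f := fun z : R * R => p (z.1 - z.2) * q z.2) (measurable_convM mp mq)).
Qed.

Lemma ge0_integral_conv p q : measurable_fun setT p -> measurable_fun setT q ->
  (forall t, 0 <= p t) -> (forall t, 0 <= q t) ->
  (\int[mu]_t \int[mu]_s (p (t - s) * q s)%:E =
   (\int[mu]_t (p t)%:E) * (\int[mu]_t (q t)%:E))%E.
Proof.
move=> mp mq p0 q0.
transitivity (\int[mu]_s \int[mu]_t (p (t - s) * q s)%:E)%E.
  apply: (Rtonelli mu mu (measurable_convM mp mq)).
  by move=> z; rewrite mulr_ge0.
rewrite muleC -ge0_integralZr//; last 3 first.
  exact/measurable_EFinP.
  by move=> t _; rewrite lee_fin.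
  by apply: integral_ge0 => t _; rewrite lee_fin.
apply: eq_integral => s _.
under eq_integral do rewrite mulrC EFinM.
rewrite ge0_integralZl//; last 3 first.
  apply/measurable_EFinP; apply: measurableT_comp => //; exact: measurable_funB.
  by move=> t _; rewrite lee_fin.
  by rewrite lee_fin.
congr (_ * _)%E.
have := integral_affine (- s) ltr01 (f := EFin \o p).
rewrite invr1 mul1e => <-; last exact/measurable_EFinP.
by apply: eq_integral => t _ /=; rewrite mul1r.
Qed.

Lemma conv_prod_intg p q : intg mu p -> intg mu q ->
  intg (mu \x mu)%E (fun z : R * R => p (z.1 - z.2) * q z.2).
Proof.
move=> /intgP[mp ip] /intgP[mq iq]; apply: prod_intgP; first exact: measurable_convM.
have /= := ge0_integral_conv (measurableT_comp (@normr_measurable R setT) mp)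
  (measurableT_comp (@normr_measurable R setT) mq) (fun=> normr_ge0 _) (fun=> normr_ge0 _).
under eq_integral do under eq_integral do rewrite -normrM.
move=> ->; rewrite lte_mul_pinfty//.
  by apply: integral_ge0 => t _; rewrite lee_fin.
by rewrite ge0_fin_numE//; apply: integral_ge0 => t _; rewrite lee_fin.
Qed.

Lemma intg_conv p q : intg mu p -> intg mu q -> intg mu (conv p q).
Proof. by move=> ip iq; rewrite convE; exact: (intg_Rint2 (conv_prod_intg ip iq)). Qed.

Lemma Rint_conv p q : intg mu p -> intg mu q ->
  \int[mu]_t conv p q t = (\int[mu]_t p t) * (\int[mu]_t q t).
Proof.
move=> ip iq; rewrite convE (Rint_fubini (conv_prod_intg ip iq))/=.
have [mp mq] := (intg_measurable ip, intg_measurable iq).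
rewrite mulrC -RintMr//; apply: eq_Rintegral => s _.
rewrite RintMr; last by apply: measurableT_comp => //; exact: measurable_funB.
by rewrite mulrC (Rint_shift (- s) mp).
Qed.

Lemma conv_intg_ae p q : intg mu p -> intg mu q ->
  {ae mu, forall t, intg mu (fun s => p (t - s) * q s)}.
Proof. by move=> ip iq; exact: (prod_intg_ae (conv_prod_intg ip iq)). Qed.

(** Only for almost every t: the interchange in the double integral needs the convolution of |p|
    with that of |q| and |g| to be finite at t. *)
Lemma conv_assoc p q g : intg mu p -> intg mu q -> intg mu g ->
  {ae mu, forall t, conv p (conv q g) t = conv (conv p q) g t}.
Proof.
move=> ip iq ig.
have ip' := intg_norm ip; have iq' := intg_norm iq; have ig' := intg_norm ig.
have [mp [mq mg]] := (intg_measurable ip, (intg_measurable iq, intg_measurable ig)).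
have h1 := conv_intg_ae ip' (intg_conv iq' ig').
apply: (aeS h1) => t h.
pose F (z : R * R) := p (t - z.1) * (q (z.1 - z.2) * g z.2).
have mF : measurable_fun setT F.
  apply: measurable_funM; last exact: measurable_convM.
  by apply: measurableT_comp => //; apply: measurable_funB => //; exact: measurable_fst.
have iF : intg (mu \x mu)%E F.
  apply: prod_intgP => //.
  have /intgP[_] := h; apply: le_lt_trans.
  apply: ae_ge0_le_integral => //.
  - by move=> s _; apply: integral_ge0 => r _; rewrite lee_fin.
  - apply: (measurable_integral2 mu (f := fun z => `|F z|%:E)).
    by apply/measurable_EFinP; exact: measurableT_comp.
  - apply/measurable_EFinP; apply: measurableT_comp => //.
    apply: (@measurable_conv1 (fun x => `|p x|)); first exact: measurableT_comp.
    by apply: measurable_conv; exact: measurableT_comp.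
  (* The real convolution of |q| and |g| agrees with the extended inner integral where the latter is
     finite, that is for almost every s. *)
  apply: (aeS (conv_intg_ae iq' ig')) => s hs _.
  rewrite normrM normr_id EFinM convE ger0_norm; last first.
    by apply: Rintegral_ge0 => r _; rewrite mulr_ge0.
  rewrite (EFin_Rint hs).
  have -> : (\int[mu]_r `|F (s, r)|%:E =
      \int[mu]_r (`|p (t - s)|%:E * (`|q (s - r)| * `|g r|)%:E))%E.
    by apply: eq_integral => r _; rewrite /F/= !normrM.
  rewrite (ge0_integralZl _ measurableT)//.
  exact: (measurable_int _ hs).
transitivity (\int[mu]_s \int[mu]_r F (s, r)).
  by rewrite !convE; apply: eq_Rintegral => s _; rewrite /F/= RintZm//; exact: measurable_conv1.
rewrite (Rint_fubini iF) !convE; apply: eq_Rintegral => r _.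
rewrite /F/=.
have m1 : measurable_fun setT (fun s : R => p (t - r - s) * q s).
  exact: measurable_conv1.
(* Translating s by r turns the inner integral into the convolution of [p] and [q] at t - r. *)
rewrite -RintMr// -[RHS](Rint_shift (- r)).
  by apply: eq_Rintegral => s _; rewrite (_ : t - r - (s - r) = t - s) ?mulrA//; ring.
by apply: measurable_funM.
Qed.

End Convolution.

(** * The Gamma function and the kernels of fractional integration *)

Section Gamma_function.
Context {R : realType}.
Local Notation mu := (@lebesgue_measure R).

Definition Gdensity (a s : R) : R := (0 < s)%R%:R * (s `^ (a - 1) * expR (- s)).

Lemma measurable_pos : measurable_fun setT (fun s : R => (0 < s)%R%:R : R).
Proof.
rewrite (_ : (fun s : R => _) = \1_(`]0, +oo[)).
  by apply: measurable_indic; exact: measurable_itv.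
by apply/funext => t; rewrite indicE mem_setE in_itv/= andbT.
Qed.

Lemma measurable_powRr (a : R) : measurable_fun setT (fun s : R => s `^ a).
Proof. exact: measurable_powR. Qed.

Lemma measurable_Gdensity a : measurable_fun setT (Gdensity a).
Proof.
apply: measurable_funM; first exact: measurable_pos.
apply: measurable_funM; first exact: measurable_powRr.
by apply: measurableT_comp.
Qed.

Lemma Gdensity_ge0 a s : 0 <= Gdensity a s.
Proof. by rewrite mulr_ge0// mulr_ge0 ?powR_ge0 ?expR_ge0. Qed.

Lemma GammaE a : Gamma a = \int[mu]_s Gdensity a s.
Proof.
rewrite /Gamma Rintegral_mkcond; apply: eq_Rintegral => s _.
rewrite patchE mem_setE in_itv/= andbT /Gdensity.
by case: ifP; rewrite ?mul1r ?mul0r.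
Qed.

(** Monotone exhaustion by the intervals [1/(i+1), 1], on each of which the primitive s^a / a gives
    at most 1/a. *)
Lemma integral_powR_near0 a : 0 < a ->
  (\int[mu]_(s in `]0%R, 1%R]) (s `^ (a - 1))%:E <= (a^-1)%:E)%E.
Proof.
move=> a0.
pose F (i : nat) : set R := `[i.+1%:R^-1, 1]%classic.
have FU : \bigcup_i F i = `]0, 1]%classic.
  apply/seteqP; split => x.
    move=> [i _]; rewrite /F/= !in_itv/= => /andP[ix ->]; rewrite andbT.
    by apply: lt_le_trans ix; rewrite invr_gt0.
  rewrite /= in_itv/= => /andP[x0 x1]; exists (Num.trunc x^-1) => //.
  rewrite /F/= in_itv/= x1 andbT invf_ple ?posrE//.
  by have /truncn_itv/andP[_ /ltW] : 0 <= x^-1 by rewrite invr_ge0 ltW.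
have ndF : nondecreasing_seq F.
  move=> i j ij; apply/subsetPset => x; rewrite /F/= !in_itv/= => /andP[ix ->].
  by rewrite andbT (le_trans _ ix)// lef_pV2 ?posrE// ler_nat.
have := @ge0_nondecreasing_set_cvg_integral _ (measurableTypeR R) R F (fun s => (s `^ (a - 1))%:E) mu ndF.
rewrite FU => h.
have /h {}h : forall i, measurable (F i) by move=> i; exact: measurable_itv.
have /h {}h : forall i, measurable_fun (F i) (fun s => (s `^ (a - 1))%:E).
  move=> i; apply: measurable_funTS; apply/measurable_EFinP; exact: measurable_powRr.
have /h {}h : forall i x, F i x -> (0 <= (x `^ (a - 1))%:E)%E.
  by move=> i x _; rewrite lee_fin powR_ge0.
rewrite -(cvg_lim _ h)//; apply: lime_le; first by apply/cvg_ex; eexists; exact: h.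
apply: nearW => i.
(* For i = 0 the interval degenerates to a point, where the fundamental theorem does not apply. *)
have [->|i0] := eqVneq i 0%N.
  by rewrite /F invr1 set_itv1 integral_set1 lee_fin invr_ge0 ltW.
have i1 : i.+1%:R^-1 < 1 :> R by rewrite invf_lt1// ltr1n ltnS lt0n.
rewrite (@continuous_FTC2 _ _ (fun s => a^-1 * s `^ a))//.
- by rewrite powR1 mulr1 -EFinB lee_fin gerBl mulr_ge0 ?powR_ge0// invr_ge0 ltW.
- have c0 : 0 < i.+1%:R^-1 :> R by rewrite invr_gt0.
  apply: derivable_within_continuous => x; rewrite in_itv/= => /andP[cx _].
  by apply: derivable_powR; rewrite in_itv/= andbT (lt_le_trans c0).
- have c0 : 0 < i.+1%:R^-1 :> R by rewrite invr_gt0.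
  have d x : 0 < x -> derivable (fun s => a^-1 * s `^ a) x 1.
    by move=> x0; apply: derivableM => //; apply: derivable_powR; rewrite in_itv/= andbT.
  have cF x : 0 < x -> {for x, continuous (fun s => a^-1 * s `^ a)}.
    by move=> /d /derivable1_diffP /differentiable_continuous.
  split.
  + by move=> x; rewrite in_itv/= => /andP[cx _]; apply: d; exact: lt_trans cx.
  + by apply: cvg_at_right_filter; exact: cF.
  + by apply: cvg_at_left_filter; exact: cF.
- have c0 : 0 < i.+1%:R^-1 :> R by rewrite invr_gt0.
  move=> x; rewrite in_itv/= => /andP[cx _].
  have x0 : 0 < x by exact: lt_trans cx.
  rewrite derive1E deriveM//; last by apply: derivable_powR; rewrite in_itv/= andbT.
  rewrite derive_cst scaler0 addr0 -derive1E powR_derive1 ?in_itv/= ?andbT//.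
  by rewrite /GRing.scale/= mulrA mulVf ?gt_eqF// mul1r.
Qed.

(** The density is compared with s^{a-1} on (0, 1] and with an exponential beyond; the bound a <= 2
    covers every order that occurs and gives s^{a-1} <= s for s > 1. *)
Lemma intg_Gdensity (a : R) : 0 < a -> a <= 2 -> intg mu (Gdensity a).
Proof.
move=> a0 a2; apply/intgP; split; first exact: measurable_Gdensity.
pose h1 (s : R) := ((fun s => s `^ (a - 1)) \_ `]0, 1]) s.
(* For s > 1, s e^{-s} <= 2 e^{-s/2} because e^{s/2} >= 1 + s/2, and 2 e^{-s/2} is four times the
   exponential density of rate 1/2. *)
pose h2 (s : R) := 4 * exponential_pdf (2^-1 : R) s.
have m1 : measurable_fun setT h1.
  apply/(measurable_restrictT (fun s : R => s `^ (a - 1)) (measurable_itv `]0, 1])).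
  by apply: measurable_funTS; exact: measurable_powRr.
have m2 : measurable_fun setT h2.
  by apply: measurable_funM => //; exact: measurable_exponential_pdf.
have h10 s : 0 <= h1 s by rewrite /h1 patchE; case: ifP => // _; exact: powR_ge0.
have h20 s : 0 <= h2 s by rewrite mulr_ge0// exponential_pdf_ge0.
apply: (@le_lt_trans _ _ (\int[mu]_s ((h1 s)%:E + (h2 s)%:E))%E).
  apply: ge0_le_integral => //.
  - by apply/measurable_EFinP; apply: measurableT_comp => //; exact: measurable_Gdensity.
  - by apply: emeasurable_funD; exact/measurable_EFinP.
  suff key (s : R) : Gdensity a s <= h1 s + h2 s.
    by move=> s _; rewrite -EFinD lee_fin ger0_norm ?Gdensity_ge0.
  rewrite /Gdensity; have [s0|s0] := ltP 0 s; last by rewrite mul0r addr_ge0.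
  rewrite mul1r; have [s1|s1] := leP s 1.
    apply: ler_wpDr => //; rewrite /h1 patchE mem_setE in_itv/= s0 s1.
    by rewrite ler_piMr ?powR_ge0// expR_le1 oppr_le0 ltW.
  apply: ler_wpDl => //; rewrite /h2 exponential_pdfE; last exact: ltW.
  apply: (@le_trans _ _ (s * expR (- s))).
    rewrite ler_wpM2r ?expR_ge0// -[leRHS]powRr1 ?(ltW s0)//.
    by apply: ler_powR; [exact: ltW|lra].
  rewrite mulrA (_ : 4 * 2^-1 = 2 :> R); last by lra.
  rewrite (_ : - s = s * - 2^-1 + (- 2^-1 * s)); last by lra.
  rewrite expRD mulrA ler_wpM2r ?expR_ge0// mulrN expRN ler_pdivrMr ?expR_gt0//.
  have := expR_ge1Dx (s * 2^-1); lra.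
rewrite ge0_integralD//; last 4 first.
- by move=> s _; rewrite lee_fin.
- exact/measurable_EFinP.
- by move=> s _; rewrite lee_fin.
- exact/measurable_EFinP.
apply: lte_add_pinfty.
  apply: le_lt_trans (ltry a^-1); apply: le_trans (integral_powR_near0 a0).
  rewrite [leRHS]integral_mkcond.
  rewrite le_eqVlt; apply/orP; left; apply/eqP; apply: eq_integral => s _.
  by rewrite /h1 !patchE; case: ifP.
have h2p : 0 < 2^-1 :> R by rewrite invr_gt0.
have /intgP[_] := intgZ 4 (@integrable_exponential_pdf R 2^-1 h2p).
by apply: le_lt_trans; apply: ge0_le_integral => //; [
   by move=> s _; rewrite lee_fin | exact/measurable_EFinP |
   by apply/measurable_EFinP; exact: measurableT_comp |
   by move=> s _; rewrite lee_fin ler_norm].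
Qed.

(** Were the integral 0, the nonnegative density would vanish almost everywhere, but it is positive
    on (0, 1], a set of positive measure. *)
Lemma Gamma_gt0 (a : R) : 0 < a -> a <= 2 -> 0 < Gamma a :> R.
Proof.
move=> a0 a2; have iG := intg_Gdensity a0 a2.
rewrite lt_neqAle; apply/andP; split; last first.
  by rewrite GammaE; apply: Rintegral_ge0 => s _; exact: Gdensity_ge0.
apply/eqP => G0.
have : (\int[mu]_s (Gdensity a s)%:E = 0)%E.
  by rewrite -EFin_Rint// -GammaE -G0.
have -> : (\int[mu]_s (Gdensity a s)%:E = \int[mu]_s `|(Gdensity a s)%:E|)%E.
  by apply: eq_integral => s _; rewrite /= ger0_norm// Gdensity_ge0.
move=> /(ae_eq_integral_abs mu measurableT (f := EFin \o Gdensity a)).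
have mG : measurable_fun setT (EFin \o Gdensity a).
  by apply/measurable_EFinP; exact: measurable_Gdensity.
move=> /(_ mG)[N [mN N0 NG]].
have : (mu `]0%R, 1%R] <= mu N)%E.
  apply: le_measure; rewrite ?inE//.
  apply: subset_trans NG => s; rewrite /= in_itv/= => /andP[s0 _] /(_ I) /= /eqP.
  by rewrite eqe /Gdensity s0 mul1r mulf_eq0 powR_eq0 (gt_eqF s0)/= gt_eqF// expR_gt0.
by rewrite N0 lebesgue_measure_itv/= lte_fin ltr01 -EFinB subr0 lee_fin ler10.
Qed.

End Gamma_function.

(* The kernel of the Riemann-Liouville integral I^a. *)
HB.lock Definition fk {R : realType} (a t : R) : R :=
  (0 < t)%R%:R * (t `^ (a - 1) / Gamma a).

HB.lock Definition ew {R : realType} (l : R) (p : R -> R) (t : R) : R :=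
  expR (- (l * t)) * p t.

Section Fractional_kernel.
Context {R : realType}.
Local Notation mu := (@lebesgue_measure R).
Implicit Types p q g : R -> R.

Lemma fkE (a : R) : fk a = fun t => (0 < t)%R%:R * (t `^ (a - 1) / Gamma a).
Proof. by rewrite unlock. Qed.

Lemma ewE (l : R) p : ew l p = fun t => expR (- (l * t)) * p t.
Proof. by rewrite unlock. Qed.

Definition causal p := forall t, t <= 0 -> p t = 0.

Lemma causal_fk (a : R) : causal (fk a).
Proof. by move=> t; rewrite leNgt fkE => /negbTE ->; rewrite mul0r. Qed.

Lemma measurable_fk (a : R) : measurable_fun setT (fk a).
Proof.
rewrite fkE; apply: measurable_funM; first exact: measurable_pos.
by apply: measurable_funM => //; exact: measurable_powRr.
Qed.

Lemma measurable_ew l p : measurable_fun setT p -> measurable_fun setT (ew l p).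
Proof. by move=> mp; rewrite ewE; apply: measurable_funM => //; exact: measurable_expRl. Qed.

Lemma fk_ge0 (a t : R) : 0 < a -> a <= 2 -> 0 <= fk a t.
Proof.
by move=> a0 a2; rewrite fkE mulr_ge0// divr_ge0 ?powR_ge0// ltW// Gamma_gt0.
Qed.

(** Homogeneity of t^{a-1}: the damped kernel is the Gamma density rescaled by l, so its transform
    reduces to the Gamma integral. *)
Lemma ew_fk (l a t : R) : 0 < l -> ew l (fk a) t = l `^ (1 - a) / Gamma a * Gdensity a (l * t).
Proof.
move=> l0; rewrite ewE fkE /Gdensity pmulr_rgt0//.
have [t0|_] := ltP 0 t; last by rewrite !(mul0r, mulr0).
rewrite !mul1r powRM ?(ltW l0) ?(ltW t0)//.
have -> : l `^ (1 - a) / Gamma a * (l `^ (a - 1) * t `^ (a - 1) * expR (- (l * t))) =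
  (l `^ (1 - a) * l `^ (a - 1)) * (expR (- (l * t)) * (t `^ (a - 1) / Gamma a)) by ring.
rewrite -powRD; last by rewrite (gt_eqF l0) implybT.
by rewrite (_ : 1 - a + (a - 1) = 0) ?powRr0 ?mul1r//; ring.
Qed.

Lemma intg_ew_fk (l a : R) : 0 < l -> 0 < a -> a <= 2 -> intg mu (ew l (fk a)).
Proof.
move=> l0 a0 a2.
have h : intg mu (fun t => l `^ (1 - a) / Gamma a * Gdensity a (l * t + 0)).
  exact: (intgZ _ (intg_affine 0 l0 (intg_Gdensity a0 a2))).
by apply: eq_intg h => t; rewrite addr0 ew_fk.
Qed.

Lemma laplace_fk (l a : R) : 0 < l -> 0 < a -> a <= 2 ->
  \int[mu]_t ew l (fk a) t = l `^ (- a).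
Proof.
move=> l0 a0 a2.
transitivity (\int[mu]_t (l `^ (1 - a) / Gamma a * Gdensity a (l * t + 0))).
  by apply: eq_Rintegral => t _; rewrite addr0 ew_fk.
rewrite RintZm; last first.
  by apply: measurableT_comp (measurable_affine l 0); exact: measurable_Gdensity.
rewrite Rint_affine//; last exact: measurable_Gdensity.
rewrite -GammaE mulrCA -mulrA mulVf ?mulr1 ?gt_eqF ?Gamma_gt0//.
rewrite -powR_inv1 ?(ltW l0)// -powRD; last by rewrite (gt_eqF l0) implybT.
by congr powR; ring.
Qed.

Lemma ew_conv l p q t : measurable_fun setT p -> measurable_fun setT q ->
  conv (ew l p) (ew l q) t = ew l (conv p q) t.
Proof.
move=> mp mq; rewrite !convE !ewE -RintZm; last exact: measurable_conv1.
apply: eq_Rintegral => s _.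
rewrite mulrACA -expRD; congr (expR _ * _); ring.
Qed.

Lemma causal_conv p q : causal p -> causal q -> causal (conv p q).
Proof.
move=> cp cq t t0; rewrite convE.
transitivity (\int[mu]_(s in setT) (0 : R)); last by rewrite Rintegral_cst// mul0r.
apply: eq_Rintegral => s _; have [s0|s0] := leP s 0.
  by rewrite cq// mulr0.
by rewrite cp ?mul0r//; lra.
Qed.

(** A causal kernel sees only the past; this lets a function that is merely locally integrable be
    truncated without changing the values up to the truncation time. *)
Lemma eq_conv_causal p q q' t : causal p -> (forall s, s < t -> q s = q' s) ->
  conv p q t = conv p q' t.
Proof.
move=> cp qq; rewrite !convE; apply: eq_Rintegral => s _.
have [st|ts] := ltP s t; first by rewrite qq.
by rewrite cp ?mul0r//; rewrite subr_le0.
Qed.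

Lemma intg_ew_conv l p q : intg mu (ew l p) -> intg mu (ew l q) ->
  measurable_fun setT p -> measurable_fun setT q ->
  intg mu (ew l (conv p q)).
Proof.
move=> ip iq mp mq; apply: eq_intg (intg_conv ip iq) => t; exact: ew_conv.
Qed.

Lemma laplace_conv l p q : intg mu (ew l p) -> intg mu (ew l q) ->
  measurable_fun setT p -> measurable_fun setT q ->
  \int[mu]_t ew l (conv p q) t = (\int[mu]_t ew l p t) * (\int[mu]_t ew l q t).
Proof.
move=> ip iq mp mq; rewrite -Rint_conv//.
by apply: eq_Rintegral => t _; rewrite ew_conv.
Qed.

Lemma fkM (a t r : R) : 0 < t -> fk a (t * r) = t `^ (a - 1) * fk a r.
Proof.
move=> t0; rewrite !fkE pmulr_rgt0//; have [r0|_] := ltP 0 r; last by rewrite !mul0r mulr0.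
by rewrite !mul1r powRM ?ltW// mulrA.
Qed.

(** The Beta integral is never computed. By homogeneity both sides are multiples of t^{a+b-1}, and
    comparing Laplace transforms at 1, where every kernel has transform 1, shows that the factor is
    1. *)
Lemma conv_fk (a b t : R) : 0 < a -> 0 < b -> a + b <= 2 ->
  conv (fk a) (fk b) t = fk (a + b) t.
Proof.
move=> a0 b0 ab2.
have [a2 b2] : a <= 2 /\ b <= 2 by split; lra.
have ab0 : 0 < a + b by rewrite addr_gt0.
pose C := conv (fk a) (fk b) 1.
have cE s : conv (fk a) (fk b) s = C * Gamma (a + b) * fk (a + b) s.
  have [s0|s0] := leP s 0.
    by rewrite (causal_conv (@causal_fk a) (@causal_fk b))// causal_fk// mulr0.
  have -> : C * Gamma (a + b) * fk (a + b) s = C * s `^ (a + b - 1).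
    by rewrite fkE s0 mul1r; field; rewrite gt_eqF// Gamma_gt0.
  have m0 : measurable_fun setT (fun r : R => fk a (s - r) * fk b r).
    by apply: measurable_conv1; exact: measurable_fk.
  have e0 : conv (fk a) (fk b) s = s * \int[mu]_r (fk a (s - (s * r + 0)) * fk b (s * r + 0)).
    by rewrite convE (Rint_affine 0 s0 m0) mulrA mulfV ?gt_eqF// mul1r.
  rewrite e0.
  transitivity (s * \int[mu]_r (s `^ (a - 1) * s `^ (b - 1) * (fk a (1 - r) * fk b r))).
    congr (_ * _); apply: eq_Rintegral => r _.
    rewrite addr0 (_ : s - s * r = s * (1 - r)); last by ring.
    by rewrite !fkM// mulrACA.
  rewrite RintZm; last by apply: measurable_conv1; exact: measurable_fk.
  rewrite /C convE mulrA mulrC; congr (_ * _).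
  rewrite -{1}(powRr1 (ltW s0)) -!powRD ?(gt_eqF s0) ?implybT//.
  by congr powR; ring.
rewrite cE; suff -> : C * Gamma (a + b) = 1 by rewrite mul1r.
have <- : \int[mu]_t ew 1 (conv (fk a) (fk b)) t = 1.
  rewrite (laplace_conv (intg_ew_fk ltr01 a0 a2) (intg_ew_fk ltr01 b0 b2) (measurable_fk a) (measurable_fk b)).
  by rewrite (laplace_fk ltr01 a0 a2) (laplace_fk ltr01 b0 b2) !powR1 mulr1.
transitivity (\int[mu]_s (C * Gamma (a + b) * ew 1 (fk (a + b)) s)).
  rewrite RintZm; last by apply: measurable_ew; exact: measurable_fk.
  by rewrite laplace_fk// powR1 mulr1.
by apply: eq_Rintegral => s _; rewrite !ewE cE mulrCA.
Qed.

Lemma ew_inj l p q t : ew l p t = ew l q t -> p t = q t.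
Proof. by rewrite !ewE => /(mulfI (lt0r_neq0 (expR_gt0 _))). Qed.

Definition trunc_at (T : R) g (s : R) := (s <= T)%R%:R * g s.

Lemma trunc_atE T g s : s <= T -> trunc_at T g s = g s.
Proof. by rewrite /trunc_at => ->; rewrite mul1r. Qed.

Lemma measurable_le_ind (T : R) : measurable_fun setT (fun s : R => (s <= T)%R%:R : R).
Proof.
rewrite (_ : (fun s : R => _) = \1_(`]-oo, T])).
  by apply: measurable_indic; exact: measurable_itv.
by apply/funext => t; rewrite indicE mem_setE in_itv/=.
Qed.

Lemma measurable_trunc T g : measurable_fun setT g -> measurable_fun setT (trunc_at T g).
Proof. by move=> mg; apply: measurable_funM => //; exact: measurable_le_ind. Qed.

Lemma intg_ew_trunc l T g : 0 <= l -> causal g -> intg mu (trunc_at T g) ->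
  intg mu (ew l (trunc_at T g)).
Proof.
move=> l0 cg ig.
have h : intg mu (fun t => trunc_at T g t * expR (- (l * t))).
  apply: (@intgMbd _ _ _ _ _ _ 1 ig); first exact: measurable_expRl.
  move=> t gt; rewrite ger0_norm ?expR_ge0// expR_le1 oppr_le0 mulr_ge0//.
  rewrite leNgt; apply: contra gt => /ltW /cg; rewrite /trunc_at => ->.
  by rewrite mulr0.
by apply: eq_intg h => t; rewrite ewE mulrC.
Qed.

(** Associativity of convolution, applied after truncating [g] at n + 1 and damping by e^{-t}, which
    makes the kernels integrable. Truncation is invisible up to time n + 1, and countably many null
    sets cover all t. *)
Lemma frac_semigroup (a b : R) g : 0 < a -> 0 < b -> a + b <= 2 ->
  measurable_fun setT g -> causal g ->
  (forall T, 0 < T -> intg mu (trunc_at T g)) ->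
  {ae mu, forall t, conv (fk a) (conv (fk b) g) t = conv (fk (a + b)) g t}.
Proof.
move=> a0 b0 ab2 mg cg ig.
have [a2 b2] : a <= 2 /\ b <= 2 by split; lra.
have h (n : nat) : {ae mu, forall t, t <= n.+1%:R ->
    conv (fk a) (conv (fk b) g) t = conv (fk (a + b)) g t}.
  pose gn := trunc_at n.+1%:R g.
  have ign : intg mu gn by exact: ig.
  have mgn : measurable_fun setT gn by exact: measurable_trunc.
  have mb : measurable_fun setT (conv (fk b) gn).
    by apply: measurable_conv => //; exact: measurable_fk.
  have E1 : conv (ew 1 (fk b)) (ew 1 gn) = ew 1 (conv (fk b) gn).
    by apply/funext => s; apply: ew_conv => //; exact: measurable_fk.
  have E2 : conv (ew 1 (fk a)) (ew 1 (fk b)) = ew 1 (fk (a + b)).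
    have -> : fk (a + b) = conv (fk a) (fk b).
      by apply/funext => s; rewrite conv_fk.
    by apply/funext => s; apply: ew_conv; exact: measurable_fk.
  have := conv_assoc (intg_ew_fk ltr01 a0 a2) (intg_ew_fk ltr01 b0 b2)
    (intg_ew_trunc ler01 cg ign).
  rewrite -/gn E1 E2 => /aeS; apply => t.
  rewrite (ew_conv 1 t (measurable_fk a) mb) (ew_conv 1 t (measurable_fk (a + b)) mgn).
  move=> /ew_inj e tn.
  have gng r : r < t -> gn r = g r.
    by move=> rt; rewrite /gn trunc_atE// (le_trans (ltW rt)).
  rewrite -(eq_conv_causal (@causal_fk (a + b)) gng) -e.
  apply: (eq_conv_causal (@causal_fk a)) => s st.
  apply: (eq_conv_causal (@causal_fk b)) => r rs.
  by rewrite gng// (lt_trans rs).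
have := ae_foralln h; move=> /aeS; apply => t ht.
apply: (ht (Num.trunc `|t|)).
apply: le_trans (ler_norm t) _.
by have /truncn_itv/andP[_ /ltW] : 0 <= `|t| by [].
Qed.

Lemma Gamma1 : Gamma 1 = 1 :> R.
Proof.
rewrite GammaE -[RHS]/(fine 1%:E) -(@integral_exponential_pdf R 1 ltr01).
rewrite /Rintegral; congr fine; apply: ae_eq_integral => //.
- by apply/measurable_EFinP; exact: measurable_Gdensity.
- by apply/measurable_EFinP; exact: measurable_exponential_pdf.
apply: (aeS (ae_neq 0)) => s s0 _; congr EFin; rewrite /Gdensity subrr powRr0 mul1r.
have [s_gt0|s_le0] := ltP 0 s.
  by rewrite exponential_pdfE ?ltW// !mul1r mulN1r.
by rewrite mul0r lt0_exponential_pdf// lt_neqAle s_le0 andbT.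
Qed.

Lemma fk1 (t : R) : fk 1 t = (0 < t)%R%:R.
Proof. by rewrite fkE Gamma1 subrr powRr0 divr1 mulr1. Qed.

End Fractional_kernel.

(** * Caputo derivatives of sections *)

Section Order_ceil.
Context {R : realType}.

Lemma order_ceil1 (nu : R) : 0 < nu -> nu <= 1 -> order_ceil nu = 1%N.
Proof.
move=> n0 n1; rewrite /order_ceil.
have -> : Num.ceil nu = 1 by apply/ceil_def; rewrite intrB subrr n0.
by [].
Qed.

Lemma order_ceil2 (nu : R) : 1 < nu -> nu <= 2 -> order_ceil nu = 2%N.
Proof.
move=> n0 n1; rewrite /order_ceil.
have -> : Num.ceil nu = 2.
  apply/ceil_def; rewrite n1 andbT (_ : 2 - 1 = 1)//.
by [].
Qed.

End Order_ceil.

Section Primitive.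
Context {R : realType}.
Local Notation mu := (@lebesgue_measure R).
Implicit Types phi psi G D : R -> R.

Lemma intg_mkcond (i : interval R) D :
  mu.-integrable [set` i] (EFin \o D) -> intg mu (D \_ [set` i]).
Proof.
have [+ _] := @integrable_mkcond _ _ _ mu [set` i] (EFin \o D) (measurable_itv i).
by move=> /[apply]; rewrite restrict_EFin.
Qed.

Lemma trunc_restrict G D T : 0 < T -> measurable_fun setT G -> causal G ->
  {ae mu, forall t, 0 < t -> D t = G t} ->
  mu.-integrable `]0, T] (EFin \o D) -> intg mu (trunc_at T G).
Proof.
move=> T0 mG cG DG iD.
have iD' : intg mu (D \_ `]0, T]).
  exact: intg_mkcond.
apply: (intg_ae _ _ iD'); first exact: measurable_trunc.
apply: (aeS DG) => t Dt; rewrite patchE mem_setE in_itv/= /trunc_at.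
have [t0|t0] := ltP 0 t; last by rewrite /= cG// mulr0.
by rewrite /=; case: ifP => tT; rewrite ?mul0r// mul1r Dt.
Qed.

(** The integral formula for [psi] holds between positive times only; integrability of [D] up to 0
    yields the limit at 0 by dominated convergence along arbitrary sequences. *)
Lemma primitive_limit psi G D : measurable_fun setT G -> causal G ->
  {ae mu, forall t, 0 < t -> D t = G t} ->
  (forall T, 0 < T -> mu.-integrable `]0, T] (EFin \o D)) ->
  (forall s t, 0 < s -> s <= t -> psi t - psi s = \int[mu]_(r in `[s, t]) D r) ->
  forall t, 0 < t -> psi s @[s --> 0^'+] --> psi t - conv (fk 1) G t.
Proof.
move=> mG cG DG iD psiE t t0.
have iT := trunc_restrict t0 mG cG DG (iD _ t0).
apply/cvg_at_rightP => s [s0 scvg].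
pose I (k : nat) (r : R) : R := (s k <= r)%R%:R * trunc_at t G r.
have mI k : measurable_fun setT (fun r => (s k <= r)%R%:R : R).
  rewrite (_ : (fun r : R => _) = \1_(`[s k, +oo[)).
    by apply: measurable_indic; exact: measurable_itv.
  by apply/funext => r; rewrite indicE mem_setE in_itv/= andbT.
have mIk k : measurable_fun setT (I k).
  by apply: measurable_funM; [exact: mI|exact: measurable_trunc].
have h1 k : s k <= t -> psi t - psi (s k) = \int[mu]_r I k r.
  move=> st; rewrite psiE// Rintegral_mkcond.
  have iD' : intg mu (D \_ `[s k, t]).
    apply: intg_mkcond; apply: integrableS (iD _ t0) => //.
    by move=> r; rewrite /= !in_itv/= => /andP[/(lt_le_trans (s0 k)) -> ->].
  apply: Rint_ae; first exact: intg_measurable iD'.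
    exact: mIk.
  apply: (aeS DG) => r Dr; rewrite patchE mem_setE in_itv/= /I /trunc_at.
  have [sr|sr] := leP (s k) r; last by rewrite /= mul0r.
  rewrite /= mul1r; case: ifP => tT; rewrite ?mul0r// mul1r Dr//.
  exact: lt_le_trans sr.
have h2 : \int[mu]_r I k r @[k --> \oo] --> conv (fk 1) G t.
  have -> : conv (fk 1) G t = \int[mu]_r trunc_at t G r.
    rewrite convE; apply: Rint_ae.
    - by apply: measurable_conv1 => //; exact: measurable_fk.
    - exact: measurable_trunc.
    apply: (aeS (ae_neq t)) => r rt; rewrite fk1 subr_gt0 /trunc_at le_eqVlt.
    by rewrite (negbTE rt).
  apply: (Rint_dominated_cvg _ _ (intg_norm iT)).
  - exact: mIk.
  - exact: measurable_trunc.
  - apply: aeW => r; have [r0|r0] := leP r 0.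
      rewrite /I /trunc_at cG// mulr0; under eq_fun do rewrite mulr0.
      exact: cvg_cst.
    apply: cvg_near_cst; near=> k; rewrite /I.
    suff -> : s k <= r by rewrite mul1r.
    by apply: ltW; near: k; exact: cvgr_lt scvg _ r0.
  - move=> k r; rewrite /I normrM; case: (s k <= r); rewrite ?normr1 ?mul1r//.
    by rewrite normr0 mul0r.
have h3 : psi t - \int[mu]_r I k r @[k --> \oo] --> psi t - conv (fk 1) G t.
  by apply: cvgB => //; exact: cvg_cst.
apply: cvg_trans h3; apply: near_eq_cvg; near=> k.
rewrite -h1 ?subKr//; apply: ltW; near: k; exact: cvgr_lt scvg _ t0.
Unshelve. all: end_near. Qed.

Lemma primitive_conv psi G D L : measurable_fun setT G -> causal G ->
  {ae mu, forall t, 0 < t -> D t = G t} ->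
  (forall T, 0 < T -> mu.-integrable `]0, T] (EFin \o D)) ->
  (forall s t, 0 < s -> s <= t -> psi t - psi s = \int[mu]_(r in `[s, t]) D r) ->
  psi s @[s --> 0^'+] --> L ->
  forall t, 0 < t -> psi t = L + conv (fk 1) G t.
Proof.
move=> mG cG DG iD psiE psiL t t0.
have e : psi t - conv (fk 1) G t = L.
  exact: (cvg_unique _ (primitive_limit mG cG DG iD psiE t0) psiL).
by rewrite -e subrK.
Qed.

Lemma AC1_conv phi G : measurable_fun setT G -> causal G ->
  {ae mu, forall t, 0 < t -> derive1n 1 phi t = G t} -> AC_loc 1 phi ->
  (forall T, 0 < T -> intg mu (trunc_at T G)) /\
  (forall t, 0 < t -> phi t = phi 0 + conv (fk 1) G t).
Proof.
move=> mG cG DG [phi0 _ iD phiE]; split.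
  by move=> T T0; exact: trunc_restrict T0 mG cG DG (iD _ T0).
exact: (primitive_conv mG cG DG iD phiE phi0).
Qed.

(** Before T the damping e^{-t} is at least e^{-T}, so the integrable damped convolution dominates
    the undamped one up to the factor e^T. *)
Lemma intg_trunc_conv a G T : 0 < a -> a <= 2 -> 0 < T ->
  measurable_fun setT G -> causal G -> intg mu (trunc_at T G) ->
  intg mu (trunc_at T (conv (fk a) G)).
Proof.
move=> a0 a2 T0 mG cG iG.
have mGT : measurable_fun setT (trunc_at T G) by exact: measurable_trunc.
have h : intg mu (ew 1 (conv (fk a) (trunc_at T G))).
  apply: intg_ew_conv => //; last exact: measurable_fk.
    exact: intg_ew_fk.
  exact: intg_ew_trunc.
apply: (le_intg _ _ (intgZ (expR T) (intg_norm h))).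
  by apply: measurable_trunc; apply: measurable_conv => //; exact: measurable_fk.
move=> t /=; rewrite /trunc_at; have [tT|tT] := leP t T; last first.
  by rewrite mul0r normr0 mulr_ge0 ?expR_ge0.
rewrite mul1r ewE normrM mulrA ger0_norm ?expR_ge0// -expRD mul1r.
rewrite (eq_conv_causal (q := G) (q' := trunc_at T G) (@causal_fk _ a)); last first.
  by move=> s st; rewrite trunc_atE// (le_trans (ltW st)).
rewrite ler_peMl// -[leLHS]expR0 ler_expR subr_ge0//.
Qed.

Lemma integrable_of_trunc G T : intg mu (trunc_at T G) ->
  mu.-integrable `]0, T] (EFin \o G).
Proof.
move=> h; have : mu.-integrable `]0, T] (EFin \o trunc_at T G).
  by apply: integrableS h => //; exact: measurable_itv.
apply: eq_integrable => // t.
by rewrite inE/= in_itv/= => /andP[_ tT]; rewrite /= trunc_atE.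
Qed.

(** The initial condition speaks of the difference quotient at 0, while the representation needs the
    limit of phi' there. That limit exists because phi' is a primitive of a function integrable up
    to 0, and the mean value theorem finds points tending to 0 where phi' equals the quotient, so it
    is 0. *)
Lemma AC2_conv phi G : measurable_fun setT G -> causal G ->
  {ae mu, forall t, 0 < t -> derive1n 2 phi t = G t} -> AC_loc 2 phi ->
  h^-1 * (phi h - phi 0) @[h --> 0^'+] --> (0 : R) ->
  [/\ forall T, 0 < T -> intg mu (trunc_at T G),
      forall T, 0 < T -> mu.-integrable `]0, T] (EFin \o derive1n 1 phi),
      forall t, 0 < t -> derive1n 1 phi t = conv (fk 1) G t &
      forall t, 0 < t -> phi t = phi 0 + conv (fk 1) (conv (fk 1) G) t].
Proof.
move=> mG cG DG [phi0 dphi iD psiE] slope.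
have iT T : 0 < T -> intg mu (trunc_at T G).
  by move=> T0; exact: trunc_restrict T0 mG cG DG (iD _ T0).
have d1 t : 0 < t -> derivable phi t 1 by move=> t0; exact: (dphi 0%N).
pose psi := derive1n 1 phi.
(* phi' is continuous on compact subintervals of t > 0 as an indefinite integral; this allows phi to
   be recovered from it by the fundamental theorem. *)
have psi_cont s t : 0 < s -> s < t -> {within `[s, t], continuous psi}.
  move=> s0 st.
  have iDst : mu.-integrable `[s, t] (EFin \o derive1n 2 phi).
    apply: integrableS (iD _ (lt_trans s0 st)) => //.
    by move=> r; rewrite /= !in_itv/= => /andP[/(lt_le_trans s0) -> ->].
  have h := parameterized_integral_continuous (ltW st) iDst.
  apply: (@subspace_eq_continuous _ _ _
    (fun x => psi s + parameterized_integral mu s x (derive1n 2 phi))).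
    move=> x; rewrite inE/= in_itv/= => /andP[sx _].
    by rewrite /parameterized_integral -psiE// addrC subrK.
  by move=> x; apply: cvgD; [exact: cvg_cst|exact: h].
have phi_cont t : 0 < t -> {for t, continuous phi}.
  by move=> /d1 /derivable1_diffP /differentiable_continuous.
have phi_LR s t : 0 < s -> s < t -> derivable_oo_LRcontinuous phi s t.
  move=> s0 st; split.
  - by move=> x; rewrite in_itv/= => /andP[sx _]; apply: d1; exact: lt_trans sx.
  - by apply: cvg_at_right_filter; exact: phi_cont.
  - by apply: cvg_at_left_filter; apply: phi_cont; exact: lt_trans st.
have phi_w t : 0 < t -> {within `[0, t], continuous phi}.
  move=> t0; apply: derivable_oo_LRcontinuous_within; split.
  - by move=> x; rewrite in_itv/= => /andP[sx _]; exact: d1.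
  - exact: phi0.
  - by apply: cvg_at_left_filter; exact: phi_cont.
have psiL := primitive_limit mG cG DG iD psiE ltr01.
have L0 : psi 1 - conv (fk 1) G 1 = 0.
  (* The points [c k] come from the mean value theorem on [0, 1/(k+1)]. *)
  have /choice[c cP] : forall k : nat, exists c : R, 0 < c < k.+1%:R^-1 /\
      (k.+1%:R^-1)^-1 * (phi k.+1%:R^-1 - phi 0) = psi c.
    move=> k; have k0 : 0 < k.+1%:R^-1 :> R by rewrite invr_gt0.
    have [|c] := MVT k0 (df := psi) _ (phi_w _ k0).
      move=> x; rewrite in_itv/= => /andP[x0 _]; split; first exact: d1.
      by rewrite /psi /= derive1E.
    rewrite in_itv/= subr0 => cI ->; exists c; split => //.
    by rewrite mulrC mulfK// gt_eqF.
  have c0 k : 0 < c k by have [/andP[]] := cP k.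
  have cc : c k @[k --> \oo] --> (0 : R).
    apply: (squeeze_cvgr _ (cvg_cst _) (@cvg_harmonic R)).
    by apply: nearW => k; have [/andP[/ltW -> /ltW ->]] := cP k.
  have h1 : psi (c k) @[k --> \oo] --> psi 1 - conv (fk 1) G 1.
    by move/cvg_at_rightP : psiL; apply.
  have h2 : psi (c k) @[k --> \oo] --> (0 : R).
    rewrite (_ : (fun k => psi (c k)) =
      (fun k : nat => (k.+1%:R^-1)^-1 * (phi k.+1%:R^-1 - phi 0))); last first.
      by apply/funext => k; have [_ ->] := cP k.
    move/cvg_at_rightP : slope; apply; split; last exact: cvg_harmonic.
    by move=> k; rewrite invr_gt0.
  exact: (cvg_unique _ h1 h2).
rewrite L0 in psiL.
have psiC t : 0 < t -> psi t = conv (fk 1) G t.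
  by move=> t0; rewrite -[RHS]add0r; exact: (primitive_conv mG cG DG iD psiE psiL t0).
have iT1 T : 0 < T -> mu.-integrable `]0, T] (EFin \o psi).
  move=> T0; have : mu.-integrable `]0, T] (EFin \o conv (fk 1) G).
    by apply: integrable_of_trunc; apply: intg_trunc_conv => //; [lra|exact: iT].
  apply: eq_integrable => // s.
  by rewrite inE/= in_itv/= => /andP[s0 _]; rewrite /= psiC.
split => // t t0.
have m1 : measurable_fun setT (conv (fk 1) G).
  by apply: measurable_conv => //; exact: measurable_fk.
have c1 : causal (conv (fk 1) G) by apply: causal_conv => //; exact: causal_fk.
apply: (@primitive_conv phi (conv (fk 1) G) psi (phi 0) m1 c1 _ _ _ phi0 t t0).
- by apply: aeW => s s0; exact: psiC.
- exact: iT1.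
- move=> r s r0; rewrite le_eqVlt => /predU1P[<-|rs].
    by rewrite subrr set_itv1 Rintegral_set1.
  rewrite /Rintegral (continuous_FTC2 rs (psi_cont _ _ r0 rs) (phi_LR _ _ r0 rs)) ?EFinB//.
Qed.

(** The two sides differ at most at the end points s = 0 and s = t, where [D] or the power may take
    default values, and on the null set where [D] and [W] differ. *)
Lemma caputo_integral a D W t : 0 < a -> a <= 2 -> 0 < t ->
  measurable_fun setT W -> causal W ->
  {ae mu, forall s, 0 < s -> D s = W s} ->
  (forall T, 0 < T -> mu.-integrable `]0, T] (EFin \o D)) ->
  (Gamma a)^-1 * \int[mu]_(s in `[0, t]) (D s * (t - s) `^ (a - 1)) =
  conv (fk a) W t.
Proof.
move=> a0 a2 t0 mW cW DW iD.
have mD : measurable_fun `]0, t] D.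
  by apply/measurable_EFinP; exact: measurable_int (iD _ t0).
have mp : measurable_fun setT (fun s : R => (t - s) `^ (a - 1)).
  by apply: (measurableT_comp (measurable_powRr _)); exact: measurable_funB.
have mDp : measurable_fun `]0, t] (fun s => D s * (t - s) `^ (a - 1)).
  by apply: measurable_funM => //; exact: measurable_funTS.
rewrite {1}/Rintegral -integral_itv_obnd_cbnd; last exact/measurable_EFinP.
rewrite -/(Rintegral mu `]0, t] (fun s => D s * (t - s) `^ (a - 1))) Rintegral_mkcond.
have mm : measurable_fun setT ((fun s => D s * (t - s) `^ (a - 1)) \_ `]0, t]).
  exact/(measurable_restrictT _ (measurable_itv `]0, t])).
rewrite -RintZm// convE; apply: Rint_ae.
- exact: measurable_funM.
- by apply: measurable_conv1 => //; exact: measurable_fk.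
apply: (aeS2 DW (ae_neq t)) => s Ds st.
rewrite patchE mem_setE in_itv/= fkE subr_gt0.
have [s0|s0] := ltP 0 s; last by rewrite /= cW// !mulr0.
rewrite Ds// le_eqVlt (negbTE st)/=; case: ltP => _; last by rewrite mulr0 !mul0r.
by rewrite -[true%:R]/(1 : R) mul1r; ring.
Qed.

End Primitive.

Section Caputo.
Context {R : realType}.
Local Notation mu := (@lebesgue_measure R).

(* With n the ceiling of 2 alpha and G the n-th derivative of phi, firstd is phi', hcap is the
   Caputo derivative of order 2 alpha, and Jcap that of order alpha; firstd uses phi'(0) = 0 when
   n = 2. *)
Definition firstd (alpha : R) (G : R -> R) : R -> R :=
  if order_ceil (2 * alpha) == 1%N then G else conv (fk 1) G.

Definition hcap (alpha : R) (G : R -> R) : R -> R :=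
  let n := order_ceil (2 * alpha) in
  if 2 * alpha == n%:R then G else conv (fk (n%:R - 2 * alpha)) G.

Definition Jcap (alpha : R) (G : R -> R) : R -> R :=
  if alpha == 1 then firstd alpha G else conv (fk (1 - alpha)) (firstd alpha G).

(** Write I^a for the fractional integral of order a. With G the n-th derivative, phi' = I^{n-1} G,
    D^{2 alpha} phi = I^{n - 2 alpha} G and D^alpha phi = I^{1-alpha} I^{n-1} G; the last two
    identities are then I^{n-alpha} = I^alpha I^{n - 2 alpha} and I^n = I^{2 alpha} I^{n - 2 alpha}.
    Integer orders are treated apart, because they are ordinary derivatives and I^0 is not given by
    a kernel. *)
Lemma caputo_sections alpha phi G : 0 < alpha -> alpha <= 1 ->
  let n := order_ceil (2 * alpha) in
  measurable_fun setT G -> causal G ->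
  {ae mu, forall t, 0 < t -> derive1n n phi t = G t} -> AC_loc n phi ->
  (2^-1 < alpha -> h^-1 * (phi h - phi 0) @[h --> 0^'+] --> (0 : R)) ->
  [/\ forall T, 0 < T -> intg mu (trunc_at T G),
      forall t, 0 < t -> phi t = phi 0 + conv (fk 1) (firstd alpha G) t,
      {ae mu, forall t, 0 < t -> caputo (2 * alpha) phi t = hcap alpha G t},
      forall t, 0 < t -> caputo alpha phi t = Jcap alpha G t &
      {ae mu, forall t, Jcap alpha G t = conv (fk alpha) (hcap alpha G) t} /\
      {ae mu, forall t, conv (fk 1) (firstd alpha G) t = conv (fk (2 * alpha)) (hcap alpha G) t}].
Proof.
move=> alpha0 alpha1 n mG cG DG AC slope.
have m1 : measurable_fun setT (conv (fk 1) G).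
  by apply: measurable_conv => //; exact: measurable_fk.
have c1 : causal (conv (fk 1) G) by apply: causal_conv => //; exact: causal_fk.
have [a2|a2] := leP (2 * alpha) 1.
  have n1 : n = 1%N by apply: order_ceil1 => //; rewrite mulr_gt0.
  have oa : order_ceil alpha = 1%N by apply: order_ceil1.
  rewrite /Jcap /firstd /hcap -/n n1/=.
  move: (AC) DG; rewrite n1 => AC1 DG.
  have [_ _ iD _] := AC1.
  have [iT phiE] := AC1_conv mG cG DG AC1.
  have alt : alpha != 1 by rewrite lt_eqF//; lra.
  rewrite (negbTE alt); have e1 t : 0 < t -> caputo alpha phi t = conv (fk (1 - alpha)) G t.
    move=> t0; rewrite /caputo oa (negbTE alt).
    have p1 : 0 < 1 - alpha by lra.
    have p2 : 1 - alpha <= 2 by lra.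
    exact: (caputo_integral p1 p2 t0 mG cG DG iD).
  have [e|ne] := eqVneq (2 * alpha) 1%:R.
    split => //.
    - apply: (aeS DG) => t Dt t0; rewrite /caputo -/n n1 e eqxx; exact: Dt.
    split; last by apply: aeW => t; rewrite e.
    by apply: aeW => t; congr (conv (fk _) _ _); lra.
  split => //; last split.
  - apply: aeW => t t0; rewrite /caputo -/n n1 (negbTE ne).
    have ne' : 2 * alpha < 1 by rewrite lt_neqAle ne.
    have p1 : 0 < 1 - 2 * alpha by lra.
    have p2 : 1 - 2 * alpha <= 2 by lra.
    exact: (caputo_integral p1 p2 t0 mG cG DG iD).
  - have := @frac_semigroup _ alpha (1 - 2 * alpha) G alpha0 _ _ mG cG iT.
    move=> /(_ ltac:(lra) ltac:(lra)) /aeS; apply => t ->.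
    by congr (conv (fk _) _ _); lra.
  - have := @frac_semigroup _ (2 * alpha) (1 - 2 * alpha) G _ _ _ mG cG iT.
    move=> /(_ ltac:(lra) ltac:(lra) ltac:(lra)) /aeS; apply => t ->.
    by congr (conv (fk _) _ _); lra.
(* Here 1 < 2 alpha <= 2, so the zero initial slope is part of the hypotheses. *)
have n2 : n = 2%N by apply: order_ceil2 => //; lra.
have oa : order_ceil alpha = 1%N by apply: order_ceil1.
rewrite /Jcap /firstd /hcap -/n n2/=.
move: (AC) DG; rewrite n2 => AC2 DG.
have [_ _ iD _] := AC2.
have sl := slope ltac:(lra).
have [iT iT1 psiE phiE] := AC2_conv mG cG DG AC2 sl.
have semi11 : {ae mu, forall t, conv (fk 1) (conv (fk 1) G) t = conv (fk 2) G t}.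
  have := @frac_semigroup _ 1 1 G ltr01 ltr01 _ mG cG iT.
  move=> /(_ ltac:(lra)) /aeS; apply => t ->; congr (conv (fk _) _ _); lra.
have [e|ne] := eqVneq (2 * alpha) 2%:R.
  have e1 : alpha = 1 by lra.
  split => //.
  - by apply: (aeS DG) => t Dt t0; rewrite /caputo -/n n2 e eqxx; exact: Dt.
  - by move=> t t0; rewrite /caputo oa e1 eqxx psiE// eqxx.
  split; last by apply: (aeS semi11) => t ->; rewrite e.
  by apply: aeW => t; rewrite e1 eqxx.
have lt1 : alpha < 1 by rewrite lt_neqAle alpha1 andbT; apply: contra ne => /eqP ->; rewrite mulr1.
have p1 : 0 < 1 - alpha by lra.
have p2 : 1 - alpha <= 2 by lra.
rewrite (lt_eqF lt1); split => //; last split.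
- apply: aeW => t t0; rewrite /caputo -/n n2 (negbTE ne).
  by apply: caputo_integral => //; lra.
- move=> t t0; rewrite /caputo oa lt_eqF//.
  apply: (caputo_integral p1 p2 t0 m1 c1 _ iT1).
  by apply: aeW => s s0; exact: psiE.
- have := @frac_semigroup _ alpha (2%:R - 2 * alpha) G alpha0 _ _ mG cG iT.
  have := @frac_semigroup _ (1 - alpha) 1 G _ ltr01 _ mG cG iT.
  move=> /(_ ltac:(lra) ltac:(lra)) h1 /(_ ltac:(lra) ltac:(lra)) h2.
  apply: (aeS2 h1 h2) => t -> ->.
  by congr (conv (fk _) _ _); lra.
- have := @frac_semigroup _ (2 * alpha) (2%:R - 2 * alpha) G _ _ _ mG cG iT.
  move=> /(_ ltac:(lra) ltac:(lra) ltac:(lra)) h2.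
  apply: (aeS2 semi11 h2) => t -> ->.
  by congr (conv (fk _) _ _); lra.
Qed.

End Caputo.

(** * Null sets of product measures, L^2 norms of sections and weighted bounds *)

Section Product_ae.
Context d1 d2 (T1 : measurableType d1) (T2 : measurableType d2) (R : realType).
Variables (m1 : {sigma_finite_measure set T1 -> \bar R})
  (m2 : {sigma_finite_measure set T2 -> \bar R}).
Implicit Types (N : set (T1 * T2)).

Lemma prod_measure_indic N : measurable N ->
  ((m1 \x m2) N = \int[m1]_x \int[m2]_y (\1_N (x, y))%:E)%E.
Proof.
move=> mN; have -> : ((m1 \x m2) N = \int[m1 \x m2]_z (\1_N z)%:E)%E.
  by rewrite integral_indic// setIT.
apply: (fubini_tonelli1 (m1 := m1) (m2 := m2) (EFin \o \1_N)).
  by apply/measurable_EFinP; exact: measurable_indic.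
by move=> z; rewrite lee_fin.
Qed.

Lemma prod_measure_indic2 N : measurable N ->
  ((m1 \x m2) N = \int[m2]_y \int[m1]_x (\1_N (x, y))%:E)%E.
Proof.
move=> mN; rewrite prod_measure_indic//; apply: Rtonelli => //.
Qed.

Lemma section1_null N : measurable N -> (m1 \x m2)%E N = 0%E ->
  {ae m1, forall x, m2 (xsection N x) = 0%E}.
Proof.
move=> mN; rewrite prod_measure_indic// => N0.
have mi : measurable_fun setT (fun x => \int[m2]_y (\1_N (x, y))%:E)%E.
  apply: (measurable_integral2 m2 (f := EFin \o \1_N)).
  by apply/measurable_EFinP; exact: measurable_indic.
have := (ae_eq_integral_abs m1 measurableT mi).1.
have -> : (\int[m1]_x `|\int[m2]_y (\1_N (x, y))%:E|)%E = 0%E.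
  rewrite -N0; apply: eq_integral => x _; rewrite gee0_abs//.
  by apply: integral_ge0 => y _; rewrite lee_fin.
move=> /(_ erefl) /aeS; apply => x /(_ I) /= h.
have -> : (m2 (xsection N x) = \int[m2]_y (\1_(xsection N x) y)%:E)%E.
  by rewrite integral_indic ?setIT//; exact: measurable_xsection.
by rewrite -[RHS]h; apply: eq_integral => y _; rewrite !indicE mem_xsection.
Qed.

Lemma section2_null N : measurable N -> (m1 \x m2)%E N = 0%E ->
  {ae m2, forall y, m1 (ysection N y) = 0%E}.
Proof.
move=> mN; rewrite prod_measure_indic2// => N0.
have mi : measurable_fun setT (fun y => \int[m1]_x (\1_N (x, y))%:E)%E.
  apply: (measurable_integral2 m1 (f := fun z => (\1_N (z.2, z.1))%:E)).
  apply/measurable_EFinP; apply: (measurableT_comp (measurable_indic mN)).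
  exact: measurable_swap.
have := (ae_eq_integral_abs m2 measurableT mi).1.
have -> : (\int[m2]_y `|\int[m1]_x (\1_N (x, y))%:E|)%E = 0%E.
  rewrite -N0; apply: eq_integral => x _; rewrite gee0_abs//.
  by apply: integral_ge0 => y _; rewrite lee_fin.
move=> /(_ erefl) /aeS; apply => x /(_ I) /= h.
have -> : (m1 (ysection N x) = \int[m1]_y (\1_(ysection N x) y)%:E)%E.
  by rewrite integral_indic ?setIT//; exact: measurable_ysection.
by rewrite -[RHS]h; apply: eq_integral => y _; rewrite !indicE mem_ysection.
Qed.

Lemma ae_prod_sec1 (Q : T1 * T2 -> Prop) : {ae (m1 \x m2)%E, forall z, Q z} ->
  {ae m1, forall x, {ae m2, forall y, Q (x, y)}}.
Proof.
move=> [N [mN N0 NQ]]; apply: (aeS (section1_null mN N0)) => x h.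
exists (xsection N x); split => //; first exact: measurable_xsection.
by move=> y /= nQ; rewrite /xsection/= inE; exact: NQ.
Qed.

Lemma ae_prod_sec2 (Q : T1 * T2 -> Prop) : {ae (m1 \x m2)%E, forall z, Q z} ->
  {ae m2, forall y, {ae m1, forall x, Q (x, y)}}.
Proof.
move=> [N [mN N0 NQ]]; apply: (aeS (section2_null mN N0)) => y h.
exists (ysection N y); split => //; first exact: measurable_ysection.
by move=> x /= nQ; rewrite /ysection/= inE; exact: NQ.
Qed.

Lemma ae_prod_cyl2 (Q : T2 -> Prop) : {ae m2, forall y, Q y} ->
  {ae (m1 \x m2)%E, forall z, Q z.2}.
Proof.
move=> [N [mN N0 NQ]]; exists (setT `*` N); split.
- exact: measurableX.
- by rewrite product_measure1E// N0 mule0.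
- by move=> z /= nQ; split => //; exact: NQ.
Qed.

(** Null sections make a set null only if it is measurable, whence the measurability of [f] and [g]:
    the set where they differ is then measurable and Tonelli applies. *)
Lemma ae_prod_of_sec2 (f g : T1 * T2 -> R) :
  measurable_fun setT f -> measurable_fun setT g ->
  {ae m2, forall y, {ae m1, forall x, f (x, y) = g (x, y)}} ->
  {ae (m1 \x m2)%E, forall z, f z = g z}.
Proof.
move=> mf mg h.
pose N := [set z | f z != g z].
have mN : measurable N.
  have -> : N = (fun z => f z - g z) @^-1` (~` [set 0]).
    apply/seteqP; rewrite /N; split => z /=; first by rewrite -subr_eq0 => /eqP.
    by move=> fg; rewrite -subr_eq0; exact/eqP.
  rewrite -[X in measurable X]setTI; apply: measurable_funB => //.
  exact: measurableC.
exists N; split => //; last by move=> z /= /eqP.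
rewrite prod_measure_indic2// (ae_eq_integral (cst 0%E))//.
- by rewrite integral0.
- apply: (measurable_integral2 m1 (f := fun z => (\1_N (z.2, z.1))%:E)).
  apply/measurable_EFinP; apply: (measurableT_comp (measurable_indic mN)).
  exact: measurable_swap.
- apply: (aeS h) => y hy _; rewrite (ae_eq_integral (cst 0%E))//.
  + by rewrite integral0.
  + apply/measurable_EFinP; apply: (measurableT_comp (measurable_indic mN)).
    exact: pair2_measurable.
  + apply: (aeS hy) => x e _; rewrite indicE memNset//= => /eqP; exact.
Qed.

End Product_ae.

Section L2_norm.
Context {R : realType}.
Local Notation mu := (@lebesgue_measure R).
Implicit Types phi w : R -> R.

Definition N2 (w : R -> R) : \bar R := ('N[mu]_2%:E[EFin \o w])%E.

Lemma N2_ge0 w : (0 <= N2 w)%E.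
Proof. exact: Lnorm_ge0. Qed.

Lemma cauchy_schwarz phi w : measurable_fun setT phi -> measurable_fun setT w ->
  (\int[mu]_y (`|phi y * w y|)%:E <= N2 phi * N2 w)%E.
Proof.
move=> mp mw; have := hoelder mu mp mw (ltr0Sn _ 1) (ltr0Sn _ 1).
rewrite Lnorm1 => h; apply: h.
lra.
Qed.

(** The norm is a power of an integral in y, hence measurable in t by Tonelli; writing the power as
    a map on the extended reals covers infinite norms. *)
Lemma measurable_N2 (w : R * R -> R) : measurable_fun setT w ->
  measurable_fun setT (fun t => N2 (fun y => w (t, y))).
Proof.
move=> mw.
have -> : (fun t => N2 (fun y => w (t, y))) =
    (fun t => er_map (fun x : R => x `^ 2^-1) (\int[mu]_y (`|w (t, y)| `^ 2)%:E)%E).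
  apply/funext => t; rewrite /N2 unlock.
  have : (0 <= \int[mu]_y (`|w (t, y)| `^ 2)%:E)%E.
    by apply: integral_ge0 => y _; rewrite lee_fin powR_ge0.
  rewrite [X in (X `^ _)%E](_ : _ = \int[mu]_y (`|w (t, y)| `^ 2)%:E)%E//.
  case: integral => [r| |]//= _.
  by rewrite ifF//; apply/negbTE; rewrite invr_eq0.
have m1 : measurable_fun setT (fun t => (\int[mu]_y (`|w (t, y)| `^ 2)%:E)%E).
  apply: (measurable_integral2 mu (f := fun z => (`|w z| `^ 2)%:E)).
  apply/measurable_EFinP; apply: (measurableT_comp (measurable_powRr _)).
  exact: measurableT_comp.
have m2 := measurable_er_map R (measurable_powRr (2^-1 : R)).
exact: (measurableT_comp m2 m1).
Qed.

End L2_norm.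

Section Joint_convolution.
Context {R : realType}.
Local Notation mu := (@lebesgue_measure R).
Implicit Types (k p q : R -> R) (w : R * R -> R).

Definition sec w y : R -> R := fun t => w (t, y).

Lemma measurable_sec w y : measurable_fun setT w -> measurable_fun setT (sec w y).
Proof. by move=> mw; apply: (measurableT_comp mw); exact: pair2_measurable. Qed.

Lemma measurable_jconv k w : measurable_fun setT k -> measurable_fun setT w ->
  measurable_fun setT (fun z : R * R => conv k (sec w z.2) z.1).
Proof.
move=> mk mw; rewrite (_ : (fun z : R * R => _) =
  (fun z : R * R => \int[mu]_s (k (z.1 - s) * w (s, z.2)))); last first.
  by apply/funext => z; rewrite convE.
apply: (measurable_Rint2 mu (f := fun x : (R * R) * R => k (x.1.1 - x.2) * w (x.2, x.1.2))).
apply: measurable_funM.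
  apply: (measurableT_comp mk); apply: measurable_funB => //.
  by apply: (measurableT_comp measurable_fst); exact: measurable_fst.
apply: (measurableT_comp mw); apply: measurable_fun_pair => //.
by apply: (measurableT_comp measurable_snd); exact: measurable_fst.
Qed.

(** Young's inequality in L^1, in extended form so that it can be used before integrability is
    known. *)
Lemma le_integral_conv p q : measurable_fun setT p -> measurable_fun setT q ->
  (\int[mu]_t `|conv p q t|%:E <=
   (\int[mu]_t `|p t|%:E) * (\int[mu]_t `|q t|%:E))%E.
Proof.
move=> mp mq.
have mp' : measurable_fun setT (fun t => `|p t|) by exact: measurableT_comp.
have mq' : measurable_fun setT (fun t => `|q t|) by exact: measurableT_comp.
rewrite -ge0_integral_conv//; apply: ge0_le_integral => //.
- apply/measurable_EFinP; apply: measurableT_comp => //; exact: measurable_conv.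
- apply: (measurable_integral2 mu (f := fun z : R * R => (`|p (z.1 - z.2)| * `|q z.2|)%:E)).
  by apply/measurable_EFinP; exact: (measurable_convM mp' mq').
move=> t _; rewrite convE /Rintegral.
have h : (`|\int[mu]_s (p (t - s) * q s)%:E| <= \int[mu]_s (`|p (t - s)| * `|q s|)%:E)%E.
  apply: le_trans (le_abse_integral _ _ _) _ => //.
    by apply/measurable_EFinP; exact: measurable_conv1.
  by rewrite le_eqVlt; apply/orP; left; apply/eqP/eq_integral => s _; rewrite abse_EFin normrM.
apply: le_trans h; case: integral => [r| |] //=; by rewrite normr0 leey.
Qed.

Lemma le_laplace_conv l p q : measurable_fun setT p -> measurable_fun setT q ->
  (\int[mu]_t `|ew l (conv p q) t|%:E <=
   (\int[mu]_t `|ew l p t|%:E) * (\int[mu]_t `|ew l q t|%:E))%E.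
Proof.
move=> mp mq; apply: le_trans (le_integral_conv (measurable_ew l mp) (measurable_ew l mq)).
by rewrite le_eqVlt; apply/orP; left; apply/eqP/eq_integral => t _; rewrite ew_conv.
Qed.

Lemma integral_ew_fk l a : 0 < l -> 0 < a -> a <= 2 ->
  (\int[mu]_t `|ew l (fk a) t|%:E = (l `^ (- a))%:E)%E.
Proof.
move=> l0 a0 a2; rewrite -laplace_fk// EFin_Rint; last exact: intg_ew_fk.
apply: eq_integral => t _; rewrite ger0_norm// ewE mulr_ge0 ?expR_ge0//.
exact: fk_ge0.
Qed.

End Joint_convolution.

Section Weighted_bound.
Context {R : realType}.
Local Notation mu := (@lebesgue_measure R).
Implicit Types (k phi : R -> R) (w : R * R -> R) (v : R -> R -> R).

(** Tonelli, then Cauchy-Schwarz in y at each time: a time integral of L^2 norms in space becomes a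
    bound on space-time integrals against a fixed [phi]. *)
Lemma mixed_bound k w phi : measurable_fun setT k -> (forall t, 0 <= k t) ->
  measurable_fun setT w -> measurable_fun setT phi ->
  (\int[mu]_y \int[mu]_t (`|k t * w (t, y) * phi y|)%:E <=
   (\int[mu]_t ((k t)%:E * N2 (fun y => w (t, y)))) * N2 phi)%E.
Proof.
move=> mk k0 mw mp.
have mw1 t : measurable_fun setT (fun y => w (t, y)).
  by apply: (measurableT_comp mw); exact: pair1_measurable.
have mk1 : measurable_fun setT (fun z : R * R => `|k z.1 * w z * phi z.2|).
  apply: measurableT_comp => //; apply: measurable_funM.
    by apply: measurable_funM => //; apply: (measurableT_comp mk); exact: measurable_fst.
  by apply: (measurableT_comp mp); exact: measurable_snd.
have mN : measurable_fun setT (fun t => N2 (fun y => w (t, y))) by exact: measurable_N2.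
rewrite -(Rtonelli mu mu (f := fun z => `|k z.1 * w z * phi z.2|))//=.
rewrite -ge0_integralZr//; last 3 first.
- by apply: emeasurable_funM => //; exact/measurable_EFinP.
- by move=> t _; rewrite mule_ge0 ?lee_fin ?N2_ge0.
- exact: N2_ge0.
apply: ge0_le_integral => //.
- by move=> t _; apply: integral_ge0 => y _; rewrite lee_fin.
- apply: (measurable_integral2 mu (f := fun z => (`|k z.1 * w z * phi z.2|)%:E)).
  exact/measurable_EFinP.
- apply: emeasurable_funM => //; apply: emeasurable_funM => //.
  exact/measurable_EFinP.
move=> t _.
have -> : (\int[mu]_y (`|k t * w (t, y) * phi y|)%:E =
   (k t)%:E * \int[mu]_y (`|phi y * w (t, y)|)%:E)%E.
  rewrite -ge0_integralZl//; last 2 first.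
  - apply/measurable_EFinP; apply: (measurableT_comp (@normr_measurable R setT)).
    exact: (measurable_funM mp).
  - by rewrite lee_fin.
  apply: eq_integral => y _; rewrite -EFinM; congr EFin.
  by rewrite -mulrA normrM ger0_norm// [w _ * _]mulrC.
by rewrite -muleA lee_wpmul2l ?lee_fin// muleC [X in (_ <= X)%E]muleC muleC cauchy_schwarz.
Qed.

(** Extension by zero to t <= 0. It makes the sections in time causal and turns measurability on the
    half-plane into measurability on the plane. *)
Definition strip v (z : R * R) : R := (0 < z.1)%R%:R * v z.1 z.2.

Lemma measurable_strip v : strip_measurable v -> measurable_fun setT (strip v).
Proof.
move=> mv.
have mD : measurable [set z : R * R | 0 < z.1].
  rewrite (_ : [set _ | _] = `]0, +oo[ `*` setT).
    by apply: measurableX => //; exact: measurable_itv.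
  by apply/seteqP; split=> z /=; rewrite in_itv/= andbT => //; case.
move/(measurable_restrictT _ mD) : mv; apply: eq_measurable_fun => z _.
rewrite /strip /patch; case: ifPn; rewrite ?inE/= => h.
  by rewrite h mul1r.
by rewrite notin_setE/= in h; move/negP/negbTE: h => ->; rewrite mul0r.
Qed.

Lemma causal_strip v y : causal (sec (strip v) y).
Proof. by move=> t t0; rewrite /sec /strip/= ltNge t0 mul0r. Qed.

Lemma N2_strip v t : 0 < t -> N2 (fun y => strip v (t, y)) = N2 (v t).
Proof. by move=> t0; congr N2; apply/funext => y; rewrite /strip/= t0 mul1r. Qed.

Lemma N2_ae (f g : R -> R) : measurable_fun setT f -> measurable_fun setT g ->
  {ae mu, forall y, f y = g y} -> N2 f = N2 g.
Proof.
move=> mf mg fg; rewrite /N2 unlock.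
have h (q : R -> R) : measurable_fun setT q ->
    measurable_fun setT (fun x => `|(EFin \o q) x| `^ 2)%E.
  move=> mq; apply/measurable_EFinP.
  by apply: (measurableT_comp (measurable_powRr 2)); exact: measurableT_comp.
have e : (\int[mu]_x (`|(EFin \o f) x| `^ 2) = \int[mu]_x (`|(EFin \o g) x| `^ 2))%E.
  apply: ae_eq_integral; [exact: measurableT|exact: h|exact: h|].
  by apply: (aeS fg) => y /= ->.
by rewrite e.
Qed.

Lemma near_bound (T : R) v : strip_measurable v ->
  (\int[mu]_(t in `]0%R, T]) 'N[mu]_2%:E[EFin \o v t] < +oo)%E ->
  (\int[mu]_t (((0 < t <= T)%R%:R)%:E * N2 (fun y => strip v (t, y))) < +oo)%E.
Proof.
move=> mv; rewrite integral_mkcond; congr (_ < _)%E; apply: eq_integral => t _.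
rewrite /patch; case: ifPn; rewrite ?inE/= ?notin_setE/= in_itv/= => h.
  by rewrite h mul1e N2_strip//; case/andP: h.
by move/negP/negbTE: h => ->; rewrite mul0e.
Qed.

Lemma measurable_gt_ind (T : R) : measurable_fun setT (fun s : R => (T < s)%R%:R : R).
Proof.
rewrite (_ : (fun s : R => _) = \1_(`]T, +oo[)).
  by apply: measurable_indic; exact: measurable_itv.
by apply/funext => t; rewrite indicE mem_setE in_itv/= andbT.
Qed.

(** Young's inequality a x <= w x^2 + a^2 / w with w = t^zeta e^{-beta t} and a = e^{-lt}. The
    quotient a^2 / w is t^{-zeta} e^{-(2l - beta)t}, and t^{-zeta} <= t for t > 1 because zeta >
    -1. *)
Lemma weight_young (zeta beta l t x : R) : -1 < zeta -> 1 < t ->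
  expR (- (l * t)) * x <= t `^ zeta * expR (- beta * t) * x ^+ 2 +
    t * expR (- ((2 * l - beta) * t)).
Proof.
move=> z1 t1; have t0 : 0 < t by lra.
have tz : 0 < t `^ zeta by exact: powR_gt0.
have w0 : 0 < t `^ zeta * expR (- beta * t) by rewrite mulr_gt0// expR_gt0.
have tw : 1 <= t * t `^ zeta.
  rewrite -[X in X * _](powRr1 (ltW t0)) -powRD; last by rewrite (gt_eqF t0) implybT.
  by rewrite -[leLHS](powRr0 t) ler_powR//; lra.
set w := _ * expR _ in w0 *; set a := expR _.
have aw : a ^+ 2 <= w * (t * expR (- ((2 * l - beta) * t))).
  have -> : w * (t * expR (- ((2 * l - beta) * t))) = (t * t `^ zeta) * a ^+ 2.
    have -> : a ^+ 2 = expR (- beta * t) * expR (- ((2 * l - beta) * t)).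
      by rewrite /a expr2 -!expRD; congr expR; ring.
    rewrite /w; ring.
  by rewrite ler_peMl// exprn_ge0// expR_ge0.
rewrite -(ler_pM2l w0).
set b := t * _ in aw *.
have : 0 <= (w * x - a) ^+ 2 + (w * x) ^+ 2 by rewrite addr_ge0// sqr_ge0.
nra.
Qed.

(** The condition beta < 2 l originates here: it makes the remainder t e^{-(2l - beta)t} of
    [weight_young] integrable. *)
Lemma tail_bound (zeta beta l : R) v w : -1 < zeta -> beta < 2 * l ->
  weighted_L2 zeta beta v -> measurable_fun setT w ->
  {ae (mu \x mu)%E, forall z : R * R, strip v z = strip (fun t y => w (t, y)) z} ->
  (\int[mu]_t (((1 < t)%R%:R * expR (- (l * t)))%:E * N2 (fun y => w (t, y))) < +oo)%E.
Proof.
move=> z1 bl [mv vfin] mw vw.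
have msv := measurable_strip mv.
have mN (u : R * R -> R) : measurable_fun setT u -> measurable_fun setT (fun t => N2 (fun y => u (t, y))).
  exact: measurable_N2.
have g0 : 0 < 2 * l - beta by lra.
pose W (t : R) := (0 < t)%R%:R * (t `^ zeta * expR (- beta * t)) : R.
have mW : measurable_fun setT W.
  apply: measurable_funM; first exact: measurable_pos.
  apply: measurable_funM; first exact: measurable_powRr.
  by under eq_fun do rewrite mulNr; exact: measurable_expRl.
have W0 t : 0 <= W t by rewrite /W !mulr_ge0 ?powR_ge0 ?expR_ge0.
pose A (t : R) := ((W t)%:E * (N2 (fun y => strip v (t, y)) * N2 (fun y => strip v (t, y))))%E.
have mA : measurable_fun setT A.
  apply: emeasurable_funM; first exact/measurable_EFinP.
  by apply: emeasurable_funM; exact: mN.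
have Afin : (\int[mu]_t A t < +oo)%E.
  move: vfin; rewrite /weighted_sqnorm integral_mkcond; congr (_ < _)%E.
  apply: eq_integral => t _; rewrite /patch /A /W; case: ifPn; rewrite ?inE/= ?notin_setE/= in_itv/= andbT => h.
    by rewrite h mul1r N2_strip// expeS expe1.
  by move/negP/negbTE: h => ->; rewrite mul0r mul0e.
(* The remainder t e^{-(2l - beta)t} is written as a damped kernel of order 2, whose integrability
   is known. *)
pose B (t : R) := Gamma 2 * ew (2 * l - beta) (fk 2) t.
have Bi : intg mu B by apply: intgZ; exact: intg_ew_fk.
have B0 t : 0 <= B t.
  have h : 0 <= Gamma 2 :> R by apply: ltW; exact: Gamma_gt0.
  have h2 : 0 <= ew (2 * l - beta) (fk 2) t by rewrite ewE mulr_ge0 ?expR_ge0// fk_ge0.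
  exact: mulr_ge0.
have A0 (t : R) : setT t -> (0 <= A t)%E.
  by rewrite /A => _; rewrite !mule_ge0 ?lee_fin ?N2_ge0.
have B1 (t : R) : setT t -> (0 <= (B t)%:E)%E by rewrite lee_fin.
have mB : measurable_fun setT (fun t => (B t)%:E).
  by apply/measurable_EFinP; exact: (intg_measurable Bi).
apply: (@le_lt_trans _ _ (\int[mu]_t (A t + (B t)%:E))%E); last first.
  have -> := ge0_integralD mu measurableT A0 mA B1 mB.
  by rewrite lte_add_pinfty// -EFin_Rint// ltry.
apply: ae_ge0_le_integral => //.
- by move=> t _; rewrite mule_ge0 ?lee_fin ?N2_ge0// mulr_ge0 ?expR_ge0.
- apply: emeasurable_funM; last exact: mN.
  apply/measurable_EFinP; apply: measurable_funM; first exact: measurable_gt_ind.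
  exact: measurable_expRl.
- by move=> t _; rewrite adde_ge0 ?lee_fin// /A !mule_ge0 ?lee_fin ?N2_ge0.
- by apply: emeasurable_funD => //; apply/measurable_EFinP; exact: (intg_measurable Bi).
apply: (aeS (ae_prod_sec1 vw)) => t vwt _.
have [t1|t1] := ltP 1 t; last first.
  by rewrite mul0r mul0e adde_ge0 ?lee_fin// /A !mule_ge0 ?lee_fin ?N2_ge0.
have t0 : 0 < t by lra.
have -> : N2 (fun y => w (t, y)) = N2 (fun y => strip v (t, y)).
  apply: N2_ae; first by apply: (measurableT_comp mw); exact: pair1_measurable.
    by apply: (measurableT_comp msv); exact: pair1_measurable.
  by apply: (aeS vwt) => y ->; rewrite /strip/= t0 mul1r.
rewrite mul1r /A /W t0 mul1r.
have : (0 <= N2 (fun y => strip v (t, y)))%E by exact: N2_ge0.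
case: N2 => [x x0| _|//].
  rewrite -!EFinM -EFinD lee_fin.
  have -> : B t = t * expR (- ((2 * l - beta) * t)).
    rewrite /B ewE fkE t0 mul1r (_ : (2 : R) - 1 = 1)//; last by ring.
    rewrite powRr1 ?(ltW t0)//; field.
    exact: lt0r_neq0 (Gamma_gt0 _ _).
  exact: weight_young.
rewrite mulyy [X in (_ <= X + _)%E]gt0_muley ?addye ?leey//.
by rewrite lte_fin mulr_gt0 ?powR_gt0 ?expR_gt0.
Qed.

Lemma measurable_jhcap alpha w : measurable_fun setT w ->
  measurable_fun setT (fun z : R * R => hcap alpha (sec w z.2) z.1).
Proof.
move=> mw; rewrite /hcap; case: (2 * alpha == _).
  by rewrite (_ : (fun _ => _) = w)//; apply/funext => -[].
by apply: measurable_jconv => //; exact: measurable_fk.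
Qed.

Lemma order_ceil_gap (alpha : R) : 0 < alpha -> alpha <= 1 ->
  2 * alpha != (order_ceil (2 * alpha))%:R ->
  0 < (order_ceil (2 * alpha))%:R - 2 * alpha <= 2.
Proof.
move=> a0 a1; have [h|h] := leP (2 * alpha) 1.
  by rewrite order_ceil1//; [move=> /eqP a2; apply/andP; split; lra|lra].
by rewrite order_ceil2//; [move=> /eqP a2; apply/andP; split; lra|lra].
Qed.

(** Up to time 1 the weight t^zeta is of no help, as zeta may be large; the bound goes back to the
    n-th derivative, which is integrable up to 0. The constant is the total mass l^{-a} of the
    damped kernel, or 1 when there is no kernel. *)
Lemma laplace_hcap_near (alpha l : R) : 0 < l -> 0 < alpha -> alpha <= 1 ->
  exists2 C : R, 0 <= C & forall G : R -> R, measurable_fun setT G -> causal G ->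
  (\int[mu]_t `|(t <= 1)%R%:R * ew l (hcap alpha G) t|%:E <=
   C%:E * \int[mu]_t `|(0 < t <= 1)%R%:R * G t|%:E)%E.
Proof.
move=> l0 a0 a1.
pose a := (order_ceil (2 * alpha))%:R - 2 * alpha.
pose C := if 2 * alpha == (order_ceil (2 * alpha))%:R then 1 else l `^ (- a).
have C0 : 0 <= C by rewrite /C; case: ifP => _ //; exact: powR_ge0.
exists C => // G mG cG.
pose G1 := trunc_at 1 G.
have mG1 : measurable_fun setT G1 by exact: measurable_trunc.
have mh p : measurable_fun setT p -> measurable_fun setT (hcap alpha p).
  move=> mp; rewrite /hcap; case: (2 * alpha == _) => //.
  by apply: measurable_conv => //; exact: measurable_fk.
have hG1 t : t <= 1 -> hcap alpha G t = hcap alpha G1 t.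
  move=> t1; rewrite /hcap; case: (2 * alpha == _); first by rewrite /G1 trunc_atE.
  apply: eq_conv_causal; first exact: causal_fk.
  by move=> s st; rewrite /G1 trunc_atE//; lra.
apply: (@le_trans _ _ (\int[mu]_t `|ew l (hcap alpha G1) t|%:E)%E).
  apply: ge0_le_integral => //.
  - apply/measurable_EFinP; apply: (measurableT_comp (@normr_measurable R setT)).
    apply: measurable_funM; first exact: measurable_le_ind.
    by apply: measurable_ew; exact: mh.
  - apply/measurable_EFinP; apply: (measurableT_comp (@normr_measurable R setT)).
    by apply: measurable_ew; exact: mh.
  - move=> t _; rewrite lee_fin; have [t1|t1] := leP t 1.
      by rewrite mul1r !ewE hG1.
    by rewrite mul0r normr0.
apply: (@le_trans _ _ (C%:E * \int[mu]_t `|ew l G1 t|%:E)%E); last first.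
  rewrite lee_wpmul2l ?lee_fin//; apply: ge0_le_integral => //.
  - apply/measurable_EFinP; apply: (measurableT_comp (@normr_measurable R setT)).
    exact: measurable_ew.
  - apply/measurable_EFinP; apply: (measurableT_comp (@normr_measurable R setT)).
    apply: measurable_funM => //; under eq_fun do rewrite -mulnb natrM.
    by apply: measurable_funM; [exact: measurable_pos|exact: measurable_le_ind].
  - move=> t _; rewrite lee_fin ewE /G1 /trunc_at; have [t0|t0] := ltP 0 t.
      rewrite /= normrM ger0_norm ?expR_ge0// ler_piMl// -expR0 ler_expR.
      by rewrite oppr_le0 mulr_ge0// ltW.
    by rewrite cG// !mulr0 normr0.
rewrite /hcap /C; case: ifPn => h; first by rewrite mul1e.
have /andP[a0' a2] := order_ceil_gap a0 a1 h.
apply: le_trans (le_laplace_conv l _ mG1) _; first exact: measurable_fk.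
by rewrite integral_ew_fk.
Qed.

(** The time axis is cut at t = 1: [laplace_hcap_near] before, [tail_bound] after, each turned into
    a pairing with [phi] by [mixed_bound]. *)
Lemma mixed_hcap (zeta beta l alpha : R) g v : -1 < zeta -> beta < 2 * l -> 0 < l ->
  0 < alpha -> alpha <= 1 ->
  strip_measurable g ->
  (\int[mu]_(t in `]0%R, 1%R]) 'N[mu]_2%:E[EFin \o g t] < +oo)%E ->
  let H := fun z : R * R => hcap alpha (sec (strip g) z.2) z.1 in
  weighted_L2 zeta beta v ->
  {ae (mu \x mu)%E, forall z : R * R, strip v z = strip (fun t y => H (t, y)) z} ->
  exists2 M : R, 0 <= M & forall phi, measurable_fun setT phi ->
    (\int[mu]_y \int[mu]_t (`|ew l (sec H y) t * phi y|)%:E <= M%:E * N2 phi)%E.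
Proof.
move=> z1 bl l0 a0 a1 mg gfin H vw vH.
have mG := measurable_strip mg.
have mH : measurable_fun setT H := measurable_jhcap alpha mG.
have [C C0 hC] := laplace_hcap_near l0 a0 a1.
have tfin := tail_bound z1 bl vw mH vH.
have nfin := near_bound mg gfin.
pose k1 (t : R) : R := (0 < t <= 1)%R%:R.
pose k2 (t : R) : R := (1 < t)%R%:R * expR (- (l * t)).
have mk1 : measurable_fun setT k1.
  rewrite /k1; under eq_fun do rewrite -mulnb natrM.
  by apply: measurable_funM; [exact: measurable_pos|exact: measurable_le_ind].
have mk2 : measurable_fun setT k2.
  by apply: measurable_funM; [exact: measurable_gt_ind|exact: measurable_expRl].
have k20 t : 0 <= k2 t by rewrite mulr_ge0 ?expR_ge0.
pose I1 := (\int[mu]_t ((k1 t)%:E * N2 (fun y => strip g (t, y))))%E.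
pose I2 := (\int[mu]_t ((k2 t)%:E * N2 (fun y => H (t, y))))%E.
have I10 : (0 <= I1)%E by apply: integral_ge0 => t _; rewrite mule_ge0 ?lee_fin ?N2_ge0.
have I20 : (0 <= I2)%E by apply: integral_ge0 => t _; rewrite mule_ge0 ?lee_fin ?N2_ge0.
have I1f : (I1 \is a fin_num)%E by rewrite ge0_fin_numE.
have I2f : (I2 \is a fin_num)%E by rewrite ge0_fin_numE.
have fI1 : 0 <= fine I1 by exact: fine_ge0.
have fI2 : 0 <= fine I2 by exact: fine_ge0.
exists (C * fine I1 + fine I2); first by rewrite addr_ge0// mulr_ge0.
move=> phi mp.
have B1 := mixed_bound mk1 (fun t => ler0n _ _) mG mp.
have B2 := mixed_bound mk2 k20 mH mp.
rewrite EFinD EFinM !fineK// ge0_muleDl ?mule_ge0 ?lee_fin//.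
rewrite -muleA; apply: le_trans (leeD (lee_wpmul2l _ B1) B2); last by rewrite lee_fin.
have mK (k : R -> R) (w : R * R -> R) : measurable_fun setT k -> measurable_fun setT w ->
    measurable_fun setT (fun z : R * R => (`|k z.2 * w (z.2, z.1) * phi z.1|)%:E).
  move=> mk mw; apply/measurable_EFinP; apply: (measurableT_comp (@normr_measurable R setT)).
  apply: measurable_funM; last by apply: (measurableT_comp mp); exact: measurable_fst.
  apply: measurable_funM; first by apply: (measurableT_comp mk); exact: measurable_snd.
  by apply: (measurableT_comp mw); exact: measurable_swap.
have mK1 (k : R -> R) (w : R * R -> R) y : measurable_fun setT k -> measurable_fun setT w ->
    measurable_fun setT (fun t : R => (`|k t * w (t, y) * phi y|)%:E).
  move=> mk mw; apply/measurable_EFinP; apply: (measurableT_comp (@normr_measurable R setT)).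
  apply: measurable_funM => //; apply: measurable_funM => //.
  exact: (measurable_sec y mw).
have mI (k : R -> R) (w : R * R -> R) : measurable_fun setT k -> measurable_fun setT w ->
    measurable_fun setT (fun y => \int[mu]_t (`|k t * w (t, y) * phi y|)%:E)%E.
  move=> mk mw.
  exact: (measurable_integral2 mu (f := fun z => (`|k z.2 * w (z.2, z.1) * phi z.1|)%:E) (mK k w mk mw)).
have I0 (k : R -> R) (w : R * R -> R) y : setT y ->
    (0 <= \int[mu]_t (`|k t * w (t, y) * phi y|)%:E)%E.
  by move=> _; apply: integral_ge0 => t _; rewrite lee_fin.
have C0' : (0 <= C%:E)%E by rewrite lee_fin.
have m1 := mI _ _ mk1 mG; have m2 := mI _ _ mk2 mH.
have e1 := ge0_integralZl mu measurableT m1 (I0 k1 (strip g)) C0'.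
rewrite -e1.
have m3 : measurable_fun setT (fun y => C%:E * \int[mu]_t (`|k1 t * strip g (t, y) * phi y|)%:E)%E.
  exact: emeasurable_funM.
have p3 y : setT y -> (0 <= C%:E * \int[mu]_t (`|k1 t * strip g (t, y) * phi y|)%:E)%E.
  by move=> yT; rewrite mule_ge0// I0.
have e2 := ge0_integralD mu measurableT p3 m3 (I0 k2 H) m2.
rewrite -e2.
have me : measurable_fun setT (fun t => expR (- (l * t))) by exact: measurable_expRl.
apply: ge0_le_integral => //.
- by move=> y _; apply: integral_ge0 => t _; rewrite lee_fin.
- by under eq_fun do (rewrite ewE; under eq_integral do rewrite /sec); exact: mI.
- exact: emeasurable_funD.
move=> y _.
have -> : (\int[mu]_t `|ew l (sec H y) t * phi y|%:E =
  \int[mu]_t (`|(t <= 1)%R%:R * ew l (sec H y) t|%:E * `|phi y|%:E) +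
  \int[mu]_t `|k2 t * H (t, y) * phi y|%:E)%E.
  rewrite -ge0_integralD//; last 2 first.
  - apply: emeasurable_funM => //; apply/measurable_EFinP.
    apply: (measurableT_comp (@normr_measurable R setT)).
    apply: measurable_funM; first exact: measurable_le_ind.
    by apply: measurable_ew; exact: measurable_sec.
  - exact: mK1.
  apply: eq_integral => t _; rewrite -EFinM -EFinD; congr EFin.
  rewrite ewE /k2 /sec; have [t1|t1] := leP t 1.
    by rewrite !mul0r normr0 addr0 mul1r -normrM.
  by rewrite !mul0r normr0 mul0r add0r mul1r.
apply: leeD => //.
rewrite ge0_integralZr//; last first.
  apply/measurable_EFinP; apply: (measurableT_comp (@normr_measurable R setT)).
  apply: measurable_funM; first exact: measurable_le_ind.
  by apply: measurable_ew; exact: measurable_sec.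
have -> : (\int[mu]_t `|k1 t * strip g (t, y) * phi y|%:E =
  (\int[mu]_t `|k1 t * sec (strip g) y t|%:E) * `|phi y|%:E)%E.
  rewrite -ge0_integralZr//.
    by apply: eq_integral => t _; rewrite -EFinM -normrM.
  apply/measurable_EFinP; apply: (measurableT_comp (@normr_measurable R setT)).
  by apply: measurable_funM => //; exact: measurable_sec.
rewrite muleA; apply: lee_wpmul2r; first by rewrite lee_fin.
have hy := hC _ (measurable_sec y mG) (@causal_strip g y).
have -> : sec H y = hcap alpha (sec (strip g) y) by [].
exact: hy.
Qed.

End Weighted_bound.

(** * Test functions and mollification *)

Section Smooth.
Context {R : realType}.
Local Notation mu := (@lebesgue_measure R).
Implicit Types f g phi : R -> R.

(** Recursion on the derivative of the function rather than on iterated derivatives; in this form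
    sums and products go through by a plain induction on n. *)
Fixpoint smoothn n f : Prop :=
  if n is m.+1 then (forall x, derivable f x 1) /\ smoothn m (derive1 f) else True.

Lemma smoothnP f : (forall n, smoothn n f) <->
  (forall k x, derivable (derive1n k f) x 1).
Proof.
split=> [h k|h n].
  suff : forall g, smoothn k.+1 g -> forall x, derivable (derive1n k g) x 1.
    by move=> H; apply: H; exact: h.
  elim: k {h} => [g []//|k IH g [gd gs] x].
  by rewrite derive1Sn; exact: IH.
elim: n f h => [//|n IH f h] /=; split; first exact: (h 0%N).
by apply: IH => k x; rewrite -derive1Sn; exact: h.
Qed.

Lemma is_derive_derive1 f d : (forall x, is_derive x (1 : R) f (d x)) ->
  (forall x, derivable f x 1) /\ derive1 f = d.
Proof.
move=> h; split=> [x|]; first exact: (@ex_derive _ _ _ _ _ _ _ (h x)).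
by apply/funext => x; rewrite derive1E (@derive_val _ _ _ _ _ _ _ (h x)).
Qed.

Lemma derivable_is_derive f x : derivable f x 1 -> is_derive x (1 : R) f (derive1 f x).
Proof. by move=> h; rewrite derive1E; exact: (DeriveDef h). Qed.

Lemma smoothn_le n f : smoothn n.+1 f -> smoothn n f.
Proof. by elim: n f => [//|n IH] f [fd /IH]. Qed.

Lemma smoothn_ext n f g : f =1 g -> smoothn n f -> smoothn n g.
Proof. by move=> /funext ->. Qed.

Lemma smoothnD n f g : smoothn n f -> smoothn n g -> smoothn n (fun x => f x + g x).
Proof.
elim: n f g => [//|n IH] f g [fd fs] [gd gs].
have h x : is_derive x (1 : R) (fun x => f x + g x) (derive1 f x + derive1 g x).
  by apply: is_deriveD; exact: derivable_is_derive.
have [h1 h2] := is_derive_derive1 h; split => //.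
by rewrite h2; exact: IH.
Qed.

Lemma smoothnZ n c f : smoothn n f -> smoothn n (fun x => c * f x).
Proof.
elim: n f => [//|n IH] f [fd fs].
have h x : is_derive x (1 : R) (fun x => c * f x) (c * derive1 f x).
  by apply: is_deriveZ; exact: derivable_is_derive.
have [h1 h2] := is_derive_derive1 h; split => //.
by rewrite h2; exact: IH.
Qed.

Lemma smoothnM n f g : smoothn n f -> smoothn n g -> smoothn n (fun x => f x * g x).
Proof.
elim: n f g => [//|n IH] f g /[dup] /smoothn_le fn [fd fs] /[dup] /smoothn_le gn [gd gs].
have h x : is_derive x (1 : R) (fun x => f x * g x) (f x * derive1 g x + g x * derive1 f x).
  by apply: is_deriveM; exact: derivable_is_derive.
have [h1 h2] := is_derive_derive1 h; split => //.
by rewrite h2; apply: smoothnD; exact: IH.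
Qed.

Lemma is_derive_affine (a b x : R) : is_derive x (1 : R) (fun y => a * y + b) a.
Proof.
have h : is_derive x (1 : R) (fun y => a * y + b) (a * 1 + 0).
  apply: is_deriveD; exact: is_deriveZ.
by rewrite mulr1 addr0 in h.
Qed.

Lemma is_derive_comp_affine (a b x d : R) f : is_derive (a * x + b) (1 : R) f d ->
  is_derive x (1 : R) (fun y => f (a * y + b)) (a * d).
Proof.
move=> h; rewrite mulrC.
exact: (@is_derive1_comp _ f (fun y => a * y + b) x d a h (is_derive_affine a b x)).
Qed.

Lemma derive1n_affine (a b : R) f k : (forall j x, derivable (derive1n j f) x 1) ->
  derive1n k (fun y => f (a * y + b)) = fun y => a ^+ k * derive1n k f (a * y + b).
Proof.
move=> fd; elim: k => [|k IH]; first by apply/funext => y; rewrite expr0 mul1r.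
rewrite derive1nS IH; have h x : is_derive x (1 : R)
    (fun y => a ^+ k * derive1n k f (a * y + b)) (a ^+ k.+1 * derive1n k.+1 f (a * x + b)).
  rewrite exprSr -mulrA; apply: is_deriveZ; apply: is_derive_comp_affine.
  by rewrite derive1nS; exact: derivable_is_derive.
exact: (is_derive_derive1 h).2.
Qed.

Lemma test_affine (a b : R) phi : a != 0 -> test_function phi ->
  test_function (fun y => phi (a * y + b)).
Proof.
move=> a0 [pd [M pM]]; split.
  move=> k x; rewrite derive1n_affine//.
  have h : is_derive x (1 : R) (fun y => a ^+ k * derive1n k phi (a * y + b))
    (a ^+ k * (a * derive1n k.+1 phi (a * x + b))).
    apply: is_deriveZ; apply: is_derive_comp_affine.
    by rewrite derive1nS; exact: derivable_is_derive.
  exact: (@ex_derive _ _ _ _ _ _ _ h).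
exists ((M + `|b|) / `|a|) => x; rewrite ltr_pdivrMr ?normr_gt0// => h.
apply: pM; have := ler_normB (a * x + b) b; rewrite addrK normrM mulrC.
by move: h; lra.
Qed.

Lemma derive1_support f M : (forall x, M < `|x| -> f x = 0) ->
  forall x, M < `|x| -> derive1 f x = 0.
Proof.
move=> fM x xM; rewrite derive1E.
rewrite (@near_eq_derive _ _ _ _ (cst 0) x 1); first by rewrite derive_cst.
have : \forall y \near x, M < `|y|.
  by have := @norm_continuous _ R^o x; move/cvgr_gt; apply.
by apply: filterS => y /fM.
Qed.

Lemma test_derive1n k phi : test_function phi -> test_function (derive1n k phi).
Proof.
move=> [pd [M pM]]; split.
  by move=> j x; rewrite /derive1n -iterD; exact: (pd (j + k)%N x).
exists M; elim: k => [//|k IH]; rewrite derive1nS; exact: derive1_support.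
Qed.

Lemma test_derivable phi x : test_function phi -> derivable phi x 1.
Proof. by move=> [pd _]; exact: (pd 0%N). Qed.

Lemma test_continuous phi : test_function phi -> continuous phi.
Proof.
move=> tp x; apply: differentiable_continuous; apply/derivable1_diffP.
exact: test_derivable.
Qed.

Lemma test_measurable phi : test_function phi -> measurable_fun setT phi.
Proof. by move=> tp; apply: continuous_measurable_fun; exact: test_continuous. Qed.

Lemma test_bounded phi : test_function phi -> exists2 B, 0 <= B & forall x, `|phi x| <= B.
Proof.
move=> tp; have [_ [M pM]] := tp.
have cn : {within `[- `|M|, `|M|], continuous (fun x => `|phi x|)}.
  apply: continuous_subspaceT => x; apply: continuous_comp; first exact: test_continuous.
  exact: norm_continuous.
have [|c _ hc] := @EVT_max _ (fun x => `|phi x|) (- `|M|) `|M| _ cn.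
  by have := normr_ge0 M; lra.
exists `|phi c| => // x; have [xM|xM] := ltP M `|x|.
  by rewrite pM// normr0.
apply: hc; rewrite in_itv/=; have h := le_trans xM (ler_norm M).
by have := ler_norml x `|M|; rewrite h => /esym.
Qed.

Lemma test_intg phi : test_function phi -> intg mu phi.
Proof.
move=> tp; have [B B0 hB] := test_bounded tp; have [_ [M pM]] := tp.
apply: (@le_intg _ _ _ mu _ (fun x => B * \1_(`[- `|M|, `|M|]) x)).
- exact: test_measurable.
- move=> x; rewrite indicE mem_setE in_itv/=; have [h|h] := boolP (- `|M| <= x <= `|M|).
    by rewrite mulr1.
  rewrite pM ?normr0 ?mulr0//; rewrite ltNge; apply: contra h => xM.
  have h := le_trans xM (ler_norm M).
  by have := ler_norml x `|M|; rewrite h => /esym.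
- apply: intgZ; apply: integrable_indic_itv.
Qed.

Lemma N2_of_bounded phi B : (forall x, `|phi x| <= B) -> intg mu phi -> (N2 phi < +oo)%E.
Proof.
move=> hB iphi; have mphi := intg_measurable iphi.
have : (\int[mu]_x (`|phi x| `^ 2)%:E < +oo)%E.
  apply: (@le_lt_trans _ _ (\int[mu]_x (B * `|phi x|)%:E)%E).
    have B0 : 0 <= B := le_trans (normr_ge0 _) (hB 0).
    apply: ge0_le_integral => //.
    - apply/measurable_EFinP; apply: (measurableT_comp (measurable_powRr 2)).
      exact: measurableT_comp.
    - apply/measurable_EFinP; apply: measurable_funM => //; exact: measurableT_comp.
    - by move=> x _; rewrite lee_fin powR_mulrn// expr2 ler_wpM2r.
  by rewrite -EFin_Rint ?ltry//; apply: intgZ; exact: intg_norm.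
rewrite /N2 unlock; have : (0 <= \int[mu]_x (`|phi x| `^ 2)%:E)%E.
  by apply: integral_ge0 => x _; rewrite lee_fin powR_ge0.
rewrite -[X in (0 <= X)%E -> _]/(\int[mu]_x (`|(EFin \o phi) x| `^ 2))%E.
case: integral => [r| |]//= _ _.
by rewrite ltry.
Qed.

Lemma test_N2 phi : test_function phi -> (N2 phi < +oo)%E.
Proof.
by move=> tp; have [B _ hB] := test_bounded tp; exact: N2_of_bounded hB (test_intg tp).
Qed.

End Smooth.

Section Bump.
Context {R : realType}.
Local Notation mu := (@lebesgue_measure R).

(** The derivative of [flat k] is [flat k.+2] minus k times [flat k.+1], so this family, which
    starts with exp(-1/x), is stable under differentiation and one induction makes all its members
    smooth. *)
Definition flat (k : nat) (x : R) : R :=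
  if 0 < x then x ^- k * expR (- x^-1) else 0.

(** From e^y >= y at y = 1/(n x), raised to the power n. *)
Lemma expRN_inv_le (n : nat) (x : R) : 0 < x ->
  expR (- x^-1) <= (n%:R * x) ^+ n.
Proof.
case: n => [|n] x0; first by rewrite expr0 expR_le1 oppr_le0 invr_ge0 ltW.
have nx : 0 < n.+1%:R * x :> R by rewrite mulr_gt0.
rewrite expRN invf_ple ?posrE ?expR_gt0 ?exprn_gt0//.
rewrite -exprVn [in leRHS](_ : x^-1 = n.+1%:R * (n.+1%:R * x)^-1); last first.
  by rewrite invfM mulrA divff// mul1r.
rewrite expRM_natl lerXn2r ?nnegrE ?invr_ge0 ?expR_ge0 ?(ltW nx)//.
by apply: le_trans (expR_ge1Dx _); rewrite lerDr.
Qed.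

Lemma flat_le (k : nat) (x : R) : 0 < x ->
  `|flat k x| <= k.+1%:R ^+ k.+1 * x.
Proof.
move=> x0; have h : 0 <= x ^- k * expR (- x^-1).
  by apply: mulr_ge0; rewrite ?expR_ge0// invr_ge0 exprn_ge0// ltW.
rewrite /flat x0 ger0_norm// mulrC ler_pdivrMr ?exprn_gt0// -mulrA -exprS -exprMn.
exact: expRN_inv_le.
Qed.

Lemma is_derive_flat k x :
  is_derive x (1 : R) (flat k) (flat k.+2 x - k%:R * flat k.+1 x).
Proof.
have [x0|x0|->] := ltgtP x 0.
- apply: (@near_eq_is_derive _ _ _ (cst 0)).
    have : \forall y \near x, y < 0 by exact: lt_nbhsl.
    by apply: filterS => y y0; rewrite /flat ltNge (ltW y0).
  by rewrite /flat !(ltNge 0) !(ltW x0)/= mulr0 subr0; exact: is_derive_cst.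
- have xn0 : x != 0 by rewrite gt_eqF.
  have h1 : is_derive x (1 : R) (fun y : R => y^-1) (- x ^- 2).
    have := @is_deriveV R id x 1 1 xn0 (is_derive_id x 1).
    by rewrite /GRing.scale/= mulr1.
  pose p (z : R) := z ^+ k * expR (- z).
  have h2 (z : R) : is_derive z (1 : R) p ((k%:R * z ^+ k.-1 - z ^+ k) * expR (- z)).
    have e1 : is_derive z (1 : R) (fun z : R => expR (- z)) (- expR (- z)).
      have := @is_derive1_comp R expR (-%R) z (expR (- z)) (-1).
      by rewrite mulrN1; apply.
    have e2 : is_derive z (1 : R) (fun z : R => z ^+ k) (k%:R * z ^+ k.-1).
      have := @is_deriveX R R id k z 1 1 (is_derive_id z 1).
      rewrite /GRing.scale/= mulr1; congr is_derive.
      by apply/funext => y; rewrite exprfctE.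
    have := @is_deriveM R R (fun z : R => z ^+ k) (fun z : R => expR (- z)) z 1 _ _ e2 e1.
    move/is_derive_eq; apply; rewrite /GRing.scale/=; ring.
  have h3 := @is_derive1_comp R p (fun y : R => y^-1) x _ _ (h2 _) h1.
  apply: (near_eq_is_derive (f := p \o (fun y : R => y^-1))).
    have : \forall y \near x, 0 < y by exact: lt_nbhsr.
    by apply: filterS => y y0; rewrite /flat y0 /p/= exprVn.
  apply: is_derive_eq h3 _.
  rewrite /flat x0; case: k p h2 => [|k] _ _ /=.
    rewrite mul0r sub0r expr0 expr1; field => //.
  rewrite -!exprVn; set z := x^-1; rewrite !exprS; ring.
(* At the origin the difference quotient from the right is [flat k.+1 h], which [flat_le] bounds by
   a multiple of h; from the left it is 0. *)
have c : (fun h : R => h^-1 *: ((flat k \o shift 0) (h *: (1 : R)) - flat k 0)) @ 0^' --> (0 : R).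
  apply/cvgr0Pnorm_le => /= eps eps0.
  pose C : R := k.+2%:R ^+ k.+2.
  have C0 : 0 < C by rewrite exprn_gt0.
  near=> h.
  have hn0 : h != 0 by near: h; exact: nbhs_dnbhs_neq.
  rewrite /= addr0 /GRing.scale/= mulr1 [flat k 0]/flat ltxx subr0.
  have [h0|h0] := leP h 0; first by rewrite /flat ltNge h0/= mulr0 normr0 ltW.
  have -> : h^-1 * flat k h = flat k.+1 h.
    by rewrite /flat h0 mulrA -invfM -exprS.
  apply: le_trans (flat_le _ h0) _; rewrite -/C -ler_pdivlMl//.
  have : `|h| <= C^-1 * eps.
    near: h; apply: nbhs_dnbhs; apply: (@nbhs0_le R R^o).
    by rewrite mulr_gt0// invr_gt0.
  by rewrite gtr0_norm.
have e : flat k.+2 0 - k%:R * flat k.+1 0 = 0 by rewrite /flat ltxx mulr0 subr0.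
rewrite e; apply: DeriveDef; first exact: (cvgP _ c).
exact: cvg_lim c.
Unshelve. all: by end_near. Qed.

Lemma smooth_flat n k : smoothn n (flat k).
Proof.
elim: n k => [//|n IH] k; have [h1 h2] := is_derive_derive1 (is_derive_flat k).
split => //; rewrite h2; apply: smoothnD; first exact: IH.
by apply: (smoothn_ext (f := fun x => - k%:R * flat k.+1 x)) => [x|]; [rewrite mulNr|apply: smoothnZ; exact: IH].
Qed.

Definition bump (x : R) : R := flat 0 (1 * x + 1) * flat 0 (-1 * x + 1).

Lemma bump_ge0 x : 0 <= bump x.
Proof.
by rewrite /bump /flat; do 2 case: ifP => _; rewrite ?mulr0 ?mul0r// !expr0 !invr1 !mul1r mulr_ge0 ?expR_ge0.
Qed.

Lemma bump_out x : 1 <= `|x| -> bump x = 0.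
Proof.
rewrite /bump /flat ler_normr => /orP[h|h].
  by rewrite [X in _ * X]ifF ?mulr0//; apply/negbTE; rewrite -leNgt; lra.
by rewrite ifF ?mul0r//; apply/negbTE; rewrite -leNgt; lra.
Qed.

Lemma smoothn_affine (a b : R) f : (forall n, smoothn n f) ->
  forall n, smoothn n (fun y => f (a * y + b)).
Proof.
move=> /smoothnP fd; apply/smoothnP => k x; rewrite derive1n_affine//.
have h : is_derive x (1 : R) (fun y => a ^+ k * derive1n k f (a * y + b))
    (a ^+ k * (a * derive1n k.+1 f (a * x + b))).
  apply: is_deriveZ; apply: is_derive_comp_affine.
  by rewrite derive1nS; exact: derivable_is_derive.
exact: (@ex_derive _ _ _ _ _ _ _ h).
Qed.

Lemma test_bump : test_function bump.
Proof.
split; last by exists 1 => x /ltW; exact: bump_out.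
by apply/smoothnP => n; apply: smoothnM; apply: smoothn_affine => m; exact: smooth_flat.
Qed.

Lemma bump_le1 x : bump x <= 1.
Proof.
have fl (y : R) : 0 <= flat 0 y <= 1.
  rewrite /flat; case: ifP => y0; rewrite ?lexx ?ler01// expr0 invr1 mul1r expR_ge0/=.
  by rewrite expR_le1 oppr_le0 invr_ge0 ltW.
by rewrite /bump mulr_ile1//; [case/andP: (fl (1 * x + 1))|case/andP: (fl (-1 * x + 1))|
  case/andP: (fl (1 * x + 1))|case/andP: (fl (-1 * x + 1))].
Qed.

(** For |x| <= 1/2 both 1 + x and 1 - x are at least 1/2, and exp(-1/y) >= e^{-2} for y >= 1/2. *)
Lemma bump_lower (x : R) : `|x| <= 2^-1 -> expR (-4) <= bump x.
Proof.
have fl (y : R) : 2^-1 <= y -> expR (-2) <= flat 0 y.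
  move=> y2; have y0 : 0 < y by lra.
  rewrite /flat y0 expr0 invr1 mul1r ler_expR lerN2.
  by rewrite -[leRHS]invrK lef_pV2// posrE; lra.
rewrite ler_norml => /andP[h1 h2].
have -> : (-4 : R) = -2 + -2 by ring.
by rewrite expRD /bump; apply: ler_pM; rewrite ?expR_ge0//; apply: fl; lra.
Qed.

Lemma integral_bump_gt0 : 0 < \int[mu]_x bump x.
Proof.
have ib := test_intg test_bump.
pose low (x : R) := expR (-4) * \1_(`[- 2^-1, 2^-1]) x : R.
have il : intg mu low by apply: intgZ; exact: integrable_indic_itv.
have : \int[mu]_x low x <= \int[mu]_x bump x.
  apply: le_Rintegral => // x _; rewrite /low indicE mem_setE in_itv/=.
  have [h|h] := boolP (_ <= x <= _); last by rewrite mulr0 bump_ge0.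
  by rewrite mulr1 bump_lower// ler_norml.
apply: lt_le_trans.
rewrite /low RintZ; last exact: integrable_indic_itv.
rewrite mulr_gt0 ?expR_gt0// /Rintegral integral_indic// setIT.
have e : mu [set` `[(- 2^-1 : R), 2^-1]] = 1%:E.
  by rewrite lebesgue_measure_itv/= lte_fin ifT; [rewrite -EFinD; congr EFin|]; lra.
by rewrite [X in fine X]e.
Qed.

(** This is bump((x - y)/eps), not normalised: its mass is eps times that of [bump]. The affine form
    in y is the one covered by [test_affine]. *)
Definition sbump (eps x y : R) : R := bump ((- eps^-1) * y + eps^-1 * x).

Lemma test_sbump eps x : 0 < eps -> test_function (sbump eps x).
Proof.
by move=> e0; apply: test_affine test_bump; rewrite oppr_eq0 invr_eq0 gt_eqF.
Qed.

Lemma sbump_ge0 eps x y : 0 <= sbump eps x y. Proof. exact: bump_ge0. Qed.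

Lemma sbump_le eps x y : 0 < eps -> sbump eps x y <= (`|y - x| < eps)%R%:R.
Proof.
move=> e0; have [h|h] := ltP; first exact: bump_le1.
rewrite /sbump bump_out// mulNr addrC -mulrBr normrM gtr0_norm ?invr_gt0//.
by rewrite ler_pdivlMl// mulr1 distrC.
Qed.

Lemma Rint_sbump eps x : 0 < eps -> \int[mu]_y sbump eps x y = eps * \int[mu]_y bump y.
Proof.
move=> e0; have mb := test_measurable test_bump.
have ei : 0 < eps^-1 by rewrite invr_gt0.
have h := Rint_affine 0 ei mb; rewrite invrK in h; rewrite -h.
have m2 : measurable_fun setT (fun t => bump (eps^-1 * t + 0)).
  by apply: (measurableT_comp mb); exact: measurable_affine.
rewrite -(Rint_reflect x m2); apply: eq_Rintegral => y _.
by rewrite /sbump; congr bump; ring.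
Qed.

Lemma local_intg (z : R -> R) x eps : 0 < eps -> locally_integrable setT z ->
  intg mu (fun y => (`|y - x| < eps)%R%:R * z y).
Proof.
move=> e0 [mz _ hz]; have := hz [set` `[x - eps, x + eps]] (fun _ _ => I) (@segment_compact _ _ _).
have mi : measurable_fun setT (fun y : R => (`|y - x| < eps)%R%:R : R).
  rewrite (_ : (fun y : R => _) = \1_(ball x eps)).
    by apply: measurable_indic; exact: measurable_ball.
  by apply/funext => y; rewrite indicE /ball/= mem_setE distrC.
rewrite integral_mkcond => fin; apply/intgP; split; first exact: measurable_funM.
apply: le_lt_trans fin; apply: ge0_le_integral => //.
- apply/measurable_EFinP; apply: (measurableT_comp (@normr_measurable R setT)).
  exact: measurable_funM.
- apply/(measurable_restrictT _ _).1 => //; apply: measurable_funTS.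
  by apply/measurable_EFinP; exact: measurableT_comp.
- move=> y _; rewrite /patch; have [h|h] := ltP; last by rewrite mul0r normr0; case: ifP => _; rewrite lee_fin.
  rewrite mul1r ifT// inE/= in_itv/=; move: h; rewrite ltr_norml => /andP[h1 h2].
  by apply/andP; split; lra.
Qed.

(** At a Lebesgue point x the vanishing pairing shows that eps |z(x)| times the mass of [bump] is at
    most the integral of |z(x) - z(y)| over the ball of radius eps, that is 2 eps times the mean
    deviation, which tends to 0. *)
Lemma mollified_eq0 (z : R -> R) : locally_integrable setT z ->
  (forall eps x, 0 < eps -> \int[mu]_y (z y * sbump eps x y) = 0) ->
  {ae mu, forall y, z y = 0}.
Proof.
move=> lz h; apply: (aeS (lebesgue_differentiation lz)) => x lx.
pose c := \int[mu]_y bump y.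
have c0 : 0 < c := integral_bump_gt0.
have mz : measurable_fun setT z by case: lz.
have bound eps : 0 < eps -> ((`|z x| * c)%:E <= 2%:E * davg z x eps)%E.
  move=> e0; have ts := test_sbump x e0.
  have i1 : intg mu (fun y => z x * sbump eps x y) by apply: intgZ; exact: test_intg.
  have mzs : measurable_fun setT (fun y => z y * sbump eps x y).
    by apply: measurable_funM => //; exact: test_measurable.
  have i2 : intg mu (fun y => z y * sbump eps x y).
    apply: (@le_intg _ _ _ mu _ _ mzs _ (intg_norm (local_intg x e0 lz))) => y.
    have s1 := sbump_le x y e0.
    rewrite [leLHS]normrM [leRHS]normrM mulrC; apply: ler_wpM2r => //.
    rewrite ger0_norm; last exact: sbump_ge0.
    by apply: le_trans s1 _; exact: ler_norm.
  have e1 : \int[mu]_y ((z x - z y) * sbump eps x y) = eps * (z x * c).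
    transitivity (\int[mu]_y (z x * sbump eps x y - z y * sbump eps x y)).
      by apply: eq_Rintegral => y _; rewrite mulrBl.
    rewrite RintegralB// (h eps x e0) subr0 RintZ; last exact: test_intg.
    rewrite Rint_sbump// /c; ring.
  have i3 : intg mu (fun y => (z x - z y) * sbump eps x y).
    by apply: eq_intg (intgB i1 i2) => y; rewrite mulrBl.
  have : ((eps * (`|z x| * c))%:E <= \int[mu]_(y in ball x eps) `|((center (z x) \o z) y)%:E|)%E.
    have -> : eps * (`|z x| * c) = `|eps * (z x * c)|.
      by rewrite !normrM (gtr0_norm e0) (gtr0_norm c0).
    rewrite -e1; apply: le_trans (_ : _ <= \int[mu]_y `|((z x - z y) * sbump eps x y)%:E|)%E _.
      by rewrite -abse_EFin EFin_Rint//; apply: le_abse_integral => //; apply/measurable_EFinP; exact: intg_measurable i3.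
    rewrite [leRHS]integral_mkcond; apply: ge0_le_integral => //.
    - apply: measurableT_comp => //; apply/measurable_EFinP; exact: intg_measurable i3.
    - apply/(measurable_restrictT _ _).1; first exact: measurable_ball.
      apply: measurable_funTS; apply: measurableT_comp => //; apply/measurable_EFinP.
      by apply: measurable_funD.
    - move=> y _; rewrite /patch; have := sbump_le x y e0; rewrite distrC; case: ifPn.
        move=> _; rewrite /= lee_fin normrM (ger0_norm (sbump_ge0 _ _ _)) [`|z x - _|]distrC => s1.
        by apply: ler_piMr => //; apply: le_trans s1 _; case: (_ < _).
      rewrite notin_setE /ball/= =>  /negP/negbTE -> s0.
      have -> : sbump eps x y = 0 by apply: le_anti; rewrite s0 sbump_ge0.
      by rewrite mulr0 normr0.
  rewrite /davg /iavg (lebesgue_measure_ball x (ltW e0)).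
  case: integral => [r| |]//=.
  - rewrite inver ifF; last by rewrite mulrn_eq0/= gt_eqF.
    rewrite lee_fin => hh; rewrite -!EFinM lee_fin -(ler_pM2l e0); apply: le_trans hh _.
    rewrite le_eqVlt; apply/orP; left; apply/eqP.
    by rewrite -[eps *+ 2]mulr_natl; field; rewrite gt_eqF.
  - rewrite inver ifF; last by rewrite mulrn_eq0/= gt_eqF.
    by rewrite !gt0_muley ?leey// lte_fin invr_gt0 mulrn_wgt0.
apply/eqP; apply: contraT => zx0.
have zc : 0 < `|z x| * c by rewrite mulr_gt0// normr_gt0.
move/fine_cvgP : lx => -[fl cl].
(* A quarter suffices, since [bound] carries a factor 2. *)
have : 0 < `|z x| * c / 4 by rewrite divr_gt0.
move/cvgr0Pnorm_lt : cl => /[apply] cl.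
suff : \forall eps \near (0:R)^'+, False by move/filter_const.
near=> eps; have e0 : 0 < eps by near: eps; exact: nbhs_right_gt.
have f1 : davg z x eps \is a fin_num by near: eps.
have := bound _ e0; rewrite -(fineK f1) -EFinM lee_fin.
have : `|fine (davg z x eps)| < `|z x| * c / 4 by near: eps; exact: cl.
rewrite ltr_norml => /andP[_]; move: zc; lra.
Unshelve. all: by end_near. Qed.

End Bump.

(** * The equation in Laplace variables *)

Section Representation.
Context {R : realType}.
Local Notation mu := (@lebesgue_measure R).
Implicit Types (k phi f p : R -> R) (w D H q : R * R -> R) (u v g : R -> R -> R).

Definition jconv k w (z : R * R) : R := conv k (sec w z.2) z.1.

Lemma measurable_jfirstd alpha w : measurable_fun setT w ->
  measurable_fun setT (fun z : R * R => firstd alpha (sec w z.2) z.1).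
Proof.
move=> mw; rewrite /firstd; case: (_ == _).
  by rewrite (_ : (fun _ => _) = w)//; apply/funext => -[].
by apply: measurable_jconv => //; exact: measurable_fk.
Qed.

Lemma causal_firstd alpha (G : R -> R) : causal G -> causal (firstd alpha G).
Proof.
move=> cG; rewrite /firstd; case: (_ == _) => //.
by apply: causal_conv => //; exact: causal_fk.
Qed.

Lemma causal_hcap alpha (G : R -> R) : causal G -> causal (hcap alpha G).
Proof.
move=> cG; rewrite /hcap; case: (_ == _) => //.
by apply: causal_conv => //; exact: causal_fk.
Qed.

(** The single constant e^T + 1 covers both forms of [firstd]: 1 when it is the identity, e^T when
    it is integration, from a kernel of damped mass 1 and e^{-t} >= e^{-T} before T. *)
Lemma firstd_near (alpha T : R) : 0 < T ->
  exists2 C : R, 0 <= C & forall G : R -> R, measurable_fun setT G -> causal G ->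
  (\int[mu]_t `|(t <= T)%R%:R * firstd alpha G t|%:E <=
   C%:E * \int[mu]_t `|(0 < t <= T)%R%:R * G t|%:E)%E.
Proof.
move=> T0; exists (expR T + 1) => [|G mG cG]; first by rewrite addr_ge0 ?expR_ge0.
pose G1 := trunc_at T G.
have mG1 : measurable_fun setT G1 by exact: measurable_trunc.
have G1E t : `|G1 t| = `|(0 < t <= T)%R%:R * G t|.
  rewrite /G1 /trunc_at; have [t0|t0] := ltP 0 t => //.
  by rewrite cG// !mulr0.
have nn : (0 <= \int[mu]_t `|(0 < t <= T)%R%:R * G t|%:E)%E.
  by apply: integral_ge0 => t _; rewrite lee_fin.
have mn (h : R -> R) : measurable_fun setT h -> measurable_fun setT (fun t => (`|h t|)%:E).
  by move=> mh; apply/measurable_EFinP; exact: measurableT_comp.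
rewrite /firstd; case: (_ == _).
  apply: (@le_trans _ _ (1%:E * \int[mu]_t `|(0 < t <= T)%R%:R * G t|%:E)%E); last first.
    by apply: lee_wpmul2r => //; rewrite lee_fin lerDr expR_ge0.
  rewrite mul1e le_eqVlt; apply/orP; left; apply/eqP.
  by apply: eq_integral => t _; rewrite -G1E.
apply: (@le_trans _ _ ((expR T)%:E * \int[mu]_t `|(0 < t <= T)%R%:R * G t|%:E)%E); last first.
  by apply: lee_wpmul2r => //; rewrite lee_fin lerDl.
have hG1 t : t <= T -> conv (fk 1) G t = conv (fk 1) G1 t.
  move=> t1; apply: eq_conv_causal; first exact: causal_fk.
  by move=> s st; rewrite /G1 trunc_atE// ltW// (lt_le_trans st).
have mc : measurable_fun setT (ew 1 (conv (fk 1) G1)).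
  by apply: measurable_ew; apply: measurable_conv => //; exact: measurable_fk.
have h1 : (\int[mu]_t `|ew 1 (conv (fk 1) G1) t|%:E <= \int[mu]_t `|(0 < t <= T)%R%:R * G t|%:E)%E.
  have le02 : (1 : R) <= 2 by lra.
  apply: le_trans (le_laplace_conv 1 (measurable_fk 1) mG1) _.
  rewrite integral_ew_fk// powR1 mul1e; apply: ge0_le_integral => //.
  - by apply: mn; exact: measurable_ew.
  - by under eq_fun do rewrite -G1E; exact: mn.
  - move=> t _; rewrite -G1E lee_fin ewE; have [t0|t0] := leP t 0.
      by rewrite /G1 /trunc_at cG// !mulr0.
    rewrite normrM ger0_norm ?expR_ge0// ler_piMl// expR_le1.
    by rewrite oppr_le0 mul1r ltW.
apply: (@le_trans _ _ ((expR T)%:E * \int[mu]_t `|ew 1 (conv (fk 1) G1) t|%:E)%E); last first.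
  by apply: lee_wpmul2l h1; rewrite lee_fin expR_ge0.
rewrite -ge0_integralZl//; last exact: mn.
apply: ge0_le_integral => //.
- apply: mn; apply: measurable_funM; first exact: measurable_le_ind.
  by apply: measurable_conv => //; exact: measurable_fk.
- by apply: emeasurable_funM => //; exact: mn.
- move=> t _; rewrite -EFinM lee_fin ewE; have [tT|tT] := leP t T; last first.
    by rewrite mul0r normr0 mulr_ge0// expR_ge0.
  have -> : true%:R * conv (fk 1) G t = conv (fk 1) G1 t by rewrite hG1// mul1r.
  rewrite normrM ger0_norm ?expR_ge0// mulrA ler_peMl//.
  by rewrite -expRD -[leLHS]expR0 ler_expR; lra.
Qed.

(** The bound is local in time, since in general the solution class puts no weighted norm on the
    first time derivative; it serves for continuity in t, not for transforms. *)
Lemma mixed_firstd (alpha T : R) g : 0 < T -> strip_measurable g ->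
  (\int[mu]_(t in `]0%R, T]) 'N[mu]_2%:E[EFin \o g t] < +oo)%E ->
  exists2 M : R, 0 <= M & forall phi, measurable_fun setT phi ->
    (\int[mu]_y \int[mu]_t
       (`|(t <= T)%R%:R * firstd alpha (sec (strip g) y) t * phi y|)%:E <= M%:E * N2 phi)%E.
Proof.
move=> T0 mg gfin.
have mG := measurable_strip mg.
have [C C0 hC] := firstd_near alpha T0.
have nfin := near_bound mg gfin.
pose k1 (t : R) : R := (0 < t <= T)%R%:R.
have mk1 : measurable_fun setT k1.
  rewrite /k1; under eq_fun do rewrite -mulnb natrM.
  by apply: measurable_funM; [exact: measurable_pos|exact: measurable_le_ind].
pose I1 := (\int[mu]_t ((k1 t)%:E * N2 (fun y => strip g (t, y))))%E.
have I10 : (0 <= I1)%E by apply: integral_ge0 => t _; rewrite mule_ge0 ?lee_fin ?N2_ge0.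
have I1f : (I1 \is a fin_num)%E by rewrite ge0_fin_numE.
exists (C * fine I1); first by rewrite mulr_ge0// fine_ge0.
move=> phi mp.
have B1 := mixed_bound mk1 (fun t => ler0n _ _) mG mp.
rewrite EFinM !fineK// -muleA; apply: le_trans (lee_wpmul2l _ B1); last by rewrite lee_fin.
have mI (k : R -> R) w : measurable_fun setT k -> measurable_fun setT w ->
    measurable_fun setT (fun y => \int[mu]_t (`|k t * w (t, y) * phi y|)%:E)%E.
  move=> mk mw.
  apply: (measurable_integral2 mu (f := fun z => (`|k z.2 * w (z.2, z.1) * phi z.1|)%:E)).
  apply/measurable_EFinP; apply: (measurableT_comp (@normr_measurable R setT)).
  apply: measurable_funM; last by apply: (measurableT_comp mp); exact: measurable_fst.
  apply: measurable_funM; first by apply: (measurableT_comp mk); exact: measurable_snd.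
  by apply: (measurableT_comp mw); exact: measurable_swap.
have C0' : (0 <= C%:E)%E by rewrite lee_fin.
have m1 := mI _ _ mk1 mG.
have p1 (y : R) : setT y -> (0 <= \int[mu]_t (`|k1 t * strip g (t, y) * phi y|)%:E)%E.
  by move=> _; apply: integral_ge0 => t _; rewrite lee_fin.
have e1 := ge0_integralZl mu measurableT m1 p1 C0'.
rewrite -e1; apply: ge0_le_integral => //.
- by move=> y _; apply: integral_ge0 => t _; rewrite lee_fin.
- exact: (mI _ _ (measurable_le_ind T) (measurable_jfirstd alpha mG)).
- exact: emeasurable_funM.
move=> y _; have msy := measurable_sec y mG.
have split (h : R -> R) : measurable_fun setT h ->
    (\int[mu]_t `|h t * phi y|%:E = (\int[mu]_t `|h t|%:E) * `|phi y|%:E)%E.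
  move=> mh; rewrite -ge0_integralZr//.
    by apply: eq_integral => t _; rewrite -EFinM -normrM.
  by apply/measurable_EFinP; exact: measurableT_comp.
have -> := split (fun t => (t <= T)%R%:R * firstd alpha (sec (strip g) y) t); last first.
  apply: measurable_funM; first exact: measurable_le_ind.
  by rewrite /firstd; case: (_ == _) => //; apply: measurable_conv => //; exact: measurable_fk.
have -> := split (fun t => k1 t * sec (strip g) y t); last exact: measurable_funM.
rewrite muleA; apply: lee_wpmul2r; first by rewrite lee_fin.
by apply: hC => //; exact: causal_strip.
Qed.

(* The Volterra form of the problem, with q = du/dt and H = D_t^(2 alpha) u: u = f + I^1 q,
   I^1 q = I^(2 alpha) H, D_t^alpha u = I^alpha H; the two bounds are those that the norms of the
   solution class give after pairing with phi(y). *)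
Definition pde_rep (alpha c beta : R) f p u q H : Prop :=
  [/\ [/\ measurable_fun setT q, measurable_fun setT H,
          forall y, causal (sec q y) & forall y, causal (sec H y)],
      {ae mu, forall y, forall t, 0 < t -> u t y = f y + jconv (fk 1) q (t, y)},
      {ae (mu \x mu)%E, forall z, jconv (fk 1) q z = jconv (fk (2 * alpha)) H z},
      [/\ forall T, 0 < T -> exists2 M : R, 0 <= M & forall phi, measurable_fun setT phi ->
        (\int[mu]_y \int[mu]_t (`|(t <= T)%R%:R * q (t, y) * phi y|)%:E <= M%:E * N2 phi)%E &
        forall l, 0 < l -> beta < 2 * l -> exists2 M : R, 0 <= M &
        forall phi, measurable_fun setT phi ->
        (\int[mu]_y \int[mu]_t (`|ew l (sec H y) t * phi y|)%:E <= M%:E * N2 phi)%E] &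
      forall phi, test_function phi -> {ae mu, forall t, 0 < t ->
        \int[mu]_y ((f y + jconv (fk 1) q (t, y) - f y * p t) * derive1n 2 phi y) =
        \int[mu]_y ((c * jconv (fk alpha) H (t, y) + H (t, y)) * phi y)}].

(** [G] is a jointly measurable version of the n-th time derivative, and everything else is computed
    from it. The results are identified with the classical derivatives on almost every section in
    time, then almost everywhere in the plane. *)
Lemma pde_representation (alpha c zeta beta : R) f p u :
  0 < alpha -> alpha <= 1 -> -1 < zeta -> measurable_fun setT f ->
  anisotropic (2 * alpha) zeta beta u -> solves_equation alpha c f p u ->
  initial_conditions alpha f u ->
  exists q H, pde_rep alpha c beta f p u q H.
Proof.
move=> a0 a1 z1 mf [[hAC [g0 [mg0 hg0 fing0]]] _ [v wv hv] _] [g [hg eg]] [u0 hslope].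
have mv : strip_measurable v by case: wv.
pose G := strip g0.
have mG : measurable_fun setT G by exact: measurable_strip.
pose q z := firstd alpha (sec G z.2) z.1.
pose H z := hcap alpha (sec G z.2) z.1.
pose J z := Jcap alpha (sec G z.2) z.1.
have mq : measurable_fun setT q by exact: measurable_jfirstd.
have mH : measurable_fun setT H by exact: measurable_jhcap.
have mjc a w : measurable_fun setT w -> measurable_fun setT (jconv (fk a) w).
  by move=> mw; apply: measurable_jconv => //; exact: measurable_fk.
have mJ : measurable_fun setT J.
  rewrite /J /Jcap; case: (_ == _); first exact: mq.
  exact: (mjc (1 - alpha) q mq).
have slope : {ae mu, forall y, 2^-1 < alpha -> h^-1 * (u h y - u 0 y) @[h --> 0^'+] --> (0 : R)}.
  have [a2|a2] := boolP (2^-1 < alpha); last exact: aeW.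
  by apply: (aeS (hslope a2)) => y hy _.
have CS : {ae mu, forall y, let n := order_ceil (2 * alpha) in let phi := u^~ y in
    let G := sec G y in
    [/\ forall T, 0 < T -> intg mu (trunc_at T G),
      forall t, 0 < t -> phi t = phi 0 + conv (fk 1) (firstd alpha G) t,
      {ae mu, forall t, 0 < t -> caputo (2 * alpha) phi t = hcap alpha G t},
      forall t, 0 < t -> caputo alpha phi t = Jcap alpha G t &
      {ae mu, forall t, Jcap alpha G t = conv (fk alpha) (hcap alpha G) t} /\
      {ae mu, forall t, conv (fk 1) (firstd alpha G) t = conv (fk (2 * alpha)) (hcap alpha G) t}]}.
  apply: (aeS3 (ae_prod_sec2 hg0) hAC slope) => y hgy hACy hsy.
  apply: caputo_sections => //; first exact: measurable_sec.
    exact: causal_strip.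
  apply: (aeS hgy) => t ht t0.
  by rewrite /sec /G /strip/= t0 mul1r; exact: ht.
(* Through this equality the weighted norm of [v] becomes available for the computed [H]. *)
have vH : {ae (mu \x mu)%E, forall z : R * R, strip v z = strip (fun t y => H (t, y)) z}.
  apply: ae_prod_of_sec2.
  - exact: measurable_strip.
  - have -> : strip (fun t y => H (t, y)) = fun z => (0 < z.1)%R%:R * H z.
      by apply/funext => -[].
    apply: measurable_funM => //; apply: (measurableT_comp measurable_pos); exact: measurable_fst.
  - apply: (aeS2 (ae_prod_sec2 hv) CS) => y hvy [_ _ hcy _ _].
    apply: (aeS2 hvy hcy) => t h1 h2; rewrite /strip/=.
    by have [t0|] := ltP 0 t; rewrite ?mul0r// !mul1r -(h1 t0) (h2 t0).
have JH : {ae (mu \x mu)%E, forall z : R * R, J z = jconv (fk alpha) H z}.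
  apply: ae_prod_of_sec2 => //; first exact: mjc.
  by apply: (aeS CS) => y [_ _ _ _ [h _]].
have DH : {ae (mu \x mu)%E, forall z : R * R, jconv (fk 1) q z = jconv (fk (2 * alpha)) H z}.
  apply: ae_prod_of_sec2; [exact: mjc|exact: mjc|].
  by apply: (aeS CS) => y [_ _ _ _ [_ h]].
have rep : {ae mu, forall y, forall t, 0 < t -> u t y = f y + jconv (fk 1) q (t, y)}.
  by apply: (aeS2 u0 CS) => y uy [_ h _ _ _] t t0; rewrite -uy; exact: h.
have geq : {ae (mu \x mu)%E, forall z, 0 < z.1 -> g z.1 z.2 = c * jconv (fk alpha) H z + H z}.
  have cap : {ae mu, forall y, forall t, 0 < t -> caputo alpha (u^~ y) t = J (t, y)}.
    by apply: (aeS CS) => y [_ _ _ h _].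
  have cap2 := ae_prod_cyl2 mu cap.
  apply: (aeS2 (aeS2 eg cap2 (fun z a b => conj a b)) (aeS3 hv vH JH (fun z a b d => conj (conj a b) d))).
  move=> -[t y]/= [e1 e2] [[e3 e4] e5] t0.
  rewrite -(e1 t0) (e2 t t0) e5 (e3 t0); congr (_ + _).
  by move: e4; rewrite /strip/= t0 !mul1r.
exists q, H; split => //.
- split => // y; first exact: (causal_firstd alpha (@causal_strip _ g0 y)).
  exact: (causal_hcap alpha (@causal_strip _ g0 y)).
- split.
    move=> T T0; exact: (mixed_firstd alpha T0 mg0 (fing0 T T0)).
  move=> l l0 bl; exact: (mixed_hcap z1 bl l0 a0 a1 mg0 (fing0 1 ltr01) wv vH).
- move=> phi tphi.
  have mp := test_measurable tphi.
  have mp2 := test_measurable (test_derive1n 2 tphi).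
  apply: (aeS2 hg (ae_prod_sec1 geq)) => t hgt gt t0.
  have [[mu1 _ _] [mg1 _ _] /(_ phi tphi)] := hgt t0.
  have -> : (-1) ^+ 2 = 1 :> R by ring.
  have msec w : measurable_fun setT w -> measurable_fun setT (fun y => w (t, y)).
    by move=> mw; apply: (measurableT_comp mw); exact: pair1_measurable.
  rewrite mul1r => e.
  (* At a fixed time u may be replaced by its Volterra form for almost every y, because the
     exceptional null set in [rep] does not depend on t. *)
  transitivity (\int[mu]_y ((u t y - f y * p t) * derive1n 2 phi y)).
    apply: Rint_ae.
    + apply: measurable_funM => //; apply: measurable_funB.
        by apply: measurable_funD => //; apply: msec; exact: mjc.
      exact: measurable_funM.
    + exact: measurable_funM.
    + by apply: (aeS rep) => y /(_ t t0) ->.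
  rewrite e; apply: Rint_ae.
  + exact: measurable_funM.
  + apply: measurable_funM => //; apply: measurable_funD; last exact: msec.
    by apply: measurable_funM => //; apply: msec; exact: mjc.
  + by apply: (aeS gt) => y /(_ t0) /= ->.
Qed.

End Representation.

Section Transform.
Context {R : realType}.
Local Notation mu := (@lebesgue_measure R).
Implicit Types (k phi f p : R -> R) (w D H q : R * R -> R) (u v g : R -> R -> R).

Lemma prod_intg_swap w : intg (mu \x mu)%E w ->
  intg (mu \x mu)%E (fun z : R * R => w (z.2, z.1)).
Proof.
move=> iw; have mw := intg_measurable iw; apply: prod_intgP2.
  by apply: (measurableT_comp mw); exact: measurable_swap.
have mw' : measurable_fun setT (EFin \o w) by exact/measurable_EFinP.
exact: (integrable12ltyP mu mu mw').1 iw.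
Qed.

Definition lap l H (y : R) : R := \int[mu]_t ew l (sec H y) t.

(** Absolute integrability of e^{-lt} w(t, y) phi(y) in the plane: the form in which the bounds on
    [H] license the interchanges of integrals below. *)
Definition finite_mixed l H phi := 
  (\int[mu]_y \int[mu]_t (`|ew l (sec H y) t * phi y|)%:E < +oo)%E.

Lemma measurable_ewprod l w phi : measurable_fun setT w -> measurable_fun setT phi ->
  measurable_fun setT (fun z : R * R => ew l (sec w z.2) z.1 * phi z.2).
Proof.
move=> mw mp; apply: measurable_funM; last first.
  by apply: (measurableT_comp mp); exact: measurable_snd.
under eq_fun do rewrite ewE; apply: measurable_funM.
  by apply: (measurableT_comp (measurable_expRl l)); exact: measurable_fst.
by rewrite /sec; under eq_fun do rewrite -surjective_pairing.
Qed.

Lemma mixed_intg l w phi : measurable_fun setT w -> measurable_fun setT phi ->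
  finite_mixed l w phi ->
  intg (mu \x mu)%E (fun z : R * R => ew l (sec w z.2) z.1 * phi z.2).
Proof. by move=> mw mp fin; apply: prod_intgP2 => //; exact: measurable_ewprod. Qed.

Lemma measurable_lap l w : measurable_fun setT w -> measurable_fun setT (lap l w).
Proof.
move=> mw; apply: (measurable_Rint2 mu (f := fun z => ew l (sec w z.1) z.2)).
under eq_fun do rewrite ewE; apply: measurable_funM.
  by apply: (measurableT_comp (measurable_expRl l)); exact: measurable_snd.
by apply: (measurableT_comp mw); exact: measurable_swap.
Qed.

(** Where phi(y) = 0 the pairing carries no information on the section, hence the restriction on y;
    such y contribute nothing to the integrals either. *)
Lemma mixed_intg_ae l w phi : measurable_fun setT w -> measurable_fun setT phi ->
  finite_mixed l w phi ->
  {ae mu, forall y, phi y != 0 -> intg mu (ew l (sec w y))}.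
Proof.
move=> mw mp fin; apply: (aeS (prod_intg_ae2 (mixed_intg mw mp fin))) => y /= h p0.
by apply: eq_intg (intgZ (phi y)^-1 h) => t; rewrite mulrCA mulVf// mulr1.
Qed.

(** The factor [k] is 1 when w is H itself, and l^{-a} when w is its fractional integral of order
    a. *)
Lemma mixed_fubini l w phi (k : R) H : measurable_fun setT w -> measurable_fun setT phi ->
  measurable_fun setT H ->
  finite_mixed l w phi ->
  {ae mu, forall y, phi y != 0 -> lap l w y = k * lap l H y} ->
  [/\ intg mu (fun t => \int[mu]_y (ew l (sec w y) t * phi y)),
      intg mu (fun y => lap l w y * phi y) &
      \int[mu]_t \int[mu]_y (ew l (sec w y) t * phi y) =
        k * \int[mu]_y (lap l H y * phi y)].
Proof.
move=> mw mp mH fin lae; have iw := mixed_intg mw mp fin.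
have e y : \int[mu]_t (ew l (sec w y) t * phi y) = lap l w y * phi y.
  by rewrite RintMr//; apply: measurable_ew; exact: measurable_sec.
split.
- exact: (intg_Rint2 iw).
- by apply: eq_intg (intg_Rint2 (prod_intg_swap iw)) => y; rewrite -e.
- rewrite (Rint_fubini iw)/= -RintZm; last first.
    by apply: measurable_funM => //; exact: measurable_lap.
  transitivity (\int[mu]_y (lap l w y * phi y)).
    by apply: eq_Rintegral => y _; exact: e.
  apply: Rint_ae.
  + by apply: measurable_funM => //; exact: measurable_lap.
  + by apply: measurable_funM => //; apply: measurable_funM => //; exact: measurable_lap.
  + apply: (aeS lae) => y hy; have [->|/hy ->] := eqVneq (phi y) 0.
      by rewrite !mulr0.
    by rewrite mulrA.
Qed.

(** Young's inequality section by section gives the finiteness, with the damped mass l^{-a} of the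
    kernel as factor; on every integrable section the transform of the convolution is then the
    product of the transforms. *)
Lemma conv_mixed l (a : R) H phi : 0 < l -> 0 < a -> a <= 2 ->
  measurable_fun setT H -> measurable_fun setT phi ->
  finite_mixed l H phi ->
  finite_mixed l (jconv (fk a) H) phi /\
  {ae mu, forall y, phi y != 0 -> lap l (jconv (fk a) H) y = l `^ (- a) * lap l H y}.
Proof.
move=> l0 a0 a2 mH mp fin; split; last first.
  apply: (aeS (mixed_intg_ae mH mp fin)) => y h p0; have {}h := h p0.
  rewrite /lap -(laplace_fk l0 a0 a2) -laplace_conv//.
  - exact: intg_ew_fk.
  - exact: measurable_fk.
  - exact: measurable_sec.
have mk := measurable_fk a.
have mc : measurable_fun setT (jconv (fk a) H) by exact: measurable_jconv.
have mI w : measurable_fun setT w ->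
    measurable_fun setT (fun y => \int[mu]_t (`|ew l (sec w y) t * phi y|)%:E)%E.
  move=> mw; apply: (measurable_integral2 mu (f := fun z => (`|ew l (sec w z.1) z.2 * phi z.1|)%:E)).
  apply/measurable_EFinP; apply: (measurableT_comp (@normr_measurable R setT)).
  apply: measurable_funM; last by apply: (measurableT_comp mp); exact: measurable_fst.
  under eq_fun do rewrite ewE; apply: measurable_funM.
    by apply: (measurableT_comp (measurable_expRl l)); exact: measurable_snd.
  by apply: (measurableT_comp mw); exact: measurable_swap.
apply: (@le_lt_trans _ _ (\int[mu]_y ((l `^ (- a))%:E * \int[mu]_t (`|ew l (sec H y) t * phi y|)%:E))%E).
  apply: ge0_le_integral => //.
  - by move=> y _; apply: integral_ge0 => t _; rewrite lee_fin.
  - exact: mI.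
  - by apply: emeasurable_funM => //; exact: mI.
  move=> y _; have ms := measurable_sec y mH.
  have split (h : R -> R) : measurable_fun setT h ->
      (\int[mu]_t `|h t * phi y|%:E = (\int[mu]_t `|h t|%:E) * `|phi y|%:E)%E.
    move=> mh; rewrite -ge0_integralZr//.
      by apply: eq_integral => t _; rewrite -EFinM -normrM.
    by apply/measurable_EFinP; exact: measurableT_comp.
  have -> := split (ew l (sec (jconv (fk a) H) y)); last first.
    by apply: measurable_ew; exact: measurable_sec.
  have -> := split (ew l (sec H y)); last exact: measurable_ew.
  rewrite muleA; apply: lee_wpmul2r; first by rewrite lee_fin.
  by rewrite -(integral_ew_fk l0 a0 a2); exact: (le_laplace_conv l mk ms).
rewrite ge0_integralZl//; last 3 first.
- exact: mI.
- by move=> y _; apply: integral_ge0 => t _; rewrite lee_fin.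
- by rewrite lee_fin powR_ge0.
rewrite lte_mul_pinfty// ?lee_fin ?powR_ge0//.
Qed.

Lemma N2_mul_intg (f phi : R -> R) : measurable_fun setT f -> measurable_fun setT phi ->
  (N2 f < +oo)%E -> (N2 phi < +oo)%E -> intg mu (fun y => f y * phi y).
Proof.
move=> mf mp ff fp; apply/intgP; split; first exact: measurable_funM.
apply: le_lt_trans (cauchy_schwarz mf mp) _.
by rewrite lte_mul_pinfty ?N2_ge0// ge0_fin_numE// N2_ge0.
Qed.

Lemma sec_split l w phi t : measurable_fun setT w -> measurable_fun setT phi ->
  \int[mu]_y (ew l (sec w y) t * phi y) = expR (- (l * t)) * \int[mu]_y (w (t, y) * phi y).
Proof.
move=> mw mp; rewrite -RintZm.
  by apply: eq_Rintegral => y _; rewrite ewE mulrA.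
by apply: measurable_funM => //; apply: (measurableT_comp mw); exact: pair1_measurable.
Qed.

Lemma sec_intg_ae l w phi : measurable_fun setT w -> measurable_fun setT phi ->
  finite_mixed l w phi -> {ae mu, forall t, intg mu (fun y => w (t, y) * phi y)}.
Proof.
move=> mw mp fin; apply: (aeS (prod_intg_ae (mixed_intg mw mp fin))) => t h.
by apply: eq_intg (intgZ (expR (l * t)) h) => y; rewrite ewE /= !mulrA -expRD subrr expR0 mul1r.
Qed.

(** The pairing of u(t, .) with phi, taken through the Volterra form so that it is measurable in
    t. *)
Definition Umean f q phi t : R := \int[mu]_y ((f y + jconv (fk 1) q (t, y)) * phi y).

Lemma ew1E l t : ew l (fk 1) t = (0 < t)%R%:R * expR (- (l * t)) :> R.
Proof. by rewrite ewE fk1 mulrC. Qed.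

Lemma laplace_fk1 (l : R) : 0 < l -> \int[mu]_t ew l (fk 1) t = l^-1.
Proof.
move=> l0; rewrite laplace_fk//; last by lra.
by rewrite powR_inv1// ltW.
Qed.

Lemma intg_fk1 (l : R) : 0 < l -> intg mu (ew l (fk 1)).
Proof. by move=> l0; apply: intg_ew_fk => //; lra. Qed.

(** The form with q defines the pairing at every t, the form with H carries the exponential bounds;
    they agree almost everywhere, so the transform is computed with H. *)
Lemma Umean_laplace l (a : R) f q H phi : 0 < l -> 0 < a -> a <= 2 ->
  measurable_fun setT f -> measurable_fun setT q -> measurable_fun setT H ->
  measurable_fun setT phi -> intg mu (fun y => f y * phi y) ->
  (forall y, causal (sec H y)) ->
  {ae (mu \x mu)%E, forall z, jconv (fk 1) q z = jconv (fk a) H z} ->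
  finite_mixed l H phi ->
  intg mu (fun t => ew l (fk 1) t * Umean f q phi t) /\
  \int[mu]_t (ew l (fk 1) t * Umean f q phi t) =
    \int[mu]_y ((l^-1 * f y + l `^ (- a) * lap l H y) * phi y).
Proof.
move=> l0 a0 a2 mf mq mH mp ifp cH DH fin.
have [cfin clap] := conv_mixed l0 a0 a2 mH mp fin.
have mk := measurable_fk a; have mk1 := @measurable_fk R 1.
have mc : measurable_fun setT (jconv (fk a) H) by exact: measurable_jconv.
have mD : measurable_fun setT (jconv (fk 1) q) by exact: measurable_jconv.
have [i1 i2 e12] := mixed_fubini mc mp mH cfin clap.
have [_ i3 _] : [/\ intg mu (fun t => \int[mu]_y (ew l (sec H y) t * phi y)),
      intg mu (fun y => lap l H y * phi y) &
      \int[mu]_t \int[mu]_y (ew l (sec H y) t * phi y) = 1 * \int[mu]_y (lap l H y * phi y)].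
  by apply: mixed_fubini => //; apply: aeW => y _; rewrite mul1r.
pose F := \int[mu]_y (f y * phi y).
pose A t := \int[mu]_y (ew l (sec (jconv (fk a) H) y) t * phi y).
have UE : {ae mu, forall t, F * ew l (fk 1) t + A t = ew l (fk 1) t * Umean f q phi t}.
  apply: (aeS2 (ae_prod_sec1 DH) (sec_intg_ae mc mp cfin)) => t Dt ict.
  rewrite /A sec_split// ew1E; have [t0|t0] := ltP 0 t.
    rewrite /Umean mul1r mulrC -mulrDr; congr (_ * _).
    transitivity (\int[mu]_y (f y * phi y + jconv (fk a) H (t, y) * phi y)).
      by rewrite RintegralD.
    have mDt : measurable_fun setT (fun y => jconv (fk 1) q (t, y)).
      by apply: (measurableT_comp mD); exact: pair1_measurable.
    apply: Rint_ae.
    - apply: measurable_funD; first exact: measurable_funM.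
      exact: intg_measurable ict.
    - by apply: measurable_funM => //; exact: measurable_funD.
    - by apply: (aeS Dt) => y ->; rewrite mulrDl.
  rewrite !mul0r mulr0 add0r; have -> : \int[mu]_y (jconv (fk a) H (t, y) * phi y) = 0.
    transitivity (\int[mu]_(y in setT) (0 : R)); last by rewrite Rintegral_cst// mul0r.
    apply: eq_Rintegral => y _; rewrite /jconv/= causal_conv ?mul0r//.
    exact: causal_fk.
  by rewrite mulr0.
have mU : measurable_fun setT (Umean f q phi).
  apply: (measurable_Rint2 mu (f := fun z => (f z.2 + jconv (fk 1) q z) * phi z.2)).
  have m2 (h : R -> R) : measurable_fun setT h -> measurable_fun setT (fun z : R * R => h z.2).
    by move=> mh; apply: (measurableT_comp mh); exact: measurable_snd.
  by apply: measurable_funM; [apply: measurable_funD => //; exact: m2|exact: m2].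
have mR : measurable_fun setT (fun t => ew l (fk 1) t * Umean f q phi t).
  by apply: measurable_funM => //; exact: measurable_ew.
have iL : intg mu (fun t => F * ew l (fk 1) t + A t).
  by apply: intgD => //; apply: intgZ; exact: intg_fk1.
split; first exact: intg_ae UE iL.
rewrite -(Rint_ae _ _ UE)//; last exact: intg_measurable iL.
have -> : \int[mu]_t (F * ew l (fk 1) t + A t) = F * l^-1 + \int[mu]_t A t.
  rewrite RintegralD//; last by apply: intgZ; exact: intg_fk1.
  by rewrite RintZ ?laplace_fk1//; exact: intg_fk1.
rewrite /A e12 mulrC /F -!RintZ//.
rewrite -RintegralD//; [|exact: intgZ|exact: intgZ].
by apply: eq_Rintegral => y _; ring.
Qed.

Lemma le_lap l w phi y : measurable_fun setT w ->
  ((`|lap l w y * phi y|)%:E <= \int[mu]_t (`|ew l (sec w y) t * phi y|)%:E)%E.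
Proof.
move=> mw; have ms := measurable_ew l (measurable_sec y mw).
have -> : (\int[mu]_t (`|ew l (sec w y) t * phi y|)%:E =
    (\int[mu]_t `|(ew l (sec w y) t)%:E|) * (`|phi y|)%:E)%E.
  rewrite -ge0_integralZr//.
    by apply: eq_integral => t _; rewrite abse_EFin -EFinM -normrM.
  by apply: measurableT_comp => //; exact/measurable_EFinP.
rewrite normrM EFinM; apply: lee_wpmul2r; first by rewrite lee_fin.
rewrite /lap /Rintegral; have : (`|\int[mu]_t (ew l (sec w y) t)%:E| <=
    \int[mu]_t `|(ew l (sec w y) t)%:E|)%E.
  by apply: le_abse_integral => //; exact/measurable_EFinP.
apply: le_trans; case: integral => [r| |] //=; by rewrite normr0 leey.
Qed.

(** [uh] is the transform of u = f + I^{2 alpha} H. The equation, paired with phi at almost every t,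
    is damped and integrated in time; [mixed_fubini] turns the pairings of H and of its fractional
    integrals into multiples of pairings of the transform of H. *)
Lemma pde_laplace (alpha c beta l : R) f p u q H : 0 < alpha -> alpha <= 1 ->
  measurable_fun setT f -> (N2 f < +oo)%E ->
  measurable_fun setT p -> (forall t, `|p t| <= 1) ->
  pde_rep alpha c beta f p u q H -> 0 < l -> beta < 2 * l ->
  let uh y := l^-1 * f y + l `^ (- (2 * alpha)) * lap l H y in
  let ph := \int[mu]_t (ew l (fk 1) t * p t) in
  [/\ measurable_fun setT uh,
      exists2 M : R, 0 <= M & forall phi, measurable_fun setT phi ->
        (\int[mu]_y `|uh y * phi y|%:E <= M%:E * N2 phi)%E,
      forall phi, test_function phi ->
        intg mu (fun t => ew l (fk 1) t * Umean f q phi t) /\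
        \int[mu]_t (ew l (fk 1) t * Umean f q phi t) = \int[mu]_y (uh y * phi y) &
      forall phi, test_function phi ->
        \int[mu]_y (uh y * derive1n 2 phi y) - ph * \int[mu]_y (f y * derive1n 2 phi y) =
        (c * l `^ alpha + (l `^ alpha) ^+ 2) *
          (\int[mu]_y (uh y * phi y) - l^-1 * \int[mu]_y (f y * phi y))].
Proof.
move=> a0 a1 mf ff mp p1 [[mq mH cq cH] _ DH [_ bdH] weq] l0 bl uh ph.
have a20 : 0 < 2 * alpha by lra.
have a22 : 2 * alpha <= 2 by lra.
have ale2 : alpha <= 2 by lra.
have [M M0 hM] := bdH l l0 bl.
have mlap := measurable_lap l mH.
have muh : measurable_fun setT uh by apply: measurable_funD; exact: measurable_funM.
have finm phi : measurable_fun setT phi -> (N2 phi < +oo)%E -> finite_mixed l H phi.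
  move=> mphi fphi; apply: le_lt_trans (hM phi mphi) _.
  by rewrite lte_mul_pinfty// lee_fin.
split => //.
- have nf : (N2 f \is a fin_num)%E by rewrite ge0_fin_numE// N2_ge0.
  have fnf : 0 <= fine (N2 f) by apply: fine_ge0; exact: N2_ge0.
  have li : 0 <= l^-1 by rewrite invr_ge0 ltW.
  exists (l^-1 * fine (N2 f) + l `^ (- (2 * alpha)) * M).
    by rewrite addr_ge0// mulr_ge0// powR_ge0.
  move=> phi mphi.
  have mn (h : R -> R) : measurable_fun setT h -> measurable_fun setT (fun y => (`|h y|)%:E).
    by move=> mh; apply/measurable_EFinP; exact: measurableT_comp.
  have mfp : measurable_fun setT (fun y => f y * phi y) by exact: measurable_funM.
  have mlp : measurable_fun setT (fun y => lap l H y * phi y) by exact: measurable_funM.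
  have h1 : (\int[mu]_y (`|f y * phi y|)%:E <= (fine (N2 f))%:E * N2 phi)%E.
    by rewrite fineK//; exact: cauchy_schwarz.
  have h2 : (\int[mu]_y (`|lap l H y * phi y|)%:E <= M%:E * N2 phi)%E.
    apply: le_trans (hM phi mphi); apply: ge0_le_integral => //.
    + exact: mn.
    + apply: (measurable_integral2 mu (f := fun z => (`|ew l (sec H z.1) z.2 * phi z.1|)%:E)).
      apply/measurable_EFinP; apply: (measurableT_comp (@normr_measurable R setT)).
      apply: measurable_funM; last by apply: (measurableT_comp mphi); exact: measurable_fst.
      under eq_fun do rewrite ewE; apply: measurable_funM.
        by apply: (measurableT_comp (measurable_expRl l)); exact: measurable_snd.
      by apply: (measurableT_comp mH); exact: measurable_swap.
    + by move=> y _; exact: le_lap.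
  apply: (@le_trans _ _ (\int[mu]_y ((l^-1)%:E * (`|f y * phi y|)%:E +
      (l `^ (- (2 * alpha)))%:E * (`|lap l H y * phi y|)%:E))%E).
    apply: ge0_le_integral => //.
    + by apply: mn; exact: measurable_funM.
    + by apply: emeasurable_funD; apply: emeasurable_funM => //; exact: mn.
    + move=> y _; rewrite -!EFinM -EFinD lee_fin /uh mulrDl.
      apply: le_trans (ler_normD _ _) _; rewrite -!mulrA !(normrM (l^-1)) (normrM (l `^ _)).
      by rewrite (ger0_norm li) (ger0_norm (powR_ge0 _ _)).
  rewrite ge0_integralD//; last 4 first.
  + by move=> y _; rewrite mule_ge0 ?lee_fin.
  + by apply: emeasurable_funM => //; exact: mn.
  + by move=> y _; rewrite mule_ge0 ?lee_fin ?powR_ge0.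
  + by apply: emeasurable_funM => //; exact: mn.
  have mn1 := mn _ mfp; have mn2 := mn _ mlp.
  have li' : (0 <= (l^-1)%:E)%E by rewrite lee_fin.
  have li2 : (0 <= (l `^ (- (2 * alpha)))%:E)%E by rewrite lee_fin powR_ge0.
  rewrite ge0_integralZl// ge0_integralZl//.
  rewrite EFinD ge0_muleDl ?lee_fin ?mulr_ge0 ?powR_ge0// !EFinM -!muleA.
  by apply: leeD; apply: lee_wpmul2l => //; rewrite lee_fin ?powR_ge0.
- move=> phi tphi; have mphi := test_measurable tphi.
  apply: Umean_laplace => //.
    by apply: N2_mul_intg => //; exact: test_N2.
  by apply: finm => //; exact: test_N2.
move=> phi tphi; have t2phi := test_derive1n 2 tphi.
set psi := derive1n 2 phi in t2phi *.
have [mphi mpsi] := (test_measurable tphi, test_measurable t2phi).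
have [fphi fpsi] := (test_N2 tphi, test_N2 t2phi).
have iphi := N2_mul_intg mf mphi ff fphi.
have ipsi := N2_mul_intg mf mpsi ff fpsi.
have Mphi := finm phi mphi fphi; have Mpsi := finm psi mpsi fpsi.
have [cpsi lpsi] := conv_mixed l0 a20 a22 mH mpsi Mpsi.
have [cphi lphi] := conv_mixed l0 a0 ale2 mH mphi Mphi.
have mj a : measurable_fun setT (jconv (fk a) H).
  by apply: measurable_jconv => //; exact: measurable_fk.
have mjq : measurable_fun setT (jconv (fk 1) q).
  by apply: measurable_jconv => //; exact: measurable_fk.
have [i1 i2 e12] := mixed_fubini (mj _) mpsi mH cpsi lpsi.
have [i3 i4 e34] := mixed_fubini (mj _) mphi mH cphi lphi.
have hp chi : measurable_fun setT chi -> finite_mixed l H chi ->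
  [/\ intg mu (fun t => \int[mu]_y (ew l (sec H y) t * chi y)),
      intg mu (fun y => lap l H y * chi y) &
      \int[mu]_t \int[mu]_y (ew l (sec H y) t * chi y) = 1 * \int[mu]_y (lap l H y * chi y)].
  by move=> mc fc; apply: mixed_fubini => //; apply: aeW => y _; rewrite mul1r.
have [i5 i6 e56] := hp phi mphi Mphi.
have [_ i7 _] := hp psi mpsi Mpsi.
pose F := \int[mu]_y (f y * psi y).
pose E := \int[mu]_y (lap l H y * phi y).
have causal0 w chi t : (forall y, causal (sec w y)) -> t <= 0 ->
    \int[mu]_y (w (t, y) * chi y) = 0.
  move=> cw t0; transitivity (\int[mu]_(y in setT) (0 : R)).
    by apply: eq_Rintegral => y _; have := cw y t t0; rewrite /sec => ->; rewrite mul0r.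
  by rewrite Rintegral_cst// mul0r.
have cj a y : causal (sec (jconv (fk a) H) y).
  have h : causal (conv (fk a) (sec H y)).
    by apply: causal_conv => //; exact: causal_fk.
  by move=> t t0; exact: h.
have ipe : intg mu (fun t => ew l (fk 1) t * p t).
  by apply: (@intgMbd _ _ _ mu _ _ 1) => //; exact: intg_fk1.
have eqt : {ae mu, forall t,
    (F * ew l (fk 1) t - F * (ew l (fk 1) t * p t)) +
      \int[mu]_y (ew l (sec (jconv (fk (2 * alpha)) H) y) t * psi y) =
    c * (\int[mu]_y (ew l (sec (jconv (fk alpha) H) y) t * phi y)) +
      \int[mu]_y (ew l (sec H y) t * phi y)}.
  have s1 := sec_intg_ae (mj (2 * alpha)) mpsi cpsi.
  have s2 := sec_intg_ae (mj alpha) mphi cphi.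
  have s3 := sec_intg_ae mH mphi Mphi.
  have s123 := aeS3 s1 s2 s3 (fun t a b d => conj a (conj b d)).
  apply: (aeS3 (weq phi tphi) (ae_prod_sec1 DH) s123) => t wt Dt [h1 [h2 h3]].
  rewrite !sec_split// !ew1E; have [t0|t0] := ltP 0 t; last first.
    by rewrite !mul0r !mulr0 !causal0// !mulr0 subrr addr0.
  have {}wt := wt t0.
  (* The pairing of I^{2 alpha} H with phi'' is solved for from the weak equation at time t, where
     it occurs inside the pairing of u - f p. *)
  have -> : \int[mu]_y (jconv (fk (2 * alpha)) H (t, y) * psi y) =
     \int[mu]_y ((f y + jconv (fk 1) q (t, y) - f y * p t) * psi y) - F + p t * F.
    rewrite /F -RintZ//.
    have j1 : intg mu (fun y => (f y + jconv (fk 1) q (t, y) - f y * p t) * psi y).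
      have k1 : intg mu (fun y => f y * psi y + jconv (fk (2 * alpha)) H (t, y) * psi y
         - p t * (f y * psi y)) by apply: intgB; [exact: intgD|exact: intgZ].
      have k2 : {ae mu, forall y, f y * psi y + jconv (fk (2 * alpha)) H (t, y) * psi y
         - p t * (f y * psi y) = (f y + jconv (fk 1) q (t, y) - f y * p t) * psi y}.
        by apply: (aeS Dt) => y ->; ring.
      apply: intg_ae k2 k1; apply: measurable_funM => //.
      apply: measurable_funB; last exact: measurable_funM.
      by apply: measurable_funD => //; apply: (measurableT_comp mjq); exact: pair1_measurable.
    rewrite -RintegralB// -RintegralD//; [|exact: intgB|exact: intgZ].
    apply: Rint_ae.
    - exact: intg_measurable h1.
    - exact: (intg_measurable (intgD (intgB j1 ipsi) (intgZ (p t) ipsi))).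
    - by apply: (aeS Dt) => y ->; ring.
  rewrite /psi wt.
  have -> : \int[mu]_y ((c * jconv (fk alpha) H (t, y) + H (t, y)) * phi y) =
      c * \int[mu]_y (jconv (fk alpha) H (t, y) * phi y) + \int[mu]_y (H (t, y) * phi y).
    rewrite -RintZ// -RintegralD//; last exact: intgZ.
    by apply: eq_Rintegral => y _; ring.
  have -> : true%:R = 1 :> R by [].
  ring.
have iF : intg mu (fun t => F * ew l (fk 1) t) by apply: intgZ; exact: intg_fk1.
have iFp : intg mu (fun t => F * (ew l (fk 1) t * p t)) by apply: intgZ.
have iFF : intg mu (fun t => F * ew l (fk 1) t - F * (ew l (fk 1) t * p t)) by exact: intgB.
have ic3 := intgZ c i3.
have := Rint_ae (intg_measurable (intgD iFF i1)) (intg_measurable (intgD ic3 i5)) eqt.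
rewrite RintegralD//.
rewrite RintegralB// RintZ ?RintZ ?laplace_fk1//; [|exact: intg_fk1].
rewrite RintegralD//.
rewrite RintZ// e12 e34 e56 mul1r -/ph -/E.
have -> : \int[mu]_y (uh y * psi y) = l^-1 * F + l `^ (- (2 * alpha)) * \int[mu]_y (lap l H y * psi y).
  rewrite /F -!RintZ// -RintegralD//; [|exact: intgZ|exact: intgZ].
  by apply: eq_Rintegral => y _; rewrite /uh; ring.
have -> : \int[mu]_y (uh y * phi y) = l^-1 * (\int[mu]_y (f y * phi y)) + l `^ (- (2 * alpha)) * E.
  rewrite /E -!RintZ// -RintegralD//; [|exact: intgZ|exact: intgZ].
  by apply: eq_Rintegral => y _; rewrite /uh; ring.
move=> e.
(* With s = l^alpha, u^ - f/l = s^{-2} H^, so (c s + s^2)(u^ - f/l) = (c/s + 1) H^, the transform of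
   the left-hand side of the equation. *)
have lp : l `^ (- (2 * alpha)) * (l `^ alpha) ^+ 2 = 1.
  rewrite -powR_mulrn ?powR_ge0// -powRrM mulrC -powRD; last by rewrite (gt_eqF l0) implybT.
  by rewrite (_ : _ + _ = 0) ?powRr0//; ring.
have lp1 : l `^ (- (2 * alpha)) * l `^ alpha = l `^ (- alpha).
  rewrite -powRD; last by rewrite (gt_eqF l0) implybT.
  by congr powR; ring.
have -> : (c * l `^ alpha + l `^ alpha ^+ 2) * (l^-1 * (\int[mu]_y (f y * phi y)) +
   l `^ (- (2 * alpha)) * E - l^-1 * \int[mu]_y (f y * phi y)) =
   (c * (l `^ (- (2 * alpha)) * l `^ alpha) + l `^ (- (2 * alpha)) * l `^ alpha ^+ 2) * E by ring.
rewrite lp lp1.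
transitivity (c * (l `^ (- alpha) * E) + E); last by ring.
by rewrite -e /F; ring.
Qed.

End Transform.

Section Right_continuity.
Context {R : realType}.
Local Notation mu := (@lebesgue_measure R).
Implicit Types (k phi f p : R -> R) (w D H q : R * R -> R) (u v g : R -> R -> R).

(** The kernel of order 1 is an indicator, so the integrands converge except at r = t and are
    dominated by |g|. *)
Lemma conv_fk1_right_cont (g : R -> R) : intg mu g -> forall t,
  conv (fk 1) g s @[s --> t^'+] --> conv (fk 1) g t.
Proof.
move=> ig t; have mg := intg_measurable ig.
apply/cvg_at_rightP => u [ut ucv].
have cE s : conv (fk 1) g s = \int[mu]_r (fk 1 (s - r) * g r) by rewrite convE.
rewrite cE; under eq_fun do rewrite cE.
apply: (@Rint_dominated_cvg _ _ _ mu (fun n r => fk 1 (u n - r) * g r) _ (fun r => `|g r|)).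
- by move=> n; apply: measurable_conv1 => //; exact: measurable_fk.
- by apply: measurable_conv1 => //; exact: measurable_fk.
- exact: intg_norm.
- apply: (aeS (ae_neq t)) => r rt.
  apply: cvgMl; rewrite fk1.
  have [rt'|tr] := ltP r t.
    rewrite subr_gt0 rt'; apply: cvg_near_cst; apply: nearW => n.
    by rewrite fk1 subr_gt0 (lt_trans rt' (ut n)).
  have tr' : t < r by rewrite lt_neqAle eq_sym rt.
  rewrite subr_gt0 ltNge tr/=; apply: cvg_near_cst.
  near=> n; rewrite fk1 subr_gt0 ltNge ltW//=.
  by near: n; exact: (cvgr_lt t ucv r tr').
- move=> n r; rewrite fk1 normrM ler_piMl// normr_nat; by case: (_ < _).
Unshelve. all: by end_near. Qed.

(** Cut at T because q is controlled only locally in time; for s <= T the cut is invisible to the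
    causal integral up to s. *)
Definition cutq q phi T (z : R * R) : R := (z.1 <= T)%R%:R * q z * phi z.2.

Lemma Rint_cutq q phi T s y : measurable_fun setT q -> s <= T ->
  \int[mu]_r (cutq q phi T (r, y) * fk 1 (s - r)) = jconv (fk 1) q (s, y) * phi y.
Proof.
move=> mq sT; rewrite /jconv convE/= -RintMr; last first.
  apply: measurable_conv1; [exact: measurable_fk|exact: measurable_sec].
apply: eq_Rintegral => r _; rewrite /cutq /= fk1 /sec.
have [sr|sr] := ltP 0 (s - r); last by rewrite !mul0r mulr0.
rewrite subr_gt0 in sr; rewrite (ltW (lt_le_trans sr sT)).
by rewrite mulr1 !mul1r.
Qed.

Lemma intg_cutq (alpha c beta T : R) f p u q H phi : pde_rep alpha c beta f p u q H ->
  measurable_fun setT phi -> (N2 phi < +oo)%E -> 0 < T ->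
  intg (mu \x mu)%E (cutq q phi T).
Proof.
move=> [[mq _ _ _] _ _ [bdq _] _] mphi fphi T0; have [M M0 hM] := bdq _ T0.
have mqT : measurable_fun setT (cutq q phi T).
  apply: measurable_funM; last by apply: (measurableT_comp mphi); exact: measurable_snd.
  apply: measurable_funM => //.
  by apply: (measurableT_comp (measurable_le_ind T)); exact: measurable_fst.
apply: prod_intgP2 => //; apply: le_lt_trans (hM phi mphi) _.
by rewrite lte_mul_pinfty ?lee_fin.
Qed.

Lemma intg_cutq_fk1 (alpha c beta T s : R) f p u q H phi : pde_rep alpha c beta f p u q H ->
  measurable_fun setT phi -> (N2 phi < +oo)%E -> 0 < T ->
  intg (mu \x mu)%E (fun z : R * R => cutq q phi T z * fk 1 (s - z.1)).
Proof.
move=> rep mphi fphi T0; have iqT := intg_cutq rep mphi fphi T0.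
have mfk : measurable_fun setT (fun z : R * R => fk 1 (s - z.1)).
  by apply: (measurableT_comp (measurable_fk 1)); exact: measurable_funB.
apply: (@intgMbd _ _ _ _ _ _ 1 iqT) => // z _.
by rewrite fk1 normr_nat; case: (_ < _).
Qed.

Lemma intg_jconv_fk1 (alpha c beta s : R) f p u q H phi : pde_rep alpha c beta f p u q H ->
  measurable_fun setT phi -> (N2 phi < +oo)%E ->
  intg mu (fun y => jconv (fk 1) q (s, y) * phi y).
Proof.
move=> rep mphi fphi; have T0 : 0 < `|s| + 1 by rewrite ltr_wpDl.
have sT : s <= `|s| + 1 by rewrite (le_trans (ler_norm s))// lerDl.
have [[mq _ _ _] _ _ _ _] := rep.
apply: eq_intg (intg_Rint2 (prod_intg_swap (intg_cutq_fk1 s rep mphi fphi T0))) => y.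
exact: Rint_cutq mq sT.
Qed.

(** By Fubini the pairing is a constant plus the integral up to s of an integrable function of time;
    cutting at t + 1 leaves room to the right of t. *)
Lemma Umean_right_cont (alpha c beta : R) f p u q H phi t : 
  measurable_fun setT f -> (N2 f < +oo)%E ->
  pde_rep alpha c beta f p u q H -> test_function phi -> 0 < t ->
  Umean f q phi s @[s --> t^'+] --> Umean f q phi t.
Proof.
move=> mf ff rep tphi t0; have [[mq _ _ _] _ _ _ _] := rep.
have mphi := test_measurable tphi.
have ifp := N2_mul_intg mf mphi ff (test_N2 tphi).
have T0 : 0 < t + 1 by lra.
have iqT := intg_cutq rep mphi (test_N2 tphi) T0.
have mqT := intg_measurable iqT.
pose Q r := \int[mu]_y cutq q phi (t + 1) (r, y).
have iQ : intg mu Q by exact: intg_Rint2.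
have key s : s <= t + 1 -> Umean f q phi s = \int[mu]_y (f y * phi y) + conv (fk 1) Q s.
  move=> st; have iD := intg_jconv_fk1 s rep mphi (test_N2 tphi).
  have ik := intg_cutq_fk1 s rep mphi (test_N2 tphi) T0.
  rewrite /Umean; transitivity (\int[mu]_y (f y * phi y + jconv (fk 1) q (s, y) * phi y)).
    by apply: eq_Rintegral => y _; rewrite mulrDl.
  rewrite RintegralD//; congr (_ + _).
  transitivity (\int[mu]_y \int[mu]_r (cutq q phi (t + 1) (r, y) * fk 1 (s - r))).
    by apply: eq_Rintegral => y _; rewrite Rint_cutq.
  rewrite -(Rint_fubini ik) convE; apply: eq_Rintegral => r _ /=.
  rewrite RintMr; first by rewrite mulrC.
  by apply: (measurableT_comp mqT); exact: pair1_measurable.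
rewrite key; last by lra.
have c1 := @conv_fk1_right_cont Q iQ t.
have : \int[mu]_y (f y * phi y) + conv (fk 1) Q s @[s --> t^'+] -->
   \int[mu]_y (f y * phi y) + conv (fk 1) Q t by apply: cvgD => //; exact: cvg_cst.
apply: cvg_trans; apply: near_eq_cvg; near=> s; rewrite key//.
by near: s; apply: nbhs_right_le; lra.
Unshelve. all: by end_near. Qed.

End Right_continuity.

(** * Independence *)

Section Independent_pair.
Context d d1 d2 (Om : measurableType d) (T1 : measurableType d1)
  (T2 : measurableType d2) (R : realType) (P : probability Om R).

Definition indep2 (X : Om -> T1) (Y : Om -> T2) : Prop :=
  forall A B, measurable A -> measurable B ->
    P (X @^-1` A `&` Y @^-1` B) = (P (X @^-1` A) * P (Y @^-1` B))%E.

(** Independence on rectangles says that the joint law is the product of the two laws, so the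
    statement is Tonelli for these laws. *)
Lemma ge0_indep_fubini (X : {mfun Om >-> T1}) (Y : {mfun Om >-> T2})
    (F : T1 * T2 -> \bar R) : indep2 X Y ->
  measurable_fun setT F -> (forall z, 0 <= F z)%E ->
  (\int[P]_w F (X w, Y w) = \int[P]_w1 \int[P]_w2 F (X w1, Y w2))%E.
Proof.
move=> XY mF F0.
have mXY : measurable_fun setT (fun w => (X w, Y w)) by exact: measurable_fun_pair.
pose XYm : {mfun Om >-> (T1 * T2)%type} := HB.pack (fun w => (X w, Y w)) (isMeasurableFun.Build _ _ _ _ _ mXY).
have e Z : measurable Z -> (distribution P X \x distribution P Y)%E Z = distribution P XYm Z.
  apply: product_measure_unique => A B mA mB.
  by rewrite /distribution/= /pushforward -XY.
transitivity (\int[distribution P XYm]_z F z)%E.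
  by rewrite ge0_integral_distribution.
transitivity (\int[(distribution P X \x distribution P Y)%E]_z F z)%E.
  by apply: eq_measure_integral => A mA _; symmetry; exact: e.
rewrite (fubini_tonelli1 _ mF F0) /fubini_F.
rewrite ge0_integral_distribution//; last 2 first.
  exact: measurable_fun_fubini_tonelli_F.
  by move=> x; apply: integral_ge0.
apply: eq_integral => w1 _ /=.
rewrite ge0_integral_distribution//.
by apply: measurableT_comp => //; exact: pair1_measurable.
Qed.

Lemma Rint_bounded (F : Om -> R) M : measurable_fun setT F -> (forall w, `|F w| <= M) ->
  intg P F.
Proof.
move=> mF FM; apply: (@le_intg _ _ _ P _ (fun=> M)) => //.
exact: finite_measure_integrable_cst.
Qed.

Lemma Rint_cst_prob (M : R) : \int[P]_w M = M.
Proof.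
rewrite Rintegral_cst//.
have e : fine (P setT) = 1 by rewrite probability_setT.
by rewrite -[RHS]mulr1 -[in RHS]e.
Qed.

Lemma indep_fubini (X : {mfun Om >-> T1}) (Y : {mfun Om >-> T2}) (F : T1 * T2 -> R) M :
  indep2 X Y -> measurable_fun setT F -> (forall z, `|F z| <= M) ->
  \int[P]_w F (X w, Y w) = \int[P]_w1 \int[P]_w2 F (X w1, Y w2).
Proof.
move=> XY mF FM.
have mXY : measurable_fun setT (fun w => (X w, Y w)) by exact: measurable_fun_pair.
have mFXY : measurable_fun setT (fun w => F (X w, Y w)) by exact: measurableT_comp.
have mF1 x : measurable_fun setT (fun w => F (x, Y w)).
  apply: (measurableT_comp (f := fun y => F (x, y))) => //.
  by apply: (measurableT_comp mF); exact: pair1_measurable.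
have i1 : intg P (fun w => F (X w, Y w)) by apply: (Rint_bounded (M := M)).
have i2 x : intg P (fun w => F (x, Y w)) by apply: (Rint_bounded (M := M)).
have mI : measurable_fun setT (fun w1 => \int[P]_w2 F (X w1, Y w2)).
  apply: (measurable_Rint2 P (f := fun z : Om * Om => F (X z.1, Y z.2))).
  apply: (measurableT_comp mF); apply: measurable_fun_pair.
    by apply: measurableT_comp => //; exact: measurable_fst.
  by apply: measurableT_comp => //; exact: measurable_snd.
have bI w1 : `|\int[P]_w2 F (X w1, Y w2)| <= M.
  apply: le_trans (le_normr_Rintegral _ _) _ => //.
  rewrite -[leRHS]Rint_cst_prob; apply: le_Rintegral => //.
  - exact: intg_norm.
  - exact: finite_measure_integrable_cst.
have i3 : intg P (fun w1 => \int[P]_w2 F (X w1, Y w2)) by apply: (Rint_bounded (M := M)).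
have ic : intg P (fun=> M) by exact: finite_measure_integrable_cst.
(* Adding the bound makes the integrand nonnegative; the constant M is cancelled at the end. *)
have F0 z : 0 <= F z + M by have := FM z; rewrite ler_norml => /andP[h _]; lra.
have := ge0_indep_fubini (F := fun z => (F z + M)%:E) XY.
have mFM : measurable_fun setT (fun z => (F z + M)%:E).
  by apply/measurable_EFinP; exact: measurable_funD.
move=> /(_ mFM (fun z => F0 z)).
rewrite -EFin_Rint; last exact: intgD.
rewrite RintegralD// Rint_cst_prob.
under eq_integral => w1 _.
  rewrite -EFin_Rint; last exact: intgD.
  rewrite RintegralD// Rint_cst_prob.
  over.
rewrite -EFin_Rint; last exact: intgD.
by rewrite RintegralD// Rint_cst_prob => -[] /addIr.
Qed.

Lemma indep_sigma1 (G : set (set Om)) B : setI_closed G -> G setT ->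
  G `<=` measurable -> measurable B ->
  (forall A, G A -> P (A `&` B) = (P A * P B)%E) ->
  forall A, <<s G >> A -> P (A `&` B) = (P A * P B)%E.
Proof.
move=> GI GT Gm mB GB A sA.
have PB0 : 0 <= fine (P B) by apply: fine_ge0.
pose m1 := mrestr P mB; pose m2 := mscale (NngNum PB0) P.
have m2E C : m2 C = (P C * P B)%E.
  by rewrite /m2 /mscale/= fineK ?fin_num_measure// muleC.
rewrite -m2E -[LHS]/(m1 A).
apply: (g_sigma_algebra_measure_unique G Gm (fun=> setT)) => //.
- by rewrite bigcup_const//; exists 0%N.
- by move=> C GC; rewrite -[RHS]/(m2 C) m2E -GB.
- by move=> k; rewrite /= /mrestr setTI; apply: le_lt_trans (probability_le1 P mB) _; exact: ltry.
Qed.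

Lemma indep_sigma (G1 G2 : set (set Om)) : setI_closed G1 -> G1 setT -> G1 `<=` measurable ->
  setI_closed G2 -> G2 setT -> G2 `<=` measurable ->
  (forall A B, G1 A -> G2 B -> P (A `&` B) = (P A * P B)%E) ->
  forall A B, <<s G1 >> A -> <<s G2 >> B -> P (A `&` B) = (P A * P B)%E.
Proof.
move=> I1 T1' M1 I2 T2' M2 h A B sA sB.
have sub : <<s G1 >> `<=` measurable by apply: smallest_sub => //; exact: sigma_algebra_measurable.
rewrite setIC muleC; apply: indep_sigma1 sB => //; first exact: sub.
move=> C GC; rewrite setIC muleC; apply: indep_sigma1 sA => //; first exact: M2.
by move=> D GD; exact: h.
Qed.

End Independent_pair.

Section Rectangles.
Context {d : measure_display} {Om : measurableType d} {R : realType}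
  {P : probability Om R}.
Implicit Types (theta e : nat -> {RV P >-> R}) (H : R -> {RV P >-> R}).

Lemma sigma_of_gen (I : Type) (D : set I) (X : I -> {RV P >-> R}) i B : D i -> measurable B ->
  sigma_of D X (X i @^-1` B).
Proof. by move=> Di mB; apply: sub_sigma_algebra; exists i => //; exists B. Qed.

Lemma sigma_of_measurable (I : Type) (D : set I) (X : I -> {RV P >-> R}) A :
  sigma_of D X A -> measurable A.
Proof.
apply: smallest_sub; first exact: sigma_algebra_measurable.
move=> _ [i Di [B mB ->]]; rewrite -[X in measurable X]setTI.
exact: (measurable_funPT (X i)).
Qed.

Lemma sigma_of_bigI (I : Type) (D : set I) (X : I -> {RV P >-> R}) J (s : seq J) (F : J -> set Om) :
  (forall j, sigma_of D X (F j)) -> sigma_of D X (\big[setI/setT]_(j <- s) F j).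
Proof.
move=> sF; elim: s => [|j s IH].
  by rewrite big_nil; exact: (@measurableT _ (g_sigma_algebraType _)).
rewrite big_cons; apply: (@measurableI _ (g_sigma_algebraType _)) => //; exact: sF.
Qed.

(** Indices start at 1: e_0 = 0 lies outside the independent family, and the sign of index 0 only
    ever multiplies it. *)
Definition rect theta e n (A B : nat -> set R) : set Om :=
  \big[setI/setT]_(i < n) (theta i.+1 @^-1` A i `&` e i.+1 @^-1` B i).

Lemma prob_rect theta e H n (A B : nat -> set R) C : iid_signs theta ->
  independent_variables [set j | (0 < j)%N] e -> independent_families theta e H ->
  (forall i, measurable (A i)) -> (forall i, measurable (B i)) ->
  sigma_of [set t | 0 <= t] H C ->
  P (rect theta e n A B `&` C) =
    ((\prod_(i < n) (P (theta i.+1 @^-1` A i) * P (e i.+1 @^-1` B i))) * P C)%E.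
Proof.
move=> [it _] ie ifm mA mB sC.
pose RA := \big[setI/setT]_(i < n) (theta i.+1 @^-1` A i).
pose RB := \big[setI/setT]_(i < n) (e i.+1 @^-1` B i).
have -> : rect theta e n A B = RA `&` RB by rewrite /rect big_split.
have sA : sigma_of setT theta RA.
  by apply: sigma_of_bigI => j; exact: sigma_of_gen.
have sB : sigma_of setT e RB.
  by apply: sigma_of_bigI => j; exact: sigma_of_gen.
have shift (G : nat -> set Om) : \big[setI/setT]_(i < n) G i.+1 =
    \big[setI/setT]_(j <- [seq i.+1 | i <- index_iota 0 n]) G j.
  by rewrite big_map big_mkord.
have shiftp (G : nat -> \bar R) : (\prod_(j <- [seq i.+1 | i <- index_iota 0 n]) G j =
    \prod_(i < n) G i.+1)%E.
  by rewrite big_map big_mkord.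
have us : uniq [seq i.+1 | i <- index_iota 0 n] by rewrite map_inj_uniq ?iota_uniq// => ? ? [].
have pA : P RA = (\prod_(i < n) P (theta i.+1 @^-1` A i))%E.
  rewrite /RA (shift (fun j => theta j @^-1` A j.-1)).
  transitivity (\prod_(j <- [seq i.+1 | i <- index_iota 0 n]) P (theta j @^-1` A j.-1))%E.
    by apply: it => // i _; split => //; exact: sigma_of_gen.
  exact: (shiftp (fun j => P (theta j @^-1` A j.-1))).
have pB : P RB = (\prod_(i < n) P (e i.+1 @^-1` B i))%E.
  rewrite /RB (shift (fun j => e j @^-1` B j.-1)).
  transitivity (\prod_(j <- [seq i.+1 | i <- index_iota 0 n]) P (e j @^-1` B j.-1))%E.
    by apply: ie => // i /mapP[j _ ->]; split => //; exact: sigma_of_gen.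
  exact: (shiftp (fun j => P (e j @^-1` B j.-1))).
(* The families carry the indices 0, 1, 2 in the order signs, waiting times, subordinator, and each
   supplies one event. *)
have := ifm [:: @Ordinal 3 0 isT; @Ordinal 3 1 isT; @Ordinal 3 2 isT]
  (fun i : 'I_3 => nth set0 [:: RA; RB; C] i) isT.
rewrite !big_cons !big_nil /= setIT mule1 setIA => ->.
  by rewrite pA pB big_split/= muleA.
by move=> i _; split => //; case: i => -[|[|[|//]]] ? //=.
Qed.

Lemma prob_rect0 theta e H n (A B : nat -> set R) : iid_signs theta ->
  independent_variables [set j | (0 < j)%N] e -> independent_families theta e H ->
  (forall i, measurable (A i)) -> (forall i, measurable (B i)) ->
  P (rect theta e n A B) =
    (\prod_(i < n) (P (theta i.+1 @^-1` A i) * P (e i.+1 @^-1` B i)))%E.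
Proof.
move=> h1 h2 h3 mA mB; have := prob_rect n h1 h2 h3 mA mB (C := setT).
rewrite setIT probability_setT mule1; apply.
exact: (@measurableT _ (g_sigma_algebraType _)).
Qed.

(** These rectangles are stable under intersection and generate the sigma-algebra of the first n
    signs and waiting times, the past of the walk. *)
Definition rects theta e n : set (set Om) :=
  [set C | exists A B : nat -> set R,
    [/\ forall i, measurable (A i), forall i, measurable (B i) & C = rect theta e n A B]].

Lemma rects_setI theta e n : setI_closed (rects theta e n).
Proof.
move=> _ _ [A [B [mA mB ->]]] [A' [B' [mA' mB' ->]]].
exists (fun i => A i `&` A' i), (fun i => B i `&` B' i).
split => [i|i|]; [exact: measurableI|exact: measurableI|].
rewrite /rect -big_split/=; apply: eq_bigr => i _.
by rewrite !preimage_setI setIACA.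
Qed.

Lemma rects_setT theta e n : rects theta e n setT.
Proof.
exists (fun=> setT), (fun=> setT); split => //.
by rewrite /rect big1// => i _; rewrite !preimage_setT setIT.
Qed.

Lemma rects_measurable theta e n : rects theta e n `<=` measurable.
Proof.
move=> _ [A [B [mA mB ->]]]; apply: bigsetI_measurable => i _.
apply: measurableI; rewrite -[X in measurable X]setTI.
  exact: (measurable_funPT (theta i.+1)).
exact: (measurable_funPT (e i.+1)).
Qed.

Lemma measurable_rects theta e n i : (i < n)%N ->
  measurable_fun setT (theta i.+1 : g_sigma_algebraType (rects theta e n) -> R) /\
  measurable_fun setT (e i.+1 : g_sigma_algebraType (rects theta e n) -> R).
Proof.
move=> iln; split => _ B mB; rewrite setTI; apply: sub_sigma_algebra.
  exists (fun j => if j == i then B else setT), (fun=> setT); split => //.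
    by move=> j; case: ifP.
  rewrite /rect (bigD1 (Ordinal iln))//= eqxx preimage_setT setIT big1 ?setIT// => j ji.
  by rewrite ifF ?preimage_setT ?setIT//; apply: contra_neqF ji => /eqP h; exact: val_inj.
exists (fun=> setT), (fun j => if j == i then B else setT); split => //.
  by move=> j; case: ifP.
rewrite /rect (bigD1 (Ordinal iln))//= eqxx preimage_setT setTI big1 ?setIT// => j ji.
by rewrite ifF ?preimage_setT ?setIT//; apply: contra_neqF ji => /eqP h; exact: val_inj.
Qed.

Lemma measurable_subsigma d1 (T1 : measurableType d1) (G : set (set Om)) (X : Om -> T1) :
  G `<=` measurable ->
  measurable_fun setT (X : g_sigma_algebraType G -> T1) -> measurable_fun setT X.
Proof.
move=> Gm mX _ B mB; have := mX measurableT B mB.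
apply: smallest_sub => //; exact: sigma_algebra_measurable.
Qed.

Lemma indep_rects_subordinator theta e H n r d1 (T1 : measurableType d1) (X : Om -> T1) :
  iid_signs theta -> independent_variables [set j | (0 < j)%N] e ->
  independent_families theta e H -> 0 <= r ->
  measurable_fun setT (X : g_sigma_algebraType (rects theta e n) -> T1) ->
  indep2 P X (H r).
Proof.
move=> h1 h2 h3 r0 mX A B mA mB.
have sC : sigma_of [set t | 0 <= t] H (H r @^-1` B) by exact: sigma_of_gen.
apply: (@indep_sigma1 _ _ _ P (rects theta e n)).
- exact: rects_setI.
- exact: rects_setT.
- exact: rects_measurable.
- exact: sigma_of_measurable sC.
- move=> _ [A' [B' [mA' mB' ->]]].
  by rewrite (prob_rect n h1 h2 h3 mA' mB' sC) (prob_rect0 n h1 h2 h3).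
- by have := mX measurableT A mA; rewrite setTI.
Qed.

(** A rectangle of n steps intersected with an event of the next step is a rectangle of n + 1 steps,
    so [prob_rect0] gives the product formula; it then extends to the generated sigma-algebras on
    both sides. *)
Lemma indep_rects_next theta e H n d1 (T1 : measurableType d1) (X : Om -> T1) :
  iid_signs theta -> independent_variables [set j | (0 < j)%N] e ->
  independent_families theta e H ->
  measurable_fun setT (X : g_sigma_algebraType (rects theta e n) -> T1) ->
  indep2 P X (fun w => (theta n.+1 w, e n.+1 w)).
Proof.
move=> h1 h2 h3 mX A B mA mB.
pose G := [set C | exists A B : set R, [/\ measurable A, measurable B &
  C = theta n.+1 @^-1` A `&` e n.+1 @^-1` B]].
have Gm : G `<=` measurable.
  move=> _ [A' [B' [mA' mB' ->]]].
  apply: measurableI; rewrite -[X in measurable X]setTI.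
    exact: (measurable_funPT (theta n.+1)).
  exact: (measurable_funPT (e n.+1)).
apply: (@indep_sigma _ _ _ P (rects theta e n) G).
- exact: rects_setI.
- exact: rects_setT.
- exact: rects_measurable.
- move=> _ _ [A1 [B1 [mA1 mB1 ->]]] [A2 [B2 [mA2 mB2 ->]]].
  exists (A1 `&` A2), (B1 `&` B2); split; [exact: measurableI|exact: measurableI|].
  by rewrite !preimage_setI setIACA.
- by exists setT, setT; split => //; rewrite !preimage_setT setIT.
- exact: Gm.
- move=> _ _ [A' [B' [mA' mB' ->]]] [A1 [B1 [mA1 mB1 ->]]].
  have pr k A2 B2 : measurable A2 -> measurable B2 ->
      P (rect theta e k.+1 (fun j => if (j < k)%N then A' j else A2)
        (fun j => if (j < k)%N then B' j else B2)) =
      ((\prod_(i < k) (P (theta i.+1 @^-1` A' i) * P (e i.+1 @^-1` B' i))) *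
       (P (theta k.+1 @^-1` A2) * P (e k.+1 @^-1` B2)))%E.
    move=> mA2 mB2; rewrite (prob_rect0 k.+1 h1 h2 h3).
    + rewrite big_ord_recr/= ltnn; congr (_ * _)%E.
      by apply: eq_bigr => i _; rewrite ltn_ord.
    + by move=> i; case: ifP.
    + by move=> i; case: ifP.
  have rE k A2 B2 (A3 B3 : nat -> set R) : rect theta e k.+1 (fun j => if (j < k)%N then A3 j else A2)
        (fun j => if (j < k)%N then B3 j else B2) =
      rect theta e k A3 B3 `&` (theta k.+1 @^-1` A2 `&` e k.+1 @^-1` B2).
    rewrite /rect big_ord_recr/= ltnn; congr (_ `&` _).
    by apply: eq_bigr => i _; rewrite ltn_ord.
  rewrite -rE pr// (prob_rect0 n h1 h2 h3)//; congr (_ * _)%E.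
  (* Whole lines in the first n slots give the probability of the last pair alone. *)
  have := prob_rect0 n.+1 h1 h2 h3 (A := fun j => if (j < n)%N then setT else A1)
    (B := fun j => if (j < n)%N then setT else B1).
  rewrite (rE n A1 B1 (fun=> setT) (fun=> setT)).
  rewrite {1}/rect big1 ?setTI; last by move=> i _; rewrite !preimage_setT setIT.
  move=> ->; [|by move=> i; case: ifP|by move=> i; case: ifP].
  rewrite big_ord_recr/= ltnn big1 ?mul1e// => i _.
  by rewrite ltn_ord !preimage_setT !probability_setT mule1.
- by have := mX measurableT A mA; rewrite setTI.
- have mp : measurable_fun setT ((fun w => (theta n.+1 w, e n.+1 w)) : g_sigma_algebraType G -> (R * R)%type).
    apply: measurable_fun_pair => _ C mC; rewrite setTI; apply: sub_sigma_algebra.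
      by exists C, setT; split => //; rewrite preimage_setT setIT.
    by exists setT, C; split => //; rewrite preimage_setT setTI.
  by have := mp measurableT B mB; rewrite setTI.
Qed.

End Rectangles.

(** * Primitives of damped test functions along half-lines *)

Section Primitive.
Context {R : realType}.
Local Notation mu := (@lebesgue_measure R).
Implicit Types f g phi eta : R -> R.

Lemma is_derive_continuous f d : (forall x, is_derive x (1 : R) f (d x)) -> continuous f.
Proof.
move=> h x; apply: differentiable_continuous; apply/derivable1_diffP.
exact: (@ex_derive _ _ _ _ _ _ _ (h x)).
Qed.

Lemma Rint_primitive (F f : R -> R) b : 0 <= b ->
  (forall x, is_derive x (1 : R) F (f x)) -> continuous f ->
  \int[mu]_r ((0 < r < b)%R%:R * f r) = F b - F 0.
Proof.
move=> b0 hF cf; have cF := is_derive_continuous hF.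
move: b0; rewrite le_eqVlt => /orP[/eqP <-|b0].
  rewrite subrr; transitivity (\int[mu]_(x in setT) (0 : R)); last by rewrite Rintegral_cst// mul0r.
  apply: eq_Rintegral => r _; have [h|h] := ltP 0 r; last by rewrite mul0r.
  by rewrite ltNge (ltW h) mul0r.
transitivity (\int[mu]_(r in `]0, b[) f r).
  rewrite [RHS]Rintegral_mkcond; apply: eq_Rintegral => r _.
  rewrite /patch; case: ifPn; rewrite ?inE/= ?notin_setE/= in_itv/= => h.
    by rewrite h mul1r.
  by move/negP/negbTE: h => ->; rewrite mul0r.
have mf : measurable_fun setT f by exact: continuous_measurable_fun.
have := @integral_itv_bndoo R 0 b (EFin \o f) true false.
rewrite /Rintegral => <-; last by apply: measurable_funTS; exact/measurable_EFinP.
rewrite (@continuous_FTC2 R f F 0 b)//.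
- exact: continuous_subspaceT.
- split; first by move=> x _; exact: (@ex_derive _ _ _ _ _ _ _ (hF x)).
    by apply: cvg_at_right_filter; exact: cF.
  by apply: cvg_at_left_filter; exact: cF.
- by move=> x _; rewrite derive1E (@derive_val _ _ _ _ _ _ _ (hF x)).
Qed.

Lemma test_lin (a b : R) f g : test_function f -> test_function g ->
  test_function (fun x => a * f x + b * g x).
Proof.
move=> [fd [M fM]] [gd [N gN]]; split.
  move/smoothnP : fd => fd; move/smoothnP : gd => gd.
  by apply/smoothnP => n; apply: smoothnD; apply: smoothnZ.
exists (Num.max M N) => x; rewrite gt_max => /andP[h1 h2].
by rewrite fM// gN// !mulr0 addr0.
Qed.

(** The derivative in r of e^{-ar} eta(sg r + z), the damped test function seen along a ray from z
    in the direction [sg]. *)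
Definition damped (a sg z : R) eta (r : R) : R :=
  expR (- (a * r)) * (sg * derive1 eta (sg * r + z) - a * eta (sg * r + z)).

Lemma is_derive_damped (a sg z : R) eta r : test_function eta ->
  is_derive r (1 : R) (fun r => expR (- (a * r)) * eta (sg * r + z)) (damped a sg z eta r).
Proof.
move=> te; have h1 : is_derive (sg * r + z) (1 : R) eta (derive1 eta (sg * r + z)).
  by apply: derivable_is_derive; exact: test_derivable.
have h2 := is_derive_comp_affine h1.
have h3 : is_derive r (1 : R) (fun r => expR (- (a * r))) (- a * expR (- a * r + 0)).
  have := @is_derive_comp_affine R (- a) 0 r _ expR (is_derive_expR _).
  by congr is_derive; apply/funext => x; rewrite addr0 mulNr.
have := @is_deriveM R R _ _ r 1 _ _ h3 h2.
move/is_derive_eq; apply; rewrite /damped /GRing.scale/=.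
have -> : expR (- a * r + 0) = expR (- (a * r)) by congr expR; ring.
ring.
Qed.

Lemma damped_continuous (a sg z : R) eta : test_function eta -> continuous (damped a sg z eta).
Proof.
move=> te; have t2 := test_lin sg (- a) (test_derive1n 1 te) te.
have h r := is_derive_damped a sg z r t2.
have -> : damped a sg z eta = (fun r => expR (- (a * r)) *
    (sg * derive1n 1 eta (sg * r + z) + - a * eta (sg * r + z))).
  by apply/funext => r; rewrite /damped mulNr.
exact: is_derive_continuous h.
Qed.

Lemma damped_support (a sg z : R) eta : `|sg| = 1 -> test_function eta ->
  exists2 b : R, 0 < b & forall r, b <= r ->
    eta (sg * r + z) = 0 /\ damped a sg z eta r = 0.
Proof.
move=> sg1 te; have [_ [M hM]] := te.
exists (`|M| + `|z| + 1) => [|r br].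
  by have := normr_ge0 M; have := normr_ge0 z; lra.
have out : M < `|sg * r + z|.
  have h1 : `|sg * r| - `|z| <= `|sg * r + z|.
    by rewrite lerBlDr; have := ler_normB (sg * r + z) z; rewrite addrK.
  have h2 : r <= `|sg * r| by rewrite normrM sg1 mul1r ler_norm.
  by have h3 := ler_norm M; lra.
rewrite /damped (hM _ out) (derive1_support hM out); split => //.
by rewrite !mulr0 subrr mulr0.
Qed.

(** The primitive vanishes for large r, because |sg| = 1 carries the ray out of the support, so only
    its value at r = 0 remains. *)
Lemma Rint_damped (a sg z : R) eta : `|sg| = 1 -> test_function eta ->
  \int[mu]_r ((0 < r)%R%:R * damped a sg z eta r) = - eta z.
Proof.
move=> sg1 te; have [b b0 hb] := damped_support a z sg1 te.
transitivity (\int[mu]_r ((0 < r < b)%R%:R * damped a sg z eta r)).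
  apply: eq_Rintegral => r _; have [rb|br] := ltP r b; first by rewrite andbT.
  by rewrite (hb r br).2 !mulr0.
have -> := Rint_primitive (ltW b0) (fun r => is_derive_damped a sg z r te) (damped_continuous (a := a) (sg := sg) (z := z) te).
by rewrite (hb b (lexx _)).1 !mulr0 oppr0 expR0 mul1r !add0r.
Qed.

End Primitive.

(** * The walk killed at rate s *)

Section Exponential_variable.
Context d (Om : measurableType d) (R : realType) (P : probability Om R).
Local Notation mu := (@lebesgue_measure R).
Implicit Types (X : {RV P >-> R}) (eta rho : R -> R).

Lemma Rint_prob (b : Om -> bool) : measurable [set w | b w] ->
  \int[P]_w (b w)%:R = fine (P [set w | b w]).
Proof.
move=> mb; transitivity (fine (\int[P]_w (\1_([set w | b w]) w)%:E)).
  congr fine; apply: eq_integral => w _; rewrite indicE; congr ((nat_of_bool _)%:R)%:E.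
  by apply/idP/idP; rewrite inE.
by rewrite integral_indic// setIT.
Qed.

(** Layer-cake form: F(X) = F(0) plus the integral of f over (0, X), and Fubini brings in P(X > r) =
    e^{-cr}. The law of X is thus used through its tail, as given in the hypotheses, rather than
    through a density. *)
Lemma expect_primitive (c : R) X (F f : R -> R) :
  (forall x, is_derive x (1 : R) F (f x)) -> continuous f ->
  intg mu (fun r => (0 < r)%R%:R * f r) ->
  (forall w, 0 <= X w) -> (forall t, 0 <= t -> P [set w | t < X w] = (expR (- c * t))%:E) ->
  \int[P]_w F (X w) = F 0 + \int[mu]_r ((0 < r)%R%:R * (expR (- (c * r)) * f r)).
Proof.
move=> hF cf ig0 X0 lawX.
have mX : measurable_fun setT X by [].
have pw w : F (X w) = F 0 + \int[mu]_r ((0 < r < X w)%R%:R * f r).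
  by rewrite (Rint_primitive (X0 w) hF cf) addrC subrK.
pose g0 (r : R) := (0 < r)%R%:R * f r.
have mg0 : measurable_fun setT g0 by exact: intg_measurable ig0.
pose K (z : Om * R) := (z.2 < X z.1)%R%:R * g0 z.2.
have mK : measurable_fun setT K.
  apply: measurable_funM; last by apply: (measurableT_comp mg0); exact: measurable_snd.
  have -> : (fun z : Om * R => (z.2 < X z.1)%R%:R : R) = (fun t : R => (0 < t)%R%:R) \o (fun z : Om * R => X z.1 - z.2).
    by apply/funext => z' /=; rewrite subr_gt0.
  apply: measurableT_comp; first exact: measurable_pos.
  apply: measurable_funB; last exact: measurable_snd.
  by apply: (measurableT_comp mX); exact: measurable_fst.
have iK : intg (P \x mu)%E K.
  apply: prod_intgP => //.
  apply: (@le_lt_trans _ _ (\int[P]_w \int[mu]_r (`|g0 r|)%:E)%E).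
    apply: ge0_le_integral => //.
    - by move=> w _; apply: integral_ge0 => r _; rewrite lee_fin.
    - apply: (measurable_integral2 mu (f := fun z => (`|K z|)%:E)).
      by apply/measurable_EFinP; exact: measurableT_comp.
    - move=> w _; apply: ge0_le_integral => //.
      + apply/measurable_EFinP; apply: measurableT_comp => //.
        by apply: (measurableT_comp mK); exact: pair1_measurable.
      + by apply/measurable_EFinP; exact: measurableT_comp.
      + move=> r _; rewrite lee_fin /K/= normrM normr_nat ler_piMl//.
        by case: (_ < _).
  rewrite -(EFin_Rint (intg_norm ig0)).
  rewrite -(EFin_Rint (finite_measure_integrable_cst P _ measurableT)).
  exact: ltry.
have KE w : \int[mu]_r ((0 < r < X w)%R%:R * f r) = \int[mu]_r K (w, r).
  by apply: eq_Rintegral => r _; rewrite /K/= /g0 mulrA -natrM mulnb andbC.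
under eq_Rintegral do rewrite pw KE.
have i1 : intg P (fun=> F 0) by exact: finite_measure_integrable_cst.
rewrite RintegralD//; last exact: intg_Rint2.
rewrite Rint_cst_prob (Rint_fubini iK); congr (_ + _).
apply: eq_Rintegral => r _; rewrite /K/= RintMr; last first.
  have -> : (fun w : Om => (r < X w)%R%:R : R) = (fun t : R => (0 < t)%R%:R) \o (fun w : Om => X w - r).
    by apply/funext => z' /=; rewrite subr_gt0.
  by apply: measurableT_comp; [exact: measurable_pos|exact: measurable_funB].
rewrite /g0; have [r0|r0] := ltP 0 r; last by rewrite !mul0r mulr0.
rewrite !mul1r; congr (_ * _).
have mA : measurable [set w | r < X w].
  rewrite (_ : [set w | _] = X @^-1` `]r, +oo[).
    by rewrite -[X in measurable X]setTI; apply: mX => //; exact: measurable_itv.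
  by apply/seteqP; split => w /=; rewrite in_itv/= andbT.
by rewrite Rint_prob// lawX ?ltW//= mulNr.
Qed.

Lemma expect_damped (c s sg z : R) X eta : `|sg| = 1 -> test_function eta ->
  (forall w, 0 <= X w) -> (forall t, 0 <= t -> P [set w | t < X w] = (expR (- c * t))%:E) ->
  \int[P]_w (expR (- (s * X w)) * eta (sg * X w + z)) =
   eta z + \int[mu]_r ((0 < r)%R%:R * (expR (- (c * r)) * damped s sg z eta r)).
Proof.
move=> sg1 te X0 lawX; have [b b0 hb] := damped_support s z sg1 te.
have cd : continuous (damped s sg z eta) := damped_continuous (a := s) (sg := sg) (z := z) te.
have md : measurable_fun setT (damped s sg z eta) by exact: continuous_measurable_fun.
have ig0 : intg mu (fun r => (0 < r)%R%:R * damped s sg z eta r).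
  have mg0 : measurable_fun setT (fun r : R => (0 < r)%R%:R * damped s sg z eta r).
    by apply: measurable_funM => //; exact: measurable_pos.
  have := continuous_compact_integrable (@segment_compact R 0 b)
    (continuous_subspaceT (A := [set` `[0, b]]) cd).
  move=> /integrableP[_]; rewrite integral_mkcond => fin.
  apply/intgP; split => //; apply: le_lt_trans fin; apply: ge0_le_integral => //.
  - by apply/measurable_EFinP; exact: measurableT_comp.
  - apply/(measurable_restrictT _ _).1 => //; apply: measurable_funTS.
    by apply: measurableT_comp => //; exact/measurable_EFinP.
  - move=> r _; rewrite /patch; have [r0|r0] := ltP 0 r; last first.
      by rewrite mul0r normr0; case: ifP => _ //; exact: abse_ge0.
    rewrite mul1r; case: ifPn => //; rewrite notin_setE/= in_itv/= (ltW r0)/= => h.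
    by rewrite (hb r _).2 ?normr0// leNgt; apply/negP => /ltW.
have := expect_primitive (fun r => is_derive_damped s sg z r te) cd ig0 X0 lawX.
by rewrite !mulr0 oppr0 expR0 add0r mul1r.
Qed.

Lemma exp_laplace (c s : R) X : 0 < c -> 0 < s ->
  (forall w, 0 <= X w) -> (forall t, 0 <= t -> P [set w | t < X w] = (expR (- c * t))%:E) ->
  \int[P]_w expR (- (s * X w)) = c / (c + s).
Proof.
move=> c0 s0 X0 lawX.
have ew1 (l t : R) : ew l (fk 1) t = (0 < t)%R%:R * expR (- (l * t)) by rewrite ewE fk1 mulrC.
have d1 x : is_derive x (1 : R) (fun r : R => expR (- (s * r))) (- s * expR (- (s * x))).
  have := @is_derive_comp_affine R (- s) 0 x _ expR (is_derive_expR _).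
  rewrite addr0 mulNr; congr is_derive; last by rewrite !mulNr.
  by apply/funext => y; rewrite addr0 mulNr.
have d2 x : is_derive x (1 : R) (fun r : R => - s * expR (- (s * r))) (- s * (- s * expR (- (s * x)))).
  by apply: is_deriveZ; exact: d1.
have ig : intg mu (fun r : R => (0 < r)%R%:R * (- s * expR (- (s * r)))).
  have := intgZ (- s) (intg_ew_fk s0 ltr01 (_ : 1 <= 2 :> R)).
  by move=> h; apply: eq_intg (h _) => [r|]; [rewrite ew1; ring|lra].
rewrite (expect_primitive d1 (is_derive_continuous d2) ig X0 lawX).
rewrite mulr0 oppr0 expR0.
have cs0 : 0 < c + s by lra.
transitivity (1 + \int[mu]_r (- s * ew (c + s) (fk 1) r)).
  congr (_ + _); apply: eq_Rintegral => r _; rewrite ew1 mulrDl opprD expRD; ring.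
rewrite RintZ; last by apply: intg_ew_fk => //; lra.
rewrite laplace_fk//; last by lra.
by rewrite powR_inv1 ?ltW//; field; rewrite gt_eqF.
Qed.

(** Following a ray for an exponential time of rate c killed at rate s is the resolvent c (m - sg
    d/dx)^{-1}, m = c + s. As sg^2 = 1, m^2 - d^2/dx^2 factors as (m - sg d/dx)(m + sg d/dx), and c
    (m + sg d/dx) rho is left. *)
Lemma exp_kernel_identity (c s sg z : R) X rho : 0 < c -> 0 < s -> sg ^+ 2 = 1 ->
  test_function rho ->
  (forall w, 0 <= X w) -> (forall t, 0 <= t -> P [set w | t < X w] = (expR (- c * t))%:E) ->
  \int[P]_w (expR (- (s * X w)) *
     ((c + s) ^+ 2 * rho (sg * X w + z) - derive1n 2 rho (sg * X w + z))) =
  c * ((c + s) * rho z + sg * derive1 rho z).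
Proof.
move=> c0 s0 sg2 tr X0 lawX; set m := c + s.
have sg1 : `|sg| = 1.
  by apply/eqP; rewrite -(@eqrXn2 _ 2)// -normrX sg2 normr1 expr1n.
have tg := test_lin (m ^+ 2) (-1) tr (test_derive1n 2 tr).
pose g x := m ^+ 2 * rho x + -1 * derive1n 2 rho x.
have te := test_lin (- c * m) (- c * sg) tr (test_derive1n 1 tr).
have tpsi := test_lin 1 1 tg te.
(* [psi] = g - c (m rho + sg rho') is chosen so that e^{-cr} times the damped derivative of g at
   rate s is the damped derivative of [psi] at rate m. *)
pose psi x := 1 * g x + 1 * (- c * m * rho x + - c * sg * derive1n 1 rho x).
have := expect_damped s z sg1 tg X0 lawX.
rewrite -/g => e.
transitivity (\int[P]_w (expR (- (s * X w)) * g (sg * X w + z))).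
  by apply: eq_Rintegral => w _; rewrite /g; congr (_ * _); ring.
rewrite e.
have dlin (a b : R) f1 f2 x : test_function f1 -> test_function f2 ->
    derive1 (fun x => a * f1 x + b * f2 x) x = a * derive1 f1 x + b * derive1 f2 x.
  move=> t1 t2; have h y : is_derive y (1 : R) (fun x => a * f1 x + b * f2 x) (a * derive1 f1 y + b * derive1 f2 y).
    by apply: is_deriveD; apply: is_deriveZ; apply: derivable_is_derive; exact: test_derivable.
  by rewrite (is_derive_derive1 h).2.
have -> : \int[mu]_r ((0 < r)%R%:R * (expR (- (c * r)) * damped s sg z g r)) =
    \int[mu]_r ((0 < r)%R%:R * damped m sg z psi r).
  apply: eq_Rintegral => r _; congr (_ * _); rewrite /damped mulrA -expRD.
  have -> : - (c * r) + - (s * r) = - (m * r) by rewrite /m; ring.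
  congr (_ * _); set y := sg * r + z.
  have e1 : derive1 psi y = 1 * derive1 g y +
      1 * derive1 (fun x => - c * m * rho x + - c * sg * derive1n 1 rho x) y by exact: dlin.
  have e2 := dlin (- c * m) (- c * sg) rho (derive1n 1 rho) y tr (test_derive1n 1 tr).
  have e3 : derive1 (derive1n 1 rho) y = derive1n 2 rho y by [].
  have e4 : derive1n 1 rho y = derive1 rho y by [].
  rewrite e1 e2 e3 /psi e4; move: (derive1 g y) => dg.
  transitivity (sg * dg - s * g y + c * (1 - sg ^+ 2) * derive1n 2 rho y).
    by rewrite sg2; ring.
  rewrite /g /m; ring.
rewrite Rint_damped//.
have e4 : derive1n 1 rho z = derive1 rho z by [].
by rewrite /psi /g e4 /m; ring.
Qed.

End Exponential_variable.

Section Walk.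
Context {d : measure_display} {Om : measurableType d} {R : realType}
  {P : probability Om R}.
Local Notation mu := (@lebesgue_measure R).
Implicit Types (theta e : nat -> {RV P >-> R}) (H : R -> {RV P >-> R}) (F rho : R -> R).

Lemma Rint_le_bound (F : Om -> R) M : measurable_fun setT F -> (forall w, `|F w| <= M) ->
  `|\int[P]_w F w| <= M.
Proof.
move=> mF FM; have iF := Rint_bounded P mF FM.
apply: le_trans (le_normr_Rintegral _ _) _ => //.
rewrite -[leRHS](Rint_cst_prob P); apply: le_Rintegral => //.
- exact: intg_norm.
- exact: finite_measure_integrable_cst.
Qed.

Lemma prob_theta_e theta e H n (A B : set R) : iid_signs theta ->
  independent_variables [set j | (0 < j)%N] e -> independent_families theta e H ->
  measurable A -> measurable B ->
  P (theta n.+1 @^-1` A `&` e n.+1 @^-1` B) =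
    (P (theta n.+1 @^-1` A) * P (e n.+1 @^-1` B))%E.
Proof.
move=> h1 h2 h3 mA mB.
have := prob_rect0 n.+1 h1 h2 h3 (A := fun j => if (j < n)%N then setT else A)
    (B := fun j => if (j < n)%N then setT else B).
rewrite /rect !big_ord_recr/= !ltnn big1 ?setTI; last first.
  by move=> i _; rewrite ltn_ord !preimage_setT setIT.
move=> ->; [|by move=> i; case: ifP|by move=> i; case: ifP].
rewrite big1 ?mul1e// => i _.
by rewrite ltn_ord !preimage_setT !probability_setT mule1.
Qed.

(** The two values carry total mass 1, so the event that the sign is neither 1 nor -1 is null,
    though not excluded path by path. *)
Lemma expect_sign theta j (h : R -> R) M : iid_signs theta -> measurable_fun setT h ->
  (forall x, `|h x| <= M) ->
  \int[P]_w h (theta j w) = 2^-1 * (h 1 + h (-1)).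
Proof.
move=> [_ /(_ j)[p1 pm1]] mh hM.
have mth : measurable_fun setT (theta j) by [].
have ms a : measurable [set w | theta j w == a].
  rewrite (_ : [set w | _] = theta j @^-1` [set a]).
    by rewrite -[X in measurable X]setTI; exact: mth.
  by apply/seteqP; split => w /= /eqP.
have e a : [set w | theta j w == a] = [set w | theta j w = a].
  by apply/seteqP; split => w /= /eqP.
have mi a : measurable_fun setT (fun w => (theta j w == a)%:R : R).
  exact: measurable_ind.
have ii a : intg P (fun w => (theta j w == a)%:R : R).
  apply: (@Rint_bounded _ _ _ _ _ 1 (mi a)) => w.
  by rewrite normr_nat lern1 leq_b1.
have pz : P (~` ([set w | theta j w == 1] `|` [set w | theta j w == -1])) = 0%E.
  pose A := [set w | theta j w == 1]; pose B := [set w | theta j w == -1].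
  have AB : A `&` B = set0.
    apply/seteqP; split => w //= [/eqP h1 /eqP h2].
    by have : (1 : R) <> -1 by [lra]; rewrite -{1}h1 -h2.
  have pU : P (A `|` B) = (P A + P B)%E by exact: measureU (ms 1) (ms (-1)) AB.
  rewrite probability_setC; last exact: measurableU.
  have h2 : 2^-1 + 2^-1 = 1 :> R by lra.
  have q : P (A `|` B) = 1%:E by rewrite pU /A /B !e p1 pm1 -EFinD h2.
  by rewrite q; exact: subee.
transitivity (\int[P]_w (h 1 * (theta j w == 1)%:R + h (-1) * (theta j w == -1)%:R)).
  apply: Rint_ae.
  - exact: measurableT_comp.
  - by apply: measurable_funD; exact: measurable_funM.
  exists (~` ([set w | theta j w == 1] `|` [set w | theta j w == -1])); split.
  - by apply: measurableC; exact: measurableU.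
  - exact: pz.
  - move=> w /= nh; apply: contra_not nh => nn.
    have [t1|t1] := eqVneq (theta j w) 1.
      rewrite t1 (_ : (1 : R) == -1 = false) ?mulr1 ?mulr0 ?addr0//.
      by apply/negbTE/eqP; lra.
    have [tm|tm] := eqVneq (theta j w) (-1).
      by rewrite tm mulr1 mulr0 add0r.
    by case: nn; rewrite ?(negbTE t1) ?(negbTE tm).
rewrite RintegralD//; [|exact: intgZ|exact: intgZ].
by rewrite !RintZ// !Rint_prob// !e p1 pm1/=; ring.
Qed.

(* The killed one-step kernel: E[F(a + theta e) exp(-s e)]. Qop is its n-th iterate. *)
Definition Kop theta e (s : R) n F (a : R) : R :=
  \int[P]_w (F (a + theta n.+1 w * e n.+1 w) * expR (- (s * e n.+1 w))).

Definition walk theta e n (w : Om) : R := \sum_(i < n) theta i.+1 w * e i.+1 w.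
Definition arr e n (w : Om) : R := \sum_(i < n) e i.+1 w.

Definition Qop theta e (s : R) n F (x : R) : R :=
  \int[P]_w (F (x + walk theta e n w) * expR (- (s * arr e n w))).

(** Averaging [exp_kernel_identity] over the two directions cancels the odd term sg rho'. *)
Lemma Kop_test theta e H (c s : R) n rho a : 0 < c -> 0 < s ->
  iid_signs theta -> exponential_times e c -> independent_families theta e H ->
  test_function rho ->
  Kop theta e s n (fun x => (c + s) ^+ 2 * rho x - derive1n 2 rho x) a = c * (c + s) * rho a.
Proof.
move=> c0 s0 h1 [e0 h2 epos elaw] h3 tr.
have tg := test_lin ((c + s) ^+ 2) (-1) tr (test_derive1n 2 tr).
have [M M0 hM] := test_bounded tg.
pose g x := (c + s) ^+ 2 * rho x + -1 * derive1n 2 rho x.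
have gE x : (c + s) ^+ 2 * rho x - derive1n 2 rho x = g x by rewrite /g mulN1r.
have mg : measurable_fun setT g by exact: test_measurable tg.
(* The absolute value bounds the exponential on the whole plane, as [indep_fubini] requires; the
   waiting times are nonnegative, so it changes nothing. *)
pose F (z : R * R) := g (a + z.1 * z.2) * expR (- (s * `|z.2|)).
have mF : measurable_fun setT F.
  apply: measurable_funM.
    apply: (measurableT_comp mg); apply: measurable_funD => //.
    by apply: measurable_funM; [exact: measurable_fst|exact: measurable_snd].
  apply: (measurableT_comp (measurable_expRl s)).
  by apply: measurableT_comp => //; exact: measurable_snd.
have FM z : `|F z| <= M.
  rewrite normrM -[leRHS]mulr1 ler_pM// ?hM// ger0_norm ?expR_ge0// expR_le1.
  by rewrite oppr_le0 mulr_ge0// ltW.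
have ind : indep2 P (theta n.+1) (e n.+1).
  by move=> A B mA mB; exact: (prob_theta_e n h1 h2 h3).
have := indep_fubini ind mF FM; rewrite /Kop => h.
transitivity (\int[P]_w F (theta n.+1 w, e n.+1 w)).
  by apply: eq_Rintegral => w _; rewrite gE /F/= ger0_norm.
rewrite h; pose hh b := \int[P]_w F (b, e n.+1 w).
have me : measurable_fun setT (e n.+1) by [].
have mhh : measurable_fun setT hh.
  apply: (measurable_Rint2 P (f := fun z : R * Om => F (z.1, e n.+1 z.2))).
  apply: (measurableT_comp mF); apply: measurable_fun_pair; first exact: measurable_fst.
  by apply: (measurableT_comp me); exact: measurable_snd.
have hhM b : `|hh b| <= M.
  have mFb : measurable_fun setT (fun w => F (b, e n.+1 w)).
    by apply: (measurableT_comp mF); apply: measurable_fun_pair.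
  by apply: Rint_le_bound => // w; exact: FM.
rewrite (expect_sign n.+1 h1 mhh hhM).
have val sg : sg ^+ 2 = 1 -> hh sg = c * ((c + s) * rho a + sg * derive1 rho a).
  move=> sg2; rewrite -(exp_kernel_identity a c0 s0 sg2 tr (epos n.+1) (fun t t0 => elaw n.+1 t isT t0)).
  by apply: eq_Rintegral => w _; rewrite /F /= ger0_norm// /g mulrC mulN1r [a + _]addrC.
have s1 : (1 : R) ^+ 2 = 1 by ring.
have s2 : (-1 : R) ^+ 2 = 1 by ring.
have v1 := val 1 s1; have v2 := val (-1) s2.
by rewrite v1 v2; field.
Qed.

Lemma measurable_walk theta e n : measurable_fun setT (walk theta e n).
Proof. by apply: measurable_sum => i; exact: measurable_funM. Qed.

Lemma measurable_arr e n : measurable_fun setT (arr e n).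
Proof. exact: measurable_sum. Qed.

Lemma measurable_walk_rects theta e n k : (k <= n)%N ->
  measurable_fun setT (walk theta e k : g_sigma_algebraType (rects theta e n) -> R).
Proof.
move=> kn; apply: measurable_sum => i.
have [h1 h2] := measurable_rects theta e (leq_trans (ltn_ord i) kn).
exact: measurable_funM.
Qed.

Lemma measurable_arr_rects theta e n k : (k <= n)%N ->
  measurable_fun setT (arr e k : g_sigma_algebraType (rects theta e n) -> R).
Proof.
move=> kn; apply: measurable_sum => i.
by have [h1 h2] := measurable_rects theta e (leq_trans (ltn_ord i) kn).
Qed.

Lemma arr_ge0 e (c : R) n w : exponential_times e c -> 0 <= arr e n w.
Proof. by move=> [_ _ epos _]; apply: sumr_ge0. Qed.

Lemma Qop0 theta e s F x : Qop theta e s 0 F x = F x.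
Proof.
rewrite /Qop -[RHS](Rint_cst_prob P); apply: eq_Rintegral => w _.
by rewrite /walk /arr !big_ord0 mulr0 oppr0 expR0 mulr1 addr0.
Qed.

(** Step n + 1 is independent of the first n steps, so averaging over it first inserts the one-step
    kernel inside. *)
Lemma Qop_step theta e H (c s : R) n F M x : 0 < s ->
  iid_signs theta -> exponential_times e c -> independent_families theta e H ->
  measurable_fun setT F -> (forall y, `|F y| <= M) ->
  Qop theta e s n.+1 F x = Qop theta e s n (Kop theta e s n F) x.
Proof.
move=> s0 h1 /[dup] he [e0 h2 epos elaw] h3 mF FM.
have msr : measurable_fun setT ((fun w => (walk theta e n w, arr e n w)) :
    g_sigma_algebraType (rects theta e n) -> (R * R)%type).
  by apply: measurable_fun_pair; [exact: measurable_walk_rects|exact: measurable_arr_rects].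
have ind := indep_rects_next h1 h2 h3 msr.
pose X : {mfun Om >-> (R * R)%type} := HB.pack (fun w => (walk theta e n w, arr e n w))
  (isMeasurableFun.Build _ _ _ _ _ (measurable_fun_pair (measurable_walk theta e n) (measurable_arr e n))).
have mp : measurable_fun setT (fun w => (theta n.+1 w, e n.+1 w)).
  by apply: measurable_fun_pair.
pose Y : {mfun Om >-> (R * R)%type} := HB.pack (fun w => (theta n.+1 w, e n.+1 w))
  (isMeasurableFun.Build _ _ _ _ _ mp).
pose G (z : (R * R) * (R * R)) := F (x + (z.1.1 + z.2.1 * z.2.2)) * expR (- (s * `|z.1.2 + z.2.2|)).
have mfst2 : measurable_fun setT (fun z : (R * R) * (R * R) => z.1.1).
  by apply: (measurableT_comp measurable_fst); exact: measurable_fst.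
have msnd1 : measurable_fun setT (fun z : (R * R) * (R * R) => z.1.2).
  by apply: (measurableT_comp measurable_snd); exact: measurable_fst.
have mfst1 : measurable_fun setT (fun z : (R * R) * (R * R) => z.2.1).
  by apply: (measurableT_comp measurable_fst); exact: measurable_snd.
have msnd2 : measurable_fun setT (fun z : (R * R) * (R * R) => z.2.2).
  by apply: (measurableT_comp measurable_snd); exact: measurable_snd.
have mG : measurable_fun setT G.
  apply: measurable_funM.
    apply: (measurableT_comp mF); apply: measurable_funD => //.
    by apply: measurable_funD => //; exact: measurable_funM.
  apply: (measurableT_comp (measurable_expRl s)).
  by apply: measurableT_comp => //; exact: measurable_funD.
have GM z : `|G z| <= M.
  rewrite normrM -[leRHS]mulr1 ler_pM// ?hM// ger0_norm ?expR_ge0// expR_le1.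
  by rewrite oppr_le0 mulr_ge0// ltW.
have h := indep_fubini (X := X) (Y := Y) ind mG GM.
have ap := arr_ge0 n _ he.
transitivity (\int[P]_w G (X w, Y w)).
  apply: eq_Rintegral => w _; rewrite /G/= /walk /arr !big_ord_recr/=.
  by rewrite ger0_norm// addr_ge0// ap.
rewrite h; apply: eq_Rintegral => w1 _.
rewrite /Kop -RintMr; last first.
  apply: measurable_funM.
    apply: (measurableT_comp mF); apply: measurable_funD => //; exact: measurable_funM.
  by apply: (measurableT_comp (measurable_expRl s)).
apply: eq_Rintegral => w2 _; rewrite /G/= -mulrA -expRD addrA.
rewrite ger0_norm; last by rewrite addr_ge0// ap.
by congr (_ * expR _); ring.
Qed.

Lemma measurable_Kop theta e s n F : measurable_fun setT F ->
  measurable_fun setT (Kop theta e s n F).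
Proof.
move=> mF; apply: (measurable_Rint2 P (f := fun z : R * Om =>
  F (z.1 + theta n.+1 z.2 * e n.+1 z.2) * expR (- (s * e n.+1 z.2)))).
have mt : measurable_fun setT (fun z : R * Om => theta n.+1 z.2).
  by apply: (measurableT_comp (f := theta n.+1)) => //; exact: measurable_snd.
have me : measurable_fun setT (fun z : R * Om => e n.+1 z.2).
  by apply: (measurableT_comp (f := e n.+1)) => //; exact: measurable_snd.
apply: measurable_funM.
  by apply: (measurableT_comp mF); apply: measurable_funD => //; exact: measurable_funM.
by apply: (measurableT_comp (measurable_expRl s)).
Qed.

Lemma Kop_bound theta e (c s : R) n F M a : 0 < s -> exponential_times e c ->
  measurable_fun setT F -> (forall y, `|F y| <= M) -> `|Kop theta e s n F a| <= M.
Proof.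
move=> s0 [_ _ epos _] mF FM; apply: Rint_le_bound.
  apply: measurable_funM.
    by apply: (measurableT_comp mF); apply: measurable_funD => //; exact: measurable_funM.
  by apply: (measurableT_comp (measurable_expRl s)).
move=> w; rewrite normrM -[leRHS]mulr1 ler_pM// ger0_norm ?expR_ge0// expR_le1.
by rewrite oppr_le0 mulr_ge0// ltW.
Qed.

(** The case F = 1 of the iteration: each step multiplies by c/(c + s). *)
Lemma arr_laplace theta e H (c s : R) n : 0 < c -> 0 < s ->
  iid_signs theta -> exponential_times e c -> independent_families theta e H ->
  \int[P]_w expR (- (s * arr e n w)) = (c / (c + s)) ^+ n.
Proof.
move=> c0 s0 h1 he h3.
have Q1 k : Qop theta e s k (fun=> 1) 0 = \int[P]_w expR (- (s * arr e k w)).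
  by apply: eq_Rintegral => w _; rewrite mul1r.
have one_le (y : R) : `|(1 : R)| <= 1 by rewrite normr1.
rewrite -Q1; elim: n => [|n IH]; first by rewrite Qop0 expr0.
rewrite (Qop_step n 0 s0 h1 he h3 (measurable_cst _) one_le).
have K1 a : Kop theta e s n (fun=> 1) a = c / (c + s).
  case: (he) => _ _ epos elaw.
  rewrite -(exp_laplace c0 s0 (epos n.+1) (fun t t0 => elaw n.+1 t isT t0)).
  by apply: eq_Rintegral => w _; rewrite mul1r.
rewrite exprS -IH Q1 -RintZm.
  by apply: eq_Rintegral => w _; rewrite K1.
by apply: (measurableT_comp (measurable_expRl s)); exact: measurable_arr.
Qed.

Lemma measurable_Qint theta e s n F x : measurable_fun setT F ->
  measurable_fun setT (fun w => F (x + walk theta e n w) * expR (- (s * arr e n w))).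
Proof.
move=> mF; apply: measurable_funM.
  by apply: (measurableT_comp mF); apply: measurable_funD => //; exact: measurable_walk.
by apply: (measurableT_comp (measurable_expRl s)); exact: measurable_arr.
Qed.

Lemma intg_Qint theta e (c s : R) n F M x : 0 < s -> exponential_times e c ->
  measurable_fun setT F -> (forall y, `|F y| <= M) ->
  intg P (fun w => F (x + walk theta e n w) * expR (- (s * arr e n w))).
Proof.
move=> s0 he mF FM; apply: (@Rint_bounded _ _ _ _ _ M); first exact: measurable_Qint.
move=> w; rewrite normrM -[leRHS]mulr1 ler_pM// ger0_norm ?expR_ge0// expR_le1.
by rewrite oppr_le0 mulr_ge0// ?(ltW s0)// (arr_ge0 _ _ he).
Qed.

Lemma Qop_bound theta e H (c s : R) n F M x : 0 < c -> 0 < s ->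
  iid_signs theta -> exponential_times e c -> independent_families theta e H ->
  measurable_fun setT F -> (forall y, `|F y| <= M) ->
  `|Qop theta e s n F x| <= M * (c / (c + s)) ^+ n.
Proof.
move=> c0 s0 h1 he h3 mF FM; rewrite -(arr_laplace n c0 s0 h1 he h3).
have iQ := intg_Qint theta n x s0 he mF FM.
have mE : measurable_fun setT (fun w => expR (- (s * arr e n w))).
  by apply: (measurableT_comp (measurable_expRl s)); exact: measurable_arr.
have iE : intg P (fun w => expR (- (s * arr e n w))).
  apply: (@Rint_bounded _ _ _ _ _ 1) => // w; rewrite ger0_norm ?expR_ge0// expR_le1.
  by rewrite oppr_le0 mulr_ge0// ?(ltW s0)// (arr_ge0 _ _ he).
rewrite -RintZ//; apply: le_trans (le_normr_Rintegral _ _) _ => //.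
apply: le_Rintegral => //; first exact: intg_norm.
  exact: intgZ.
by move=> w _; rewrite normrM [X in _ * X <= _]ger0_norm ?expR_ge0// ler_wpM2r// expR_ge0.
Qed.

(** Unrolling U = p F + K U leaves [Qop] of order N applied to U, of size at most MU q^N with q =
    c/(c + s). The equation is assumed for every n because the kernel is built from the variables of
    step n + 1, and each unrolling uses the next step. *)
Lemma renewal_iterate theta e H (c s p : R) F (U : R -> R) MF MU x N : 0 < c -> 0 < s ->
  iid_signs theta -> exponential_times e c -> independent_families theta e H ->
  measurable_fun setT F -> (forall y, `|F y| <= MF) ->
  measurable_fun setT U -> (forall y, `|U y| <= MU) ->
  (forall n y, U y = p * F y + Kop theta e s n U y) ->
  `|U x - p * \sum_(n < N) Qop theta e s n F x| <= MU * (c / (c + s)) ^+ N.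
Proof.
move=> c0 s0 h1 he h3 mF FM mU UM eqU.
have -> : U x = p * \sum_(n < N) Qop theta e s n F x + Qop theta e s N U x.
  elim: N => [|N IH]; first by rewrite big_ord0 mulr0 add0r Qop0.
  rewrite IH big_ord_recr/= mulrDr -addrA; congr (_ + _).
  rewrite (Qop_step N x s0 h1 he h3 mU UM) /Qop -RintZm; last exact: measurable_Qint.
  rewrite -RintegralD//.
  - by apply: eq_Rintegral => w _; rewrite {1}(eqU N) mulrDl mulrA.
  - apply: intgZ; exact: intg_Qint he mF FM.
  - apply: (intg_Qint theta N x s0 he (measurable_Kop _ _ _ _ mU)) => y.
    exact: (Kop_bound theta N y s0 he mU UM).
rewrite addrC addKr; exact: Qop_bound c0 s0 h1 he h3 mU UM.
Qed.

End Walk.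

(** * Mollification in space and the renewal equation *)

Section Mollification.
Context {R : realType}.
Local Notation mu := (@lebesgue_measure R).
Implicit Types f w rho phi : R -> R.

Lemma integral_reflect (x : R) (f : R -> \bar R) : measurable_fun setT f ->
  (\int[mu]_y f (x - y)%R = \int[mu]_y f y)%E.
Proof.
move=> mf; have ma : measurable_fun setT (fun y : R => f (1 * y + x)).
  by apply: (measurableT_comp mf); exact: measurable_affine.
have h := integral_affine x (ltr01 : 0 < 1 :> R) mf.
rewrite invr1 mul1e in h; rewrite -h -(integral_opp ma).
by apply: eq_integral => y _; congr f; ring.
Qed.

Lemma N2_reflect (x : R) rho : measurable_fun setT rho ->
  N2 (fun y => rho (x - y)) = N2 rho.
Proof.
move=> mr; rewrite /N2 unlock.
have e : (\int[mu]_y (`|(EFin \o (fun y => rho (x - y)%R)) y| `^ 2) =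
    \int[mu]_y (`|(EFin \o rho) y| `^ 2))%E.
  apply: (integral_reflect x (f := fun y => (`|(rho y)%:E| `^ 2)%E)).
  apply/measurable_EFinP.
  by apply: (measurableT_comp (measurable_powRr 2)); exact: measurableT_comp.
by rewrite e.
Qed.

Lemma N2_shift (x : R) rho : measurable_fun setT rho ->
  N2 (fun y => rho (y + x)) = N2 rho.
Proof.
move=> mr; rewrite /N2 unlock.
have mq : measurable_fun setT (fun y => (`|(rho y)%:E| `^ 2)%E).
  apply/measurable_EFinP.
  by apply: (measurableT_comp (measurable_powRr 2)); exact: measurableT_comp.
have e : (\int[mu]_y (`|(EFin \o (fun y => rho (y + x)%R)) y| `^ 2) =
    \int[mu]_y (`|(EFin \o rho) y| `^ 2))%E.
  have h := integral_affine x (ltr01 : 0 < 1 :> R) mq.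
  rewrite invr1 mul1e in h; rewrite -h.
  by apply: eq_integral => y _; rewrite mul1r.
by rewrite e.
Qed.

Lemma test_reflect (x : R) rho : test_function rho -> test_function (fun y => rho (x - y)).
Proof.
move=> tr; have := @test_affine R (-1) x rho.
rewrite oppr_eq0 oner_eq0 => /(_ isT tr); congr test_function.
by apply/funext => y; congr rho; ring.
Qed.

Lemma derive1n_reflect (x : R) rho : test_function rho ->
  derive1n 2 (fun y => rho (x - y)) = fun y => derive1n 2 rho (x - y).
Proof.
move=> [dr _]; have := derive1n_affine (-1) x 2 dr.
have -> : (fun y => rho (-1 * y + x)) = (fun y => rho (x - y)).
  by apply/funext => y; congr rho; ring.
move=> ->; apply/funext => y.
have -> : (-1 : R) ^+ 2 = 1 by ring.
by rewrite mul1r; congr (derive1n 2 rho _); ring.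
Qed.

Definition mol w rho (x : R) : R := \int[mu]_y (w y * rho (x - y)).

(** Membership in L^2 phrased by duality: for the transform of u, this is the form that integrating
    the pairings in time delivers directly. *)
Definition L2_bounded w : Prop := measurable_fun setT w /\
  exists2 M : R, 0 <= M & forall phi, measurable_fun setT phi ->
    (\int[mu]_y `|w y * phi y|%:E <= M%:E * N2 phi)%E.

Lemma L2_bounded_N2 f : measurable_fun setT f -> (N2 f < +oo)%E -> L2_bounded f.
Proof.
move=> mf ff; split => //; exists (fine (N2 f)); first by apply: fine_ge0; exact: N2_ge0.
move=> phi mp; rewrite fineK; first exact: cauchy_schwarz.
by rewrite ge0_fin_numE// N2_ge0.
Qed.

Lemma L2_bounded_intg w phi : L2_bounded w -> measurable_fun setT phi ->
  (N2 phi < +oo)%E -> intg mu (fun y => w y * phi y).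
Proof.
move=> [mw [M M0 hM]] mp fp; apply/intgP; split; first exact: measurable_funM.
by apply: le_lt_trans (hM phi mp) _; rewrite lte_mul_pinfty ?lee_fin.
Qed.

Lemma measurable_mol_kernel w rho : measurable_fun setT w -> measurable_fun setT rho ->
  measurable_fun setT (fun z : R * R => w z.2 * rho (z.1 - z.2)).
Proof.
move=> mw mr; apply: measurable_funM; first by apply: (measurableT_comp mw); exact: measurable_snd.
by apply: (measurableT_comp mr); exact: measurable_sub2.
Qed.

Lemma measurable_mol w rho : measurable_fun setT w -> measurable_fun setT rho ->
  measurable_fun setT (mol w rho).
Proof.
move=> mw mr; exact: (measurable_Rint2 mu (f := fun z : R * R => w z.2 * rho (z.1 - z.2)) (measurable_mol_kernel mw mr)).
Qed.

Lemma measurable_reflect (x : R) rho : measurable_fun setT rho ->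
  measurable_fun setT (fun y : R => rho (x - y)).
Proof. by move=> mr; apply: (measurableT_comp mr); exact: measurable_funB. Qed.

Lemma mol_intg w rho x : L2_bounded w -> measurable_fun setT rho -> (N2 rho < +oo)%E ->
  intg mu (fun y => w y * rho (x - y)).
Proof.
move=> lw mr fr; apply: L2_bounded_intg => //; first exact: measurable_reflect.
by rewrite N2_reflect.
Qed.

Lemma mol_bounded w rho : L2_bounded w -> measurable_fun setT rho -> (N2 rho < +oo)%E ->
  exists2 M : R, 0 <= M & forall x, (\int[mu]_y `|w y * rho (x - y)|%:E <= M%:E)%E /\
    `|mol w rho x| <= M.
Proof.
move=> lw mr fr; have [mw [M M0 hM]] := lw.
have nr : (N2 rho \is a fin_num)%E by rewrite ge0_fin_numE// N2_ge0.
exists (M * fine (N2 rho)); first by rewrite mulr_ge0// fine_ge0// N2_ge0.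
move=> x; have h : (\int[mu]_y `|w y * rho (x - y)|%:E <= (M * fine (N2 rho))%:E)%E.
  apply: le_trans (hM _ (measurable_reflect x mr)) _.
  by rewrite N2_reflect// EFinM fineK.
split => //; rewrite -lee_fin; apply: le_trans h.
have im := mol_intg x lw mr fr; have mm := intg_measurable im.
rewrite -abse_EFin /mol (EFin_Rint im).
by apply: le_abse_integral => //; exact/measurable_EFinP.
Qed.

Lemma mol_lin w f1 f2 (a b : R) x : L2_bounded w ->
  measurable_fun setT f1 -> (N2 f1 < +oo)%E -> measurable_fun setT f2 -> (N2 f2 < +oo)%E ->
  mol w (fun y => a * f1 y + b * f2 y) x = a * mol w f1 x + b * mol w f2 x.
Proof.
move=> lw m1 n1 m2 n2; have i1 := mol_intg x lw m1 n1; have i2 := mol_intg x lw m2 n2.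
rewrite /mol -!RintZ// -RintegralD//; [|exact: intgZ|exact: intgZ].
by apply: eq_Rintegral => y _; ring.
Qed.

End Mollification.

Section Renewal.
Context {d : measure_display} {Om : measurableType d} {R : realType}
  {P : probability Om R}.
Local Notation mu := (@lebesgue_measure R).
Implicit Types (theta e : nat -> {RV P >-> R}) (H : R -> {RV P >-> R}) (F rho w f : R -> R).

Lemma Kop_lin theta e (c s a b : R) n F1 F2 M1 M2 x : 0 < s -> exponential_times e c ->
  measurable_fun setT F1 -> (forall y, `|F1 y| <= M1) ->
  measurable_fun setT F2 -> (forall y, `|F2 y| <= M2) ->
  Kop theta e s n (fun y => a * F1 y + b * F2 y) x =
  a * Kop theta e s n F1 x + b * Kop theta e s n F2 x.
Proof.
move=> s0 [_ _ epos _] m1 b1 m2 b2.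
have i F M : measurable_fun setT F -> (forall y, `|F y| <= M) ->
    intg P (fun om => F (x + theta n.+1 om * e n.+1 om) * expR (- (s * e n.+1 om))).
  move=> mF FM; apply: (@Rint_bounded _ _ _ _ _ M).
    apply: measurable_funM.
      by apply: (measurableT_comp mF); apply: measurable_funD => //; exact: measurable_funM.
    by apply: (measurableT_comp (measurable_expRl s)).
  move=> w; rewrite normrM -[leRHS]mulr1 ler_pM// ger0_norm ?expR_ge0// expR_le1.
  by rewrite oppr_le0 mulr_ge0// ltW.
have i1 := i _ _ m1 b1; have i2 := i _ _ m2 b2.
rewrite /Kop -!RintZ// -RintegralD//; [|exact: intgZ|exact: intgZ].
by apply: eq_Rintegral => w _; ring.
Qed.

(** The kernel is a weighted average of translates and so commutes with convolution in x; the
    uniform bound of [mol_bounded] gives the integrability for Fubini. *)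
Lemma Kop_mol theta e (c s : R) n w g x : 0 < s -> exponential_times e c ->
  L2_bounded w -> measurable_fun setT g -> (N2 g < +oo)%E ->
  Kop theta e s n (mol w g) x = mol w (Kop theta e s n g) x.
Proof.
move=> s0 [_ _ epos _] lw mg ng; have [mw _] := lw.
have [M M0 hM] := mol_bounded lw mg ng.
pose K (z : Om * R) := w z.2 * g (x + theta n.+1 z.1 * e n.+1 z.1 - z.2) * expR (- (s * e n.+1 z.1)).
have mt : measurable_fun setT (fun z : Om * R => theta n.+1 z.1).
  by apply: (measurableT_comp (f := theta n.+1)) => //; exact: measurable_fst.
have me : measurable_fun setT (fun z : Om * R => e n.+1 z.1).
  by apply: (measurableT_comp (f := e n.+1)) => //; exact: measurable_fst.
have mK : measurable_fun setT K.
  apply: measurable_funM; last by apply: (measurableT_comp (measurable_expRl s)).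
  apply: measurable_funM; first by apply: (measurableT_comp mw); exact: measurable_snd.
  apply: (measurableT_comp mg); apply: measurable_funB; last exact: measurable_snd.
  by apply: measurable_funD => //; exact: measurable_funM.
have mwg v : measurable_fun setT (fun y => w y * g (v - y)).
  by apply: measurable_funM => //; exact: measurable_reflect.
have iK : intg (P \x mu)%E K.
  apply: prod_intgP => //; apply: (@le_lt_trans _ _ (\int[P]_w M%:E)%E).
    apply: ge0_le_integral => //.
    - by move=> om _; apply: integral_ge0 => r _; rewrite lee_fin.
    - apply: (measurable_integral2 mu (f := fun z => (`|K z|)%:E)).
      by apply/measurable_EFinP; exact: measurableT_comp.
    - move=> om _; apply: le_trans (hM (x + theta n.+1 om * e n.+1 om)).1.
      apply: ge0_le_integral => //.
      + apply/measurable_EFinP; apply: measurableT_comp => //.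
        by apply: (measurableT_comp mK); exact: pair1_measurable.
      + apply/measurable_EFinP; apply: (measurableT_comp (@normr_measurable R setT)).
        exact: mwg.
      + move=> y _; rewrite lee_fin /K/= normrM ler_piMr// ger0_norm ?expR_ge0// expR_le1.
        by rewrite oppr_le0 mulr_ge0// ltW.
  rewrite -(EFin_Rint (finite_measure_integrable_cst P _ measurableT)).
  exact: ltry.
transitivity (\int[P]_om \int[mu]_y K (om, y)).
  by apply: eq_Rintegral => om _; rewrite /mol -RintMr//; exact: mwg.
rewrite (Rint_fubini iK); apply: eq_Rintegral => y _.
rewrite /Kop -RintZm.
  by apply: eq_Rintegral => om _; rewrite /K/= mulrA; congr (_ * g _ * _); ring.
apply: measurable_funM; last by apply: (measurableT_comp (measurable_expRl s)).
by apply: (measurableT_comp mg); apply: measurable_funD => //; exact: measurable_funM.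
Qed.

(** Testing the weak equation on the reflected mollifier gives a pointwise equation between
    mollifications. The kernel is applied to it, its values on second derivatives are eliminated
    through [Kop_test], and the rest is algebra. *)
Lemma mol_renewal theta e H (c l alpha : R) n uh f rho x : 0 < c -> 0 < l ->
  let s := l `^ alpha in let ph := (1 - c / (c + s)) / l in
  iid_signs theta -> exponential_times e c -> independent_families theta e H ->
  L2_bounded uh -> L2_bounded f ->
  (forall phi, test_function phi ->
        \int[mu]_y (uh y * derive1n 2 phi y) - ph * \int[mu]_y (f y * derive1n 2 phi y) =
        (c * s + s ^+ 2) * (\int[mu]_y (uh y * phi y) - l^-1 * \int[mu]_y (f y * phi y))) ->
  test_function rho ->
  mol uh rho x = ph * mol f rho x + Kop theta e s n (mol uh rho) x.
Proof.
move=> c0 l0 s ph h1 h2 h3 lu lf W tr.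
have s0 : 0 < s by exact: powR_gt0.
have t2 := test_derive1n 2 tr.
have [mr nr] := (test_measurable tr, test_N2 tr).
have [m2 n2] := (test_measurable t2, test_N2 t2).
pose m := c + s; have m0 : 0 < m by rewrite addr_gt0.
pose g y := m ^+ 2 * rho y + -1 * derive1n 2 rho y.
have tg : test_function g := test_lin (m ^+ 2) (-1) tr t2.
have [mg ng] := (test_measurable tg, test_N2 tg).
have Wx y : mol uh (derive1n 2 rho) y - ph * mol f (derive1n 2 rho) y =
    (c * s + s ^+ 2) * (mol uh rho y - l^-1 * mol f rho y).
  have := W _ (test_reflect y tr); rewrite derive1n_reflect//.
have bd w r : L2_bounded w -> measurable_fun setT r -> (N2 r < +oo)%E ->
    measurable_fun setT (mol w r) /\ exists M, forall y, `|mol w r y| <= M.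
  move=> lw mrr nrr; split; first by apply: measurable_mol => //; case: lw.
  by have [M _ hM] := mol_bounded lw mrr nrr; exists M => y; exact: (hM y).2.
have Kg w : L2_bounded w -> m ^+ 2 * Kop theta e s n (mol w rho) x -
    Kop theta e s n (mol w (derive1n 2 rho)) x = c * m * mol w rho x.
  move=> lw; have [mm1 [M1 hM1]] := bd w rho lw mr nr.
  have [mm2 [M2 hM2]] := bd w _ lw m2 n2.
  have := Kop_lin theta (m ^+ 2) (-1) n x s0 h2 mm1 hM1 mm2 hM2.
  rewrite mulN1r => <-.
  have -> : (fun y => m ^+ 2 * mol w rho y + -1 * mol w (derive1n 2 rho) y) = mol w g.
    by apply/funext => y; rewrite -mol_lin.
  rewrite (Kop_mol theta n x s0 h2 lw mg ng) /mol.
  rewrite -RintZ; last exact: mol_intg.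
  apply: eq_Rintegral => y _.
  have := Kop_test n (x - y) c0 s0 h1 h2 h3 tr; rewrite -/m.
  have -> : (fun x => m ^+ 2 * rho x - derive1n 2 rho x) = g by apply/funext => z; rewrite /g mulN1r.
  by move=> ->; ring.
have [mu1 [Mu1 hMu1]] := bd uh rho lu mr nr.
have [mu2 [Mu2 hMu2]] := bd uh _ lu m2 n2.
have [mf1 [Mf1 hMf1]] := bd f rho lf mr nr.
have [mf2 [Mf2 hMf2]] := bd f _ lf m2 n2.
have KW : Kop theta e s n (mol uh (derive1n 2 rho)) x - ph * Kop theta e s n (mol f (derive1n 2 rho)) x =
    (c * s + s ^+ 2) * Kop theta e s n (mol uh rho) x - (c * s + s ^+ 2) * l^-1 * Kop theta e s n (mol f rho) x.
  have k1 := Kop_lin theta 1 (- ph) n x s0 h2 mu2 hMu2 mf2 hMf2.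
  have k2 := Kop_lin theta (c * s + s ^+ 2) (- ((c * s + s ^+ 2) * l^-1)) n x s0 h2 mu1 hMu1 mf1 hMf1.
  rewrite mul1r !mulNr in k1 k2; rewrite -k1 -k2; congr Kop; apply/funext => y.
  by have := Wx y; rewrite mul1r mulNr => ->; ring.
have Ku := Kg uh lu; have Kf := Kg f lf.
set ku := Kop theta e s n (mol uh rho) x in Ku KW *.
set kf := Kop theta e s n (mol f rho) x in Kf KW.
set k2 := Kop _ _ _ _ (mol uh (derive1n 2 rho)) x in Ku KW.
set k3 := Kop _ _ _ _ (mol f (derive1n 2 rho)) x in Kf KW.
(* [ph] is exactly the value for which the terms in [kf] cancel. *)
have phm : ph * m ^+ 2 = (c * s + s ^+ 2) * l^-1.
  by rewrite /ph -/m /m; field; rewrite !gt_eqF.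
have sm : c * s + s ^+ 2 = m ^+ 2 - c * m by rewrite /m; ring.
have key : c * m * (mol uh rho x) = c * m * (ph * mol f rho x + ku).
  have e1 : k2 = m ^+ 2 * ku - c * m * mol uh rho x by rewrite -Ku; ring.
  have e2 : k3 = m ^+ 2 * kf - c * m * mol f rho x by rewrite -Kf; ring.
  move: KW; rewrite e1 e2 sm => KW.
  have := phm; rewrite sm => phm'.
  have : (ph * m ^+ 2 - (m ^+ 2 - c * m) / l) * kf = 0 by rewrite phm' subrr mul0r.
  move: KW; lra.
have cm0 : c * m != 0 by rewrite gt_eqF// mulr_gt0.
exact: (mulfI cm0 key).
Qed.

End Renewal.

(** * Subordination *)

Section Grid.
Context {R : realType}.

(* The least point strictly above x of the grid of mesh 1/(k+1). *)
Definition gridup (k : nat) (x : R) : R := (Num.truncn (k.+1%:R * x)).+1%:R / k.+1%:R.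

Lemma gridup_gt k x : x < gridup k x.
Proof. by rewrite /gridup ltr_pdivlMr ?ltr0n// mulrC truncnS_gt. Qed.

Lemma gridup_le k x : 0 <= x -> gridup k x <= x + k.+1%:R^-1.
Proof.
move=> x0; have k0 : 0 < k.+1%:R :> R by rewrite ltr0n.
have kx0 : 0 <= k.+1%:R * x by rewrite mulr_ge0// ltW.
rewrite /gridup ler_pdivrMr// mulrDl mulVf ?gt_eqF// [x * _]mulrC -natr1 lerD2r.
by have /andP[] := truncn_itv kx0.
Qed.

Lemma gridup_cvg x : 0 <= x -> gridup k x @[k --> \oo] --> x.
Proof.
move=> x0; apply/cvgrPdist_le => eps eps0.
have h := @cvg_invnM R 1 ltr01.
have h' : \forall k \near \oo, (k.+1%:R * 1)^-1 <= eps :> R.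
  move/cvgr0Pnorm_le : h => /(_ eps eps0) [N _ hN]; exists N => // k /= Nk.
  by have := hN k.+1 (leqW Nk); rewrite /= ger0_norm// invr_ge0 mulr_ge0.
apply: filterS h' => k; rewrite mulr1 => hk.
have := gridup_gt k x; have := gridup_le k x0; move: hk (gridup k x) => hk g.
by move=> h1 h2; rewrite distrC ger0_norm ?subr_ge0 ?(ltW h2)// lerBlDl (le_trans h1)// lerD2l.
Qed.

Lemma gridup_ge0 k x : 0 <= gridup k x.
Proof. by rewrite divr_ge0. Qed.

End Grid.

Section Countable_selection.
Context d (Om : measurableType d) (R : realType).

Lemma measurable_select (N : Om -> nat) (X : nat -> Om -> R) :
  (forall j, measurable [set w | N w = j]) -> (forall j, measurable_fun setT (X j)) ->
  measurable_fun setT (fun w => X (N w) w).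
Proof.
move=> mN mX _ B mB; rewrite setTI.
have -> : (fun w => X (N w) w) @^-1` B = \bigcup_j ([set w | N w = j] `&` X j @^-1` B).
  apply/seteqP; split => [w /= h|w [j _ /= [<-]]//]; by exists (N w).
apply: bigcup_measurable => j _; apply: measurableI => //.
by rewrite -[X in measurable X]setTI; exact: mX.
Qed.

Lemma measurable_lt_fun (f g : Om -> R) : measurable_fun setT f -> measurable_fun setT g ->
  measurable [set w | f w < g w].
Proof.
move=> mf mg; rewrite (_ : [set w | _] = (fun w => g w - f w) @^-1` `]0, +oo[).
  rewrite -[X in measurable X]setTI; apply: measurable_funB => //; exact: measurable_itv.
by apply/seteqP; split => w /=; rewrite in_itv/= andbT subr_gt0.
Qed.

Lemma measurable_le_fun (f g : Om -> R) : measurable_fun setT f -> measurable_fun setT g ->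
  measurable [set w | f w <= g w].
Proof.
move=> mf mg; rewrite (_ : [set w | _] = ~` [set w | g w < f w]).
  by apply: measurableC; exact: measurable_lt_fun.
by apply/seteqP; split => w /=; [rewrite leNgt => /negP|move/negP; rewrite -leNgt].
Qed.

Lemma measurable_trunc_eq (tau : Om -> R) (k j : nat) : measurable_fun setT tau ->
  (forall w, 0 <= tau w) -> measurable [set w | Num.truncn (k.+1%:R * tau w) = j].
Proof.
move=> mt t0; rewrite (_ : [set w | _] =
    [set w | j%:R <= k.+1%:R * tau w] `&` [set w | k.+1%:R * tau w < j.+1%:R]).
  apply: measurableI.
    by apply: measurable_le_fun => //; exact: measurable_funM.
  by apply: measurable_lt_fun => //; exact: measurable_funM.
have e w : (Num.truncn (k.+1%:R * tau w) == j) = (j%:R <= k.+1%:R * tau w < j.+1%:R).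
  by rewrite truncn_eq// mulr_ge0.
by apply/seteqP; split => w /=; [move/eqP; rewrite e => /andP|move/andP; rewrite -e => /eqP].
Qed.

End Countable_selection.

Section Integral_of_sum.
Context d (T : measurableType d) (R : realType) (nu : {measure set T -> \bar R}).

Lemma Rint_sum (F : nat -> T -> R) n : (forall j, intg nu (F j)) ->
  intg nu (fun w => \sum_(j < n) F j w) /\
  \int[nu]_w (\sum_(j < n) F j w) = \sum_(j < n) \int[nu]_w F j w.
Proof.
move=> iF; have i0 : intg nu (fun=> 0) by exact: integrable0.
elim: n => [|n [IH1 IH2]].
  split; first by apply: eq_intg i0 => w; rewrite big_ord0.
  rewrite big_ord0 -[RHS](_ : \int[nu]_w (0 : R) = 0); last by rewrite /Rintegral integral0.
  by apply: eq_Rintegral => w _; exact: big_ord0.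
split.
  by apply: (eq_intg (f := fun w => \sum_(j < n) F j w + F n w)) => [w|]; [rewrite big_ord_recr|exact: intgD].
rewrite big_ord_recr/= -IH2 -RintegralD//; apply: eq_Rintegral => w _; exact: big_ord_recr.
Qed.

End Integral_of_sum.

Section Subordination.
Context {d : measure_display} {Om : measurableType d} {R : realType}
  {P : probability Om R}.
Local Notation mu := (@lebesgue_measure R).
Implicit Types (theta e : nat -> {RV P >-> R}) (H : R -> {RV P >-> R}) (tau Y : Om -> R).

Lemma subordinator_ge0 H alpha r w : stable_subordinator H alpha -> 0 <= r -> 0 <= H r w.
Proof. by move=> [h _ _ _] r0; have [H0 mono _] := h w; rewrite -H0; exact: mono. Qed.

(** The grid points approach x strictly from above, the side on which the paths are continuous. *)
Lemma subordinator_grid_cvg H alpha (x : R) w : stable_subordinator H alpha -> 0 <= x ->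
  H (gridup k x) w @[k --> \oo] --> H x w.
Proof.
move=> [h _ _ _] x0; have [_ _ rc] := h w.
have /cvg_at_rightP := rc x x0; apply; split; first by move=> k; exact: gridup_gt.
exact: gridup_cvg.
Qed.

(** H(tau) is a limit of functions that coincide with a fixed variable H(r) on each of countably
    many level sets of the rounded time. *)
Lemma measurable_subordinated H alpha tau : stable_subordinator H alpha ->
  measurable_fun setT tau -> (forall w, 0 <= tau w) ->
  measurable_fun setT (fun w => H (tau w) w).
Proof.
move=> hH mt t0.
apply: (@measurable_fun_cvg _ _ _ _ (fun k w => H (gridup k (tau w)) w)); last first.
  by move=> w _; exact: subordinator_grid_cvg hH (t0 w).
move=> k; apply: (measurable_select (N := fun w => Num.truncn (k.+1%:R * tau w))
  (X := fun j w => H (j.+1%:R / k.+1%:R) w)) => // j.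
exact: measurable_trunc_eq.
Qed.

Lemma expect_subordinator H (alpha l r : R) : stable_subordinator H alpha -> 0 <= r -> 0 < l ->
  \int[P]_w expR (- (l * H r w)) = expR (- (l `^ alpha * r)).
Proof.
move=> [_ _ _ h] r0 l0; have := h r l r0 l0; rewrite unlock => e.
rewrite /Rintegral; transitivity (fine (\int[P]_w (expR (- l * H r w))%:E)).
  by congr fine; apply: eq_integral => w _; rewrite mulNr.
by rewrite e/=; congr expR; ring.
Qed.

Lemma expect_indep_mul (X Y : Om -> R) (MX MY : R) : indep2 P X Y ->
  measurable_fun setT X -> measurable_fun setT Y ->
  (forall w, `|X w| <= MX) -> (forall w, `|Y w| <= MY) ->
  \int[P]_w (X w * Y w) = \int[P]_w X w * \int[P]_w Y w.
Proof.
move=> ind mX mY bX bY.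
pose Xm : {mfun Om >-> R} := HB.pack X (isMeasurableFun.Build _ _ _ _ _ mX).
pose Ym : {mfun Om >-> R} := HB.pack Y (isMeasurableFun.Build _ _ _ _ _ mY).
(* [indep_fubini] wants a function bounded on the whole plane; clipping provides one that agrees
   with the product on the values actually taken. *)
pose clip (M a : R) := Num.min M (Num.max (- M) a).
have clipE M a : `|a| <= M -> clip M a = a.
  by rewrite ler_norml => /andP[a1 a2]; rewrite /clip max_r// min_r.
have clip_le M a : 0 <= M -> `|clip M a| <= M.
  move=> M0; rewrite /clip ler_norml; apply/andP; split.
    by rewrite le_min le_max lexx/= andbT; lra.
  by rewrite ge_min lexx.
have mclip M : measurable_fun setT (clip M).
  by apply: measurable_minr => //; exact: measurable_maxr.
have w0 : Om := point.
have X0 : 0 <= MX := le_trans (normr_ge0 _) (bX w0).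
have Y0 : 0 <= MY := le_trans (normr_ge0 _) (bY w0).
pose F (z : R * R) := clip MX z.1 * clip MY z.2.
have mF : measurable_fun setT F.
  by apply: measurable_funM; apply: (measurableT_comp (mclip _));
    [exact: measurable_fst|exact: measurable_snd].
have FM z : `|F z| <= MX * MY by rewrite normrM ler_pM// clip_le.
have h := indep_fubini (X := Xm) (Y := Ym) ind mF FM.
transitivity (\int[P]_w F (Xm w, Ym w)).
  by apply: eq_Rintegral => w _; rewrite /F/= !clipE.
have iX := Rint_bounded P mX bX; have iY := Rint_bounded P mY bY.
rewrite h mulrC -RintZ//; apply: eq_Rintegral => w1 _.
rewrite mulrC -RintZ//; apply: eq_Rintegral => w2 _; by rewrite /F/= !clipE.
Qed.

Lemma indep2_comp d1 d2 d3 (T1 : measurableType d1) (T2 : measurableType d2)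
    (T3 : measurableType d3) (X : Om -> T1) (Y : Om -> T2) (g : T2 -> T3) :
  indep2 P X Y -> measurable_fun setT g -> indep2 P X (g \o Y).
Proof.
move=> ind mg A B mA mB; rewrite comp_preimage; apply: ind => //.
by rewrite -[X in measurable X]setTI; exact: mg.
Qed.

Lemma expect_indep_subordinator theta e H (c alpha l r M : R) n Y :
  iid_signs theta -> exponential_times e c -> independent_families theta e H ->
  stable_subordinator H alpha -> 0 <= r -> 0 < l ->
  measurable_fun setT (Y : g_sigma_algebraType (rects theta e n) -> R) ->
  (forall w, `|Y w| <= M) ->
  \int[P]_w (Y w * expR (- (l * H r w))) = \int[P]_w (Y w * expR (- (l `^ alpha * r))).
Proof.
move=> h1 [_ h2 _ _] h3 hH r0 l0 mY YM.
have mY' : measurable_fun setT Y := measurable_subsigma (@rects_measurable _ _ _ _ theta e n) mY.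
have ind := indep2_comp (indep_rects_subordinator h1 h2 h3 r0 mY) (measurable_expRl l).
have E01 w : `|expR (- (l * H r w))| <= 1.
  rewrite ger0_norm ?expR_ge0// expR_le1 oppr_le0 mulr_ge0// ?(ltW l0)//.
  exact: subordinator_ge0 hH r0.
have -> := expect_indep_mul ind mY' (measurableT_comp (measurable_expRl l) (measurable_funPT (H r))) YM E01.
have iY := Rint_bounded P mY' YM.
rewrite (expect_subordinator hH r0 l0) mulrC -RintZ//.
by apply: eq_Rintegral => w _; rewrite mulrC.
Qed.

(** For a time rounded to the grid the identity holds cell by cell: the indicator of a cell depends
    on the walk only, and H at a fixed time is independent of the walk. Right-continuity then passes
    to the limit. *)
Lemma expect_subordination theta e H (c alpha l M : R) n Y tau :
  iid_signs theta -> exponential_times e c -> independent_families theta e H ->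
  stable_subordinator H alpha -> 0 < l ->
  measurable_fun setT (Y : g_sigma_algebraType (rects theta e n) -> R) ->
  (forall w, `|Y w| <= M) ->
  measurable_fun setT (tau : g_sigma_algebraType (rects theta e n) -> R) ->
  (forall w, 0 <= tau w) ->
  \int[P]_w (Y w * expR (- (l * H (tau w) w))) = \int[P]_w (Y w * expR (- (l `^ alpha * tau w))).
Proof.
move=> h1 h2 h3 hH l0 mY YM mt t0.
have sub := @rects_measurable _ _ _ _ theta e n.
have mY' : measurable_fun setT Y := measurable_subsigma sub mY.
have mt' : measurable_fun setT tau := measurable_subsigma sub mt.
pose tr k w := Num.truncn (k.+1%:R * tau w).
pose ind k j w : R := (tr k w == j)%:R.
have mind k j : measurable_fun setT (ind k j : g_sigma_algebraType (rects theta e n) -> R).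
  have mA := measurable_trunc_eq k j mt t0.
  rewrite (_ : ind k j = \1_([set w | Num.truncn (k.+1%:R * tau w) = j])).
    exact: measurable_indic.
  apply/funext => w; rewrite indicE /ind; congr ((nat_of_bool _)%:R).
  by apply/eqP/idP; rewrite inE.
pose g (k j : nat) : R := j.+1%:R / k.+1%:R.
have g0 k j : 0 <= g k j by rewrite divr_ge0.
(* With mesh 1/(k+1), the first (k+1)^2 cells cover the times below k + 1: a finite sum for each k,
   and every path is eventually covered. *)
pose A k w := \sum_(j < k.+1 ^ 2) (Y w * ind k j w * expR (- (l * H (g k j) w))).
pose B k w := \sum_(j < k.+1 ^ 2) (Y w * ind k j w * expR (- (l `^ alpha * g k j))).
have l0' : 0 < l `^ alpha by exact: powR_gt0.
have sumE k w (h : nat -> R) : \sum_(j < k.+1 ^ 2) (Y w * ind k j w * h j) =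
    (tr k w < k.+1 ^ 2)%N%:R * (Y w * h (tr k w)).
  have [lt|ge] := ltnP (tr k w) (k.+1 ^ 2).
    rewrite (bigD1 (Ordinal lt))//= /ind eqxx mulr1 big1 ?addr0 ?mul1r// => j ji.
    rewrite (_ : (tr k w == j) = false) ?mulr0 ?mul0r//.
    by apply: contra_neqF ji => /eqP jt; apply: val_inj.
  rewrite mul0r big1// => j _; rewrite /ind (_ : (tr k w == j) = false) ?mulr0 ?mul0r//.
  by apply/negbTE; rewrite gtn_eqF// (leq_trans (ltn_ord j)).
have YiM k j w : `|Y w * ind k j w| <= M.
  rewrite /ind; case: eqP => _; rewrite ?mulr1 ?mulr0 ?normr0//.
  exact: le_trans (normr_ge0 _) (YM w).
have exp01 (h : R) : 0 <= h -> 0 <= expR (- h) <= 1.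
  by move=> h0; rewrite expR_ge0 expR_le1 oppr_le0.
have l0x x : 0 <= x -> 0 <= expR (- (l * x)) <= 1.
  by move=> x0; apply: exp01; rewrite mulr_ge0// (ltW l0).
have l0x' x : 0 <= x -> 0 <= expR (- (l `^ alpha * x)) <= 1.
  by move=> x0; apply: exp01; rewrite mulr_ge0// (ltW l0').
have bdM (y h : R) : `|y| <= M -> 0 <= h <= 1 -> `|y * h| <= M.
  by move=> yM /andP[h0 h1']; rewrite normrM (ger0_norm h0) -[leRHS]mulr1 ler_pM.
have mYi k j : measurable_fun setT (fun w => Y w * ind k j w).
  by apply: measurable_funM => //; apply: (measurable_subsigma sub); exact: mind.
have AB k : \int[P]_w A k w = \int[P]_w B k w.
  have h' j := Rint_bounded P (F := fun w => Y w * ind k j w * expR (- (l * H (g k j) w))) (M := M).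
  have [_ ->] := Rint_sum (k.+1 ^ 2) (F := fun j w => Y w * ind k j w * expR (- (l * H (g k j) w)))
    (fun j => h' j (measurable_funM (mYi k j) (measurableT_comp (measurable_expRl l) (measurable_funPT (H (g k j)))))
     (fun w => bdM _ _ (YiM k j w) (l0x _ (subordinator_ge0 w hH (g0 k j))))).
  have h'' j := Rint_bounded P (F := fun w => Y w * ind k j w * expR (- (l `^ alpha * g k j))) (M := M).
  have [_ ->] := Rint_sum (k.+1 ^ 2) (F := fun j w => Y w * ind k j w * expR (- (l `^ alpha * g k j)))
    (fun j => h'' j (measurable_funM (mYi k j) (measurable_cst _))
     (fun w => bdM _ _ (YiM k j w) (l0x' _ (g0 k j)))).
  apply: eq_bigr => j _; apply: (expect_indep_subordinator (n := n) (M := M) h1 h2 h3 hH) => //.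
  by apply: measurable_funM => //; exact: mind.
have tr_lt w : \forall k \near \oo, (tr k w < k.+1 ^ 2)%N.
  have := nbhs_infty_gtr (tau w); apply: filterS => k kt.
  have k0 : 0 < k.+1%:R :> R by rewrite ltr0n.
  rewrite -(ltr_nat R); apply: (@le_lt_trans _ _ (k.+1%:R * tau w)).
    by have /andP[] := truncn_itv (mulr_ge0 (ltW k0) (t0 w)).
  by rewrite natrX expr2 ltr_pM2l// (lt_trans kt)// ltr_nat.
have lim (h : R -> R) w (x : nat -> R) (y : R) : continuous h ->
    x k @[k --> \oo] --> y ->
    (tr k w < k.+1 ^ 2)%N%:R * (Y w * h (x k)) @[k --> \oo] --> Y w * h y.
  move=> ch xy; apply: (@cvg_trans _ ((fun k => Y w * h (x k)) @ \oo)).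
    by apply: near_eq_cvg; apply: filterS (tr_lt w) => k ->; rewrite mul1r.
  by apply: cvgM; [exact: cvg_cst|exact: (continuous_cvg _ (ch y) xy)].
have cexp a : continuous (fun x : R => expR (- (a * x))).
  move=> x; apply: (continuous_comp (f := fun x => - (a * x))); last exact: continuous_expR.
  by apply: cvgN; apply: cvgM; [exact: cvg_cst|exact: cvg_id].
have iM := finite_measure_integrable_cst P M measurableT.
have nb b (y : R) : `|y| <= M -> `|(nat_of_bool b)%:R * y| <= M.
  by case: b; rewrite ?mul1r ?mul0r ?normr0// => h; exact: le_trans h.
have AE k w : A k w = (tr k w < k.+1 ^ 2)%N%:R * (Y w * expR (- (l * H (gridup k (tau w)) w))).
  exact: (sumE k w (fun j => expR (- (l * H (g k j) w)))).
have BE k w : B k w = (tr k w < k.+1 ^ 2)%N%:R * (Y w * expR (- (l `^ alpha * gridup k (tau w)))).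
  exact: (sumE k w (fun j => expR (- (l `^ alpha * g k j)))).
have cA : (\int[P]_w A k w) @[k --> \oo] --> \int[P]_w (Y w * expR (- (l * H (tau w) w))).
  apply: (@Rint_dominated_cvg _ _ _ P _ _ (fun=> M)) => //.
  - move=> k; apply: measurable_sum => j; apply: measurable_funM => //.
    exact: (measurableT_comp (measurable_expRl l)).
  - apply: measurable_funM => //; apply: (measurableT_comp (measurable_expRl l)).
    exact: (measurable_subordinated hH).
  - apply: aeW => w; under eq_fun do rewrite AE.
    exact: (lim _ w (fun k => H (gridup k (tau w)) w) _ (cexp l) (subordinator_grid_cvg hH (t0 w))).
  - move=> k w; rewrite AE; apply: nb; apply: bdM => //; apply: l0x.
    exact: (subordinator_ge0 w hH (gridup_ge0 _ _)).
have cB : (\int[P]_w B k w) @[k --> \oo] --> \int[P]_w (Y w * expR (- (l `^ alpha * tau w))).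
  apply: (@Rint_dominated_cvg _ _ _ P _ _ (fun=> M)) => //.
  - by move=> k; apply: measurable_sum => j; exact: measurable_funM.
  - by apply: measurable_funM => //; exact: (measurableT_comp (measurable_expRl _)).
  - apply: aeW => w; under eq_fun do rewrite BE.
    exact: (lim _ w (fun k => gridup k (tau w)) _ (cexp (l `^ alpha)) (gridup_cvg (t0 w))).
  - move=> k w; rewrite BE; apply: nb; apply: bdM => //; apply: l0x'; exact: gridup_ge0.
move: cA; rewrite (_ : (fun k => \int[P]_w A k w) = (fun k => \int[P]_w B k w)); last exact/funext.
by move=> cA; rewrite -(cvg_lim (@Rhausdorff R) cA) -(cvg_lim (@Rhausdorff R) cB).
Qed.

End Subordination.

(** * Integrals without measurability, and almost sure properties of the paths *)

Section Integral_ae.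
Import HBNNSimple.
Local Open Scope ereal_scope.
Context d (T : measurableType d) (R : realType) (mu : {measure set T -> \bar R}).

(* No measurability is assumed: the integral of a nonnegative function is a supremum over simple
   functions, and these may be cut off on the null set. *)
Lemma ge0_le_integral_ae (f g : T -> \bar R) : (forall x, 0 <= f x) -> (forall x, 0 <= g x) ->
  {ae mu, forall x, f x = g x} -> \int[mu]_x f x <= \int[mu]_x g x.
Proof.
move=> f0 g0 [N [mN N0 hN]].
rewrite (ge0_integralTE _ f0) (ge0_integralTE _ g0); apply: ge_ereal_sup => /= _ [h /= hf <-].
have mD : measurable (setT `\` N) by exact: measurableD.
apply: ereal_sup_ubound; exists (proj_nnsfun h mD).
  move=> x /=; rewrite mindicE; case: (boolP (x \in _)) => [|_]; last by rewrite mulr0.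
  rewrite inE => -[_ xN]; rewrite mulr1 (le_trans (hf x))// le_eqVlt; apply/orP; left; apply/eqP.
  by apply: contrapT => ne; apply: xN; exact: hN.
rewrite -(mrestrict h mD) -(integral_nnsfun mu mD) -(@ge0_negligible_integral _ _ _ mu)//.
- by rewrite integral_nnsfun// patch_setT.
- exact/measurable_EFinP.
- by move=> x _; rewrite lee_fin.
Qed.

(** Serves the expectation in the final statement: [random_flight] is defined through an infimum and
    a choice, and measurability is shown for an almost surely equal version. *)
Lemma integral_ae (f g : T -> \bar R) : {ae mu, forall x, f x = g x} ->
  \int[mu]_x f x = \int[mu]_x g x.
Proof.
have sym : forall f g : T -> \bar R, (forall x, 0 <= f x) -> (forall x, 0 <= g x) ->
    {ae mu, forall x, f x = g x} -> \int[mu]_x f x = \int[mu]_x g x.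
  move=> {}f {}g f0 g0 fg; apply/eqP; rewrite eq_le !ge0_le_integral_ae//.
  by apply: filterS fg => x ->.
move=> fg; rewrite integralE [RHS]integralE; congr (_ - _); apply: sym => //.
- by apply: filterS fg => x e; rewrite !funeposE e.
- by apply: filterS fg => x e; rewrite !funenegE e.
Qed.

End Integral_ae.

Section Good_paths.
Context {d : measure_display} {Om : measurableType d} {R : realType}
  {P : probability Om R}.
Local Notation mu := (@lebesgue_measure R).
Implicit Types (theta e : nat -> {RV P >-> R}) (H : R -> {RV P >-> R}) (tau Y : Om -> R).

(** Markov's inequality on the event that all D_j stay above 1/(m+1): its probability is at most
    (m+1) times each mean, hence 0. No subsequence has to be extracted. *)
Lemma ae_small (D : nat -> Om -> R) : (forall j, measurable_fun setT (D j)) ->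
  (forall j w, 0 <= D j w <= 1) -> (\int[P]_w D j w) @[j --> \oo] --> (0 : R) ->
  {ae P, forall w, forall eps, 0 < eps -> exists j, D j w < eps}.
Proof.
move=> mD D01 D0.
pose b m w := `[< forall j, m.+1%:R^-1 <= D j w >].
have mA m : measurable [set w | b m w].
  rewrite (_ : [set w | _] = \bigcap_j [set w | m.+1%:R^-1 <= D j w]).
    by apply: bigcapT_measurable => j; apply: measurable_le_fun.
  by apply/seteqP; split => w /=; [move/asboolP => h j _; exact: h|move=> h; apply/asboolP => j; exact: h].
have bound m j : m.+1%:R^-1 * fine (P [set w | b m w]) <= \int[P]_w D j w.
  have mb : measurable_fun setT (fun w => (b m w)%:R : R) by exact: measurable_ind.
  have ib : intg P (fun w => (b m w)%:R).
    by apply: (@Rint_bounded _ _ _ _ _ 1) => // w; case: (b m w); rewrite ?normr1 ?normr0.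
  rewrite -(Rint_prob P (mA m)) -RintZ//; apply: le_Rintegral => //.
  - exact: intgZ.
  - by apply: (@Rint_bounded _ _ _ _ _ 1) => // w; have /andP[? ?] := D01 j w; rewrite ger0_norm.
  - move=> w _; case: (boolP (b m w)) => [/asboolP/(_ j)|_]; first by rewrite mulr1.
    by rewrite mulr0; have /andP[] := D01 j w.
have P0 m : P [set w | b m w] = 0%E.
  have f0 : 0 <= fine (P [set w | b m w]) by exact: fine_ge0.
  have : m.+1%:R^-1 * fine (P [set w | b m w]) <= 0.
    rewrite -(cvg_lim (@Rhausdorff R) D0); apply: limr_ge; first by apply/cvg_ex; exists 0.
    by near=> j; exact: bound.
  rewrite pmulr_rle0 ?invr_gt0// => f1.
  by rewrite -(fineK (fin_num_measure _ _ (mA m))); congr EFin; apply/eqP; rewrite eq_le f0 f1.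
have all m : {ae P, forall w, ~~ b m w}.
  by exists [set w | b m w]; split => // w /= /negP; rewrite negbK.
have hall := ae_foralln all; apply: (aeS hall) => w hw eps eps0.
have [m hm] : exists m, m.+1%:R^-1 < eps.
  exists (Num.truncn eps^-1); rewrite invf_plt ?posrE//; exact: truncnS_gt.
have /asboolPn/existsNP[j /negP] := hw m; rewrite -ltNge => hj.
by exists j; exact: lt_trans hm.
Unshelve. all: end_near. Qed.

(** The mean of exp(-H) at time T_n is (c/(c+1))^n, which tends to 0. *)
Lemma ae_unbounded theta e H (c alpha : R) : 0 < c ->
  iid_signs theta -> exponential_times e c -> independent_families theta e H ->
  stable_subordinator H alpha ->
  {ae P, forall w, forall t, exists n, t < H (arr e n w) w}.
Proof.
move=> c0 h1 h2 h3 hH.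
have E n : \int[P]_w expR (- (1 * H (arr e n w) w)) = (c / (c + 1)) ^+ n.
  rewrite -(arr_laplace n c0 ltr01 h1 h2 h3).
  have mr := measurable_arr_rects (theta := theta) (e := e) (leqnn n).
  have n1 (w : Om) : `|1 : R| <= 1 by rewrite normr1.
  have := expect_subordination (n := n) (Y := fun=> 1) (M := 1) (l := 1) h1 h2 h3 hH ltr01
    (measurable_cst _) n1 mr (fun w => arr_ge0 n w h2).
  rewrite powR1; under eq_Rintegral do rewrite mul1r.
  by under [RHS]eq_Rintegral do rewrite mul1r.
have mH n : measurable_fun setT (fun w => H (arr e n w) w).
  by apply: (measurable_subordinated hH) => [|w]; [exact: measurable_arr|exact: arr_ge0 h2].
have := @ae_small (fun n w => expR (- (1 * H (arr e n w) w))).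
move=> /(_ (fun n => measurableT_comp (measurable_expRl 1) (mH n))) h.
have D01 n w : 0 <= expR (- (1 * H (arr e n w) w)) <= 1.
  rewrite expR_ge0 expR_le1 oppr_le0 mul1r; apply: subordinator_ge0 hH _; exact: arr_ge0 h2.
have hh := h D01 _; apply: (aeS (hh _)) => [|w hw t].
  under eq_fun do rewrite E.
  apply: cvg_expr; rewrite ger0_norm ?divr_ge0 ?(ltW c0) ?addr_ge0 ?(ltW c0)//.
  by rewrite ltr_pdivrMr ?mul1r ?ltrDl// addr_gt0.
have [n hn] := hw _ (expR_gt0 (- t)); exists n.
by move: hn; rewrite ltr_expR ltrN2 mul1r.
Qed.

(** The means of exp(-H) at k T_n and at T_n are (c/(c+k))^n and (c/(c+1))^n, and the first tends to
    the second as k increases to 1. The difference of the variables is nonnegative by monotonicity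
    of H, so [ae_small] applies. *)
Lemma ae_no_jump theta e H (c alpha : R) : 0 < c ->
  iid_signs theta -> exponential_times e c -> independent_families theta e H ->
  stable_subordinator H alpha ->
  {ae P, forall w, forall n t, 0 <= t -> t < H (arr e n w) w ->
     exists2 s, 0 <= s < arr e n w & t < H s w}.
Proof.
move=> c0 h1 h2 h3 hH; apply: ae_foralln => n.
(* Indexed from 2 so that every factor is positive. *)
pose kap (j : nat) : R := 1 - j.+2%:R^-1.
have k0 j : 0 < kap j by rewrite subr_gt0 invf_lt1// ltr1n.
have k1 j : kap j < 1 by rewrite /kap ltrBlDr ltrDl invr_gt0.
have a0 w : 0 <= arr e n w := arr_ge0 n w h2.
have mr := measurable_arr_rects (theta := theta) (e := e) (leqnn n).
have n1 (w : Om) : `|1 : R| <= 1 by rewrite normr1.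
have mk (k : R) : measurable_fun setT ((fun w => k * arr e n w) : g_sigma_algebraType (rects theta e n) -> R).
  exact: measurable_funM.
have mH (k : R) : 0 <= k -> measurable_fun setT (fun w => H (k * arr e n w) w).
  move=> kk; apply: (measurable_subordinated hH) => [|w]; last by rewrite mulr_ge0.
  by apply: measurable_funM => //; exact: measurable_arr.
have E (k : R) : 0 < k -> \int[P]_w expR (- (1 * H (k * arr e n w) w)) = (c / (c + k)) ^+ n.
  move=> kk; rewrite -(arr_laplace n c0 kk h1 h2 h3).
  have := expect_subordination (n := n) (Y := fun=> 1) (M := 1) (l := 1) h1 h2 h3 hH ltr01
    (measurable_cst _) n1 (mk k) (fun w => mulr_ge0 (ltW kk) (a0 w)).
  rewrite powR1; under eq_Rintegral do rewrite mul1r.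
  by under [RHS]eq_Rintegral do rewrite mul1r mul1r.
pose X (k : R) w := expR (- (1 * H (k * arr e n w) w)).
have X01 k w : 0 <= k -> 0 <= X k w <= 1.
  move=> kk; rewrite expR_ge0 expR_le1 oppr_le0 mul1r; apply: subordinator_ge0 hH _.
  by rewrite mulr_ge0.
have mX (k : R) : 0 <= k -> measurable_fun setT (X k).
  by move=> kk; exact: (measurableT_comp (measurable_expRl 1) (mH k kk)).
have iX (k : R) : 0 <= k -> intg P (X k).
  move=> kk; apply: (@Rint_bounded _ _ _ _ _ 1); first exact: mX.
  by move=> w; have /andP[? ?] := X01 k w kk; rewrite ger0_norm.
have mono k w : 0 <= k -> k <= 1 -> X 1 w <= X k w.
  move=> kk kk1; rewrite ler_expR lerN2 !mul1r; have [h _ _ _] := hH.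
  have [_ m _] := h w; apply: m; first by rewrite mulr_ge0.
  by rewrite ler_piMl.
have := @ae_small (fun j w => X (kap j) w - X 1 w).
move=> /(_ (fun j => measurable_funB (mX _ (ltW (k0 j))) (mX _ ler01))) h.
have D01 j w : 0 <= X (kap j) w - X 1 w <= 1.
  have := mono _ w (ltW (k0 j)) (ltW (k1 j)); have := X01 1 w ler01.
  have := X01 _ w (ltW (k0 j)); rewrite subr_ge0 => /andP[? ?] /andP[? ?] ->/=.
  by rewrite lerBlDr (le_trans (y := 1))// lerDl.
have hh := h D01 _; apply: (aeS (hh _)) => [|w hw t t0 tH].
  have -> : (fun j => \int[P]_w (X (kap j) w - X 1 w)) =
      (fun j => (c / (c + kap j)) ^+ n - (c / (c + 1)) ^+ n).
    apply/funext => j; rewrite RintegralB//; [|exact: iX (ltW (k0 j))|exact: iX ler01].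
    by rewrite (E _ (k0 j)) (E _ ltr01).
  rewrite -(subrr ((c / (c + 1)) ^+ n)); apply: cvgB; last exact: cvg_cst.
  apply: (continuous_cvg _ (@exprn_continuous R n _)).
  apply: cvgM; first exact: cvg_cst.
  apply: cvgV; first by rewrite gt_eqF// addr_gt0.
  apply: cvgD; first exact: cvg_cst.
  rewrite -[X in _ --> X]subr0; apply: cvgB; first exact: cvg_cst.
  by have := @cvg_harmonic R; rewrite -(@cvg_shiftS R^o (@harmonic R)).
(* If T_n were 0 there would be no earlier time; this is excluded because H starts at 0 <= t. *)
have an0 : 0 < arr e n w.
  rewrite lt_neqAle a0 andbT; apply/eqP => an; move: tH; rewrite -an.
  by have [h' _ _ _] := hH; have [-> _ _] := h' w; rewrite ltNge t0.
have [|j hj] := hw (expR (- t) - X 1 w).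
  by rewrite subr_gt0 /X ltr_expR ltrN2 !mul1r.
exists (kap j * arr e n w).
  by rewrite mulr_ge0 ?(ltW (k0 j))//= gtr_pMl.
by move: hj; rewrite ltrD2r /X ltr_expR ltrN2 mul1r.
Qed.

(* The number of jumps of the time-changed counting process up to t, read off the paths; the
   default 0 is used when no such n exists. *)
Definition cnt e H (t : R) (w : Om) : nat :=
  xget 0%N [set n | H (arr e n w) w <= t < H (arr e n.+1 w) w].

Lemma arr_mono e (c : R) m n w : exponential_times e c -> (m <= n)%N -> arr e m w <= arr e n w.
Proof.
move=> [_ _ epos _]; elim: n => [|n IH]; first by rewrite leqn0 => /eqP ->.
rewrite leq_eqVlt => /orP[/eqP->//|mn]; apply: le_trans (IH mn) _.
by rewrite [leRHS]/arr big_ord_recr/= lerDl.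
Qed.

Lemma Harr_mono e H (c alpha : R) m n w : exponential_times e c -> stable_subordinator H alpha ->
  (m <= n)%N -> H (arr e m w) w <= H (arr e n w) w.
Proof.
move=> he [h _ _ _] mn; have [_ mono _] := h w; apply: mono; first exact: arr_ge0 he.
exact: arr_mono he mn.
Qed.

Lemma Harr0 e H (alpha : R) w : stable_subordinator H alpha -> H (arr e 0 w) w = 0.
Proof. by move=> [h _ _ _]; have [h0 _ _] := h w; rewrite /arr big_ord0. Qed.

Lemma cntP e H (c alpha t : R) n w : exponential_times e c -> stable_subordinator H alpha ->
  H (arr e n w) w <= t < H (arr e n.+1 w) w -> cnt e H t w = n.
Proof.
move=> he hH nt; apply: xget_unique => // m /= mt.
move: nt mt => /andP[n1 n2] /andP[m1 m2].
have key i j : H (arr e i w) w <= t -> t < H (arr e j.+1 w) w -> (i <= j)%N.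
  by move=> i1 j2; rewrite leqNgt; apply/negP => ji;
    have := le_lt_trans (le_trans (Harr_mono w he hH ji) i1) j2; rewrite ltxx.
by apply/eqP; rewrite eqn_leq !key.
Qed.

Lemma cnt_lt e H (c alpha t : R) N w : exponential_times e c -> stable_subordinator H alpha ->
  0 <= t -> t < H (arr e N w) w ->
  (cnt e H t w < N)%N /\ H (arr e (cnt e H t w) w) w <= t < H (arr e (cnt e H t w).+1 w) w.
Proof.
move=> he hH t0; elim: N => [|N IH] tN; first by move: tN; rewrite (Harr0 _ _ hH) ltNge t0.
have [lt|ge] := ltP t (H (arr e N w) w).
  by have [h1 h2] := IH lt; split => //; exact: leqW.
have nt : H (arr e N w) w <= t < H (arr e N.+1 w) w by rewrite ge.
by rewrite (cntP he hH nt).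
Qed.

(** For n >= 1 the event is the defining double inequality. The value 0 also collects the default,
    so it is treated as the complement of all the others. *)
Lemma measurable_cnt_pair e H (c alpha : R) n : exponential_times e c -> stable_subordinator H alpha ->
  measurable [set z : R * Om | cnt e H z.1 z.2 = n].
Proof.
move=> he hH.
have mz k : measurable_fun setT (fun z : R * Om => H (arr e k z.2) z.2).
  apply: (measurableT_comp (f := fun w => H (arr e k w) w)); last exact: measurable_snd.
  by apply: (measurable_subordinated hH) => [|w]; [exact: measurable_arr|exact: arr_ge0 he].
have mA k : measurable [set z : R * Om | H (arr e k z.2) z.2 <= z.1 < H (arr e k.+1 z.2) z.2].
  rewrite (_ : [set z | _] = [set z : R * Om | H (arr e k z.2) z.2 <= z.1] `&`
      [set z : R * Om | z.1 < H (arr e k.+1 z.2) z.2]).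
    apply: measurableI; first by apply: measurable_le_fun => //; exact: measurable_fst.
    by apply: measurable_lt_fun => //; exact: measurable_fst.
  by apply/seteqP; split => z /= => [/andP|/andP].
have eqn k : (0 < k)%N -> [set z : R * Om | cnt e H z.1 z.2 = k] =
    [set z : R * Om | H (arr e k z.2) z.2 <= z.1 < H (arr e k.+1 z.2) z.2].
  move=> k0; apply/seteqP; split => [[t w]/= h|[t w]/=]; last exact: cntP he hH.
  have : exists n, H (arr e n w) w <= t < H (arr e n.+1 w) w.
    apply: contrapT => hN; move: h; rewrite /cnt xgetPN; first by move=> k1; rewrite -k1 in k0.
    by move=> m /= hm; apply: hN; exists m.
  by move=> /(xgetPex 0%N); rewrite -/(cnt e H t w) h.
case: n => [|n]; last by rewrite eqn.
rewrite (_ : [set z | _] = ~` \bigcup_k [set z : R * Om | cnt e H z.1 z.2 = k.+1]).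
  by apply: measurableC; apply: bigcupT_measurable => k; rewrite eqn.
apply/seteqP; split => z /=; first by move=> h [k _ /=]; rewrite h.
by case ek : (cnt e H z.1 z.2) => [//|k] h; exfalso; apply: h; exists k.
Qed.

Lemma arrivalE e (c : R) n w : exponential_times e c -> arrival e n w = arr e n w.
Proof. by move=> [e0 _ _ _]; rewrite /arrival big_ord_recl e0 add0r. Qed.

(** T_n <= L_t iff H(T_n) <= t: from right to left this is monotonicity, while a jump of H at T_n
    across the level t would break the other direction. The largest n with T_n <= L_t is then the
    one selected by [cnt]. *)
Lemma counting_of_path theta e H (c alpha t : R) w :
  exponential_times e c -> stable_subordinator H alpha ->
  (forall t, exists n, t < H (arr e n w) w) ->
  (forall n t, 0 <= t -> t < H (arr e n w) w -> exists2 s, 0 <= s < arr e n w & t < H s w) ->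
  0 <= t -> random_flight theta e H t w = walk theta e (cnt e H t w) w.
Proof.
move=> he hH unb nj t0.
pose E := [set s | 0 <= s /\ t < H s w].
have E0 : E !=set0.
  by have [n hn] := unb t; exists (arr e n w); split => //; exact: arr_ge0 he.
have lE : has_lbound E by exists 0 => s [].
have iff n : (arr e n w <= inf E) = (H (arr e n w) w <= t).
  apply/idP/idP => h.
    rewrite leNgt; apply/negP => tn; have [s /andP[s0 sn] ts] := nj n t t0 tn.
    have := le_lt_trans (le_trans h (ge_inf lE (conj s0 ts))) sn; by rewrite ltxx.
  apply: lb_le_inf => // s [s0 ts]; rewrite leNgt; apply/negP => sn.
  have [hh _ _ _] := hH; have [_ mono _] := hh w.
  by have := lt_le_trans ts (le_trans (mono _ _ s0 (ltW sn)) h); rewrite ltxx.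
have [N hN] := unb t; have [_ /andP[c1 c2]] := cnt_lt he hH t0 hN.
have -> : random_flight theta e H t w = walk theta e (subordinated_counting e H t w) w.
  by have [e0 _ _ _] := he; rewrite /random_flight big_ord_recl e0 mulr0 add0r.
congr (walk theta e _ w); apply: xget_unique => /=.
  split; first by rewrite (arrivalE _ _ he) iff.
  move=> m; rewrite (arrivalE _ _ he) iff => m1; rewrite leqNgt; apply/negP => lt.
  by have := lt_le_trans c2 (le_trans (Harr_mono w he hH lt) m1); rewrite ltxx.
move=> m [m1 m2]; apply/eqP; rewrite eqn_leq m2 ?(arrivalE _ _ he) ?iff// andbT.
rewrite leqNgt; apply/negP => lt; move: m1; rewrite (arrivalE _ _ he) iff => m1.
by have := lt_le_trans c2 (le_trans (Harr_mono w he hH lt) m1); rewrite ltxx.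
Qed.

Lemma ae_random_flight theta e H (c alpha : R) : 0 < c ->
  iid_signs theta -> exponential_times e c -> independent_families theta e H ->
  stable_subordinator H alpha ->
  {ae P, forall w, forall t, 0 <= t -> random_flight theta e H t w = walk theta e (cnt e H t w) w}.
Proof.
move=> c0 h1 h2 h3 hH.
have u := ae_unbounded c0 h1 h2 h3 hH; have v := ae_no_jump c0 h1 h2 h3 hH.
apply: (aeS2 u v) => w uw vw t t0; exact: (counting_of_path theta h2 hH uw vw t0).
Qed.

Lemma measurable_walk_cnt theta e H (c alpha : R) : exponential_times e c ->
  stable_subordinator H alpha ->
  measurable_fun setT (fun z : R * Om => walk theta e (cnt e H z.1 z.2) z.2).
Proof.
move=> he hH; apply: (measurable_select (N := fun z : R * Om => cnt e H z.1 z.2)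
  (X := fun n (z : R * Om) => walk theta e n z.2)) => n.
  exact: measurable_cnt_pair he hH.
by apply: (measurableT_comp (f := walk theta e n)); [exact: measurable_walk|exact: measurable_snd].
Qed.

End Good_paths.

Section Tensor.
Context d1 d2 (T1 : measurableType d1) (T2 : measurableType d2) (R : realType).
Variables (m1 : {sigma_finite_measure set T1 -> \bar R})
  (m2 : {sigma_finite_measure set T2 -> \bar R}).

Lemma intg_tensor (a : T1 -> R) (b : T2 -> R) : intg m1 a -> intg m2 b ->
  intg (m1 \x m2)%E (fun z : T1 * T2 => a z.1 * b z.2).
Proof.
move=> ia ib; have [ma fa] := (intgP _ _).1 ia; have [mb fb] := (intgP _ _).1 ib.
apply: prod_intgP.
  apply: measurable_funM; first by apply: (measurableT_comp ma); exact: measurable_fst.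
  by apply: (measurableT_comp mb); exact: measurable_snd.
under eq_integral => t _ /=.
  under eq_integral do rewrite normrM EFinM.
  rewrite ge0_integralZl//; last by apply/measurable_EFinP; exact: measurableT_comp.
  over.
rewrite ge0_integralZr//; last 2 first.
- by apply/measurable_EFinP; exact: measurableT_comp.
- by apply: integral_ge0 => y _; rewrite lee_fin.
rewrite lte_mul_pinfty//; first by apply: integral_ge0 => y _; rewrite lee_fin.
by rewrite ge0_fin_numE//; apply: integral_ge0 => y _; rewrite lee_fin.
Qed.

End Tensor.

(** * The random flight *)

Section Flight.
Context {d : measure_display} {Om : measurableType d} {R : realType}
  {P : probability Om R}.
Local Notation mu := (@lebesgue_measure R).
Implicit Types (theta e : nat -> {RV P >-> R}) (H : R -> {RV P >-> R}) (tau Y : Om -> R) (F : R -> R).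

Lemma laplace_tail_ind (l a : R) : 0 < l -> 0 <= a ->
  \int[mu]_t (ew l (fk 1) t * (a <= t)%R%:R) = l^-1 * expR (- (l * a)).
Proof.
move=> l0 a0; have mew : measurable_fun setT (ew l (fk 1) : R -> R).
  by apply: measurable_ew; exact: measurable_fk.
have -> : l^-1 * expR (- (l * a)) = \int[mu]_t (expR (- (l * a)) * ew l (fk 1) (t + (- a))).
  rewrite RintZ; first by rewrite Rint_shift// laplace_fk1// mulrC.
  exact: intg_shift (intg_fk1 l0).
apply: Rint_ae.
- apply: measurable_funM => //.
  by apply: measurable_ind; exact: measurable_le_fun.
- apply: measurable_funM => //; apply: (measurableT_comp (f := ew l (fk 1))) => //.
  exact: measurable_funD.
have h := @ae_neq R a; apply: (aeS h) => t ta.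
rewrite !ew1E subr_gt0.
have -> : (a < t) = (a <= t) by rewrite lt_neqAle eq_sym ta.
have [at'|] := leP a t; last by rewrite !mulr0 mul0r mulr0.
have tgt : 0 < t by apply: le_lt_trans a0 _; rewrite lt_neqAle eq_sym ta.
by rewrite tgt mulr1 !mul1r -expRD; congr expR; ring.
Qed.

(** Fubini reduces the transform of E[Y; tau <= t] to the integral of e^{-lt} over t >= tau, which
    is e^{-l tau}/l. *)
Lemma laplace_after l (M : R) Y tau : 0 < l -> measurable_fun setT Y -> (forall w, `|Y w| <= M) ->
  measurable_fun setT tau -> (forall w, 0 <= tau w) ->
  intg mu (fun t => ew l (fk 1) t * \int[P]_w (Y w * (tau w <= t)%R%:R)) /\
  \int[mu]_t (ew l (fk 1) t * \int[P]_w (Y w * (tau w <= t)%R%:R)) =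
    l^-1 * \int[P]_w (Y w * expR (- (l * tau w))).
Proof.
move=> l0 mY YM mt t0.
pose b (z : R * Om) : R := (tau z.2 <= z.1)%R%:R.
have mb : measurable_fun setT b.
  apply: measurable_ind; apply: measurable_le_fun; last exact: measurable_fst.
  by apply: (measurableT_comp mt); exact: measurable_snd.
have iew := intg_fk1 l0.
have iY := Rint_bounded P mY YM.
have b1 z : `|b z| <= 1 by rewrite /b; case: (tau z.2 <= z.1)%R; rewrite ?normr1 ?normr0.
pose G (z : R * Om) := ew l (fk 1) z.1 * (Y z.2 * b z).
have iG : intg (mu \x P)%E G.
  have h := intgMbd (intg_tensor iew iY) mb (fun z _ => b1 z).
  by apply: eq_intg h => z; rewrite /G mulrA.
have iYb t : intg P (fun w => Y w * (tau w <= t)%R%:R).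
  have mbt : measurable_fun setT (fun w => b (t, w)) by apply: measurableT_comp => //; exact: measurable_pair1.
  by apply: (@intgMbd _ _ _ _ Y (fun w => b (t, w)) 1 iY mbt) => w _; exact: b1.
have e1 t : \int[P]_w G (t, w) = ew l (fk 1) t * \int[P]_w (Y w * (tau w <= t)%R%:R).
  by rewrite -RintZ.
split; first by apply: eq_intg (intg_Rint2 iG) => t; rewrite e1.
under eq_Rintegral do rewrite -e1.
rewrite (Rint_fubini iG) -RintZ; last first.
  apply: (@intgMbd _ _ _ _ Y (fun w => expR (- (l * tau w))) 1 iY).
    exact: (measurableT_comp (measurable_expRl l)).
  by move=> w _; rewrite ger0_norm ?expR_ge0// expR_le1 oppr_le0 mulr_ge0// (ltW l0).
apply: eq_Rintegral => w _.
transitivity (\int[mu]_t (Y w * (ew l (fk 1) t * (tau w <= t)%R%:R))).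
  by apply: eq_Rintegral => t _; rewrite /G/b/=; ring.
rewrite RintZ; first by rewrite laplace_tail_ind//; ring.
have mbw : measurable_fun setT (fun t : R => b (t, w)).
  by apply: measurableT_comp => //; exact: measurable_pair2.
exact: (intgMbd iew mbw (fun t _ => b1 (t, w))).
Qed.

(** Compared with [Qop] the killing runs one step further; the extra waiting time is independent of
    the past and contributes c/(c + s). *)
Lemma expect_next theta e H (c s B x : R) n F : 0 < c -> 0 < s ->
  iid_signs theta -> exponential_times e c -> independent_families theta e H ->
  measurable_fun setT F -> (forall y, `|F y| <= B) ->
  \int[P]_w (F (x + walk theta e n w) * expR (- (s * arr e n.+1 w))) =
    c / (c + s) * Qop theta e s n F x.
Proof.
move=> c0 s0 h1 /[dup] he [e0 h2 epos elaw] h3 mF FB.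
pose X w := F (x + walk theta e n w) * expR (- (s * arr e n w)).
have mX : measurable_fun setT (X : g_sigma_algebraType (rects theta e n) -> R).
  apply: measurable_funM.
    by apply: (measurableT_comp mF); apply: measurable_funD => //; exact: measurable_walk_rects.
  by apply: (measurableT_comp (measurable_expRl s)); exact: measurable_arr_rects.
have ind := indep2_comp (g := fun z : R * R => expR (- (s * z.2))) (indep_rects_next h1 h2 h3 mX)
  (measurableT_comp (measurable_expRl s) (measurable_snd : measurable_fun setT (@snd R R))).
have bX w : `|X w| <= B.
  rewrite normrM -[leRHS]mulr1 ler_pM// ger0_norm ?expR_ge0// expR_le1.
  by rewrite oppr_le0 mulr_ge0// ?(ltW s0)// (arr_ge0 _ _ he).
have bE w : `|((fun z : R * R => expR (- (s * z.2))) \o (fun w => (theta n.+1 w, e n.+1 w))) w| <= 1.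
  by rewrite /= ger0_norm ?expR_ge0// expR_le1 oppr_le0 mulr_ge0// (ltW s0).
have mE : measurable_fun setT ((fun z : R * R => expR (- (s * z.2))) \o (fun w => (theta n.+1 w, e n.+1 w))).
  exact: (measurableT_comp (measurable_expRl s)).
have := expect_indep_mul ind (measurable_subsigma (@rects_measurable _ _ _ _ theta e n) mX) mE bX bE.
rewrite /= (exp_laplace c0 s0)//; last by move=> t t0; exact: elaw.
move=> h; rewrite mulrC -/(Qop theta e s n F x) in h; rewrite -h.
apply: eq_Rintegral => w _; rewrite /X -mulrA -expRD; congr (_ * expR _).
by rewrite /arr big_ord_recr/=; ring.
Qed.

(** Taken along [cnt], which is jointly measurable in time and path, in place of the counting
    process of the statement; the two agree almost surely. *)
Definition flight_mean theta e H F (t x : R) : R :=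
  \int[P]_w F (x + walk theta e (cnt e H t w) w).

Lemma measurable_flight_path theta e H (c alpha t : R) : exponential_times e c ->
  stable_subordinator H alpha ->
  measurable_fun setT (fun w => walk theta e (cnt e H t w) w).
Proof.
move=> he hH; have m := measurable_walk_cnt theta he hH.
exact: (measurableT_comp m (measurable_pair1 t)).
Qed.

Lemma measurable_flight_mean theta e H (c alpha x : R) F : exponential_times e c ->
  stable_subordinator H alpha -> measurable_fun setT F ->
  measurable_fun setT (fun t => flight_mean theta e H F t x).
Proof.
move=> he hH mF; apply: (measurable_Rint2 P
  (f := fun z : R * Om => F (x + walk theta e (cnt e H z.1 z.2) z.2))).
apply: (measurableT_comp mF); apply: measurable_funD => //.
exact: measurable_walk_cnt he hH.
Qed.

Lemma flight_mean_le theta e H (c alpha B t x : R) F : exponential_times e c ->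
  stable_subordinator H alpha -> measurable_fun setT F -> (forall y, `|F y| <= B) ->
  `|flight_mean theta e H F t x| <= B.
Proof.
move=> he hH mF FB; apply: Rint_le_bound => //; apply: (measurableT_comp mF).
by apply: measurable_funD => //; exact: measurable_flight_path he hH.
Qed.

Lemma measurable_Harr e H (c alpha : R) n : exponential_times e c -> stable_subordinator H alpha ->
  measurable_fun setT (fun w => H (arr e n w) w).
Proof.
move=> he hH; apply: (measurable_subordinated hH) => [|w]; first exact: measurable_arr.
exact: arr_ge0 he.
Qed.

Lemma Harr_laplace theta e H (c alpha l : R) n : 0 < c -> 0 < l ->
  iid_signs theta -> exponential_times e c -> independent_families theta e H ->
  stable_subordinator H alpha ->
  \int[P]_w expR (- (l * H (arr e n w) w)) = (c / (c + l `^ alpha)) ^+ n.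
Proof.
move=> c0 l0 h1 h2 h3 hH.
rewrite -(arr_laplace n c0 (powR_gt0 alpha l0) h1 h2 h3).
have mr := measurable_arr_rects (theta := theta) (e := e) (leqnn n).
have n1 (w : Om) : `|1 : R| <= 1 by rewrite normr1.
have := expect_subordination (n := n) (Y := fun=> 1) (M := 1) (l := l) h1 h2 h3 hH l0
  (measurable_cst _) n1 mr (fun w => arr_ge0 n w h2).
under eq_Rintegral do rewrite mul1r.
by under [X in _ = X -> _]eq_Rintegral do rewrite mul1r.
Qed.

(** The indicator of n jumps by time t is that of H(T_n) <= t minus that of H(T_{n+1}) <= t, and the
    transforms of the two terms are Q_n F / l and q Q_n F / l. Cutting the sum at N leaves an error
    carried by the event H(T_N) <= t, whose transform is q^N / l. *)
Lemma flight_mean_laplace theta e H (c alpha l B x : R) F N : 0 < c -> 0 < l ->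
  iid_signs theta -> exponential_times e c -> independent_families theta e H ->
  stable_subordinator H alpha -> measurable_fun setT F -> (forall y, `|F y| <= B) ->
  `|\int[mu]_t (ew l (fk 1) t * flight_mean theta e H F t x) -
    (1 - c / (c + l `^ alpha)) / l * \sum_(n < N) Qop theta e (l `^ alpha) n F x| <=
  B / l * (c / (c + l `^ alpha)) ^+ N.
Proof.
move=> c0 l0 h1 he h3 hH mF FB; set s := l `^ alpha; set q := c / (c + s).
have s0 : 0 < s := powR_gt0 alpha l0.
pose Hn n w := H (arr e n w) w.
pose Y n w := F (x + walk theta e n w).
have mH n : measurable_fun setT (Hn n) := measurable_Harr n he hH.
have H0 n w : 0 <= Hn n w := subordinator_ge0 w hH (arr_ge0 n w he).
have mY n : measurable_fun setT (Y n).
  by apply: (measurableT_comp mF); apply: measurable_funD => //; exact: measurable_walk.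
have YB n w : `|Y n w| <= B by exact: FB.
have B0 : 0 <= B := le_trans (normr_ge0 _) (FB 0).
have mYr n k : (n <= k)%N -> measurable_fun setT (Y n : g_sigma_algebraType (rects theta e k) -> R).
  move=> nk; apply: (measurableT_comp mF); apply: measurable_funD => //.
  exact: measurable_walk_rects.
pose a n t := \int[P]_w (Y n w * (Hn n w <= t)%R%:R).
pose b n t := \int[P]_w (Y n w * (Hn n.+1 w <= t)%R%:R).
have ia n := (laplace_after l0 (mY n) (YB n) (mH n) (H0 n)).1.
have ib n := (laplace_after l0 (mY n) (YB n) (mH n.+1) (H0 n.+1)).1.
have ea n : \int[mu]_t (ew l (fk 1) t * a n t) = l^-1 * Qop theta e s n F x.
  rewrite (laplace_after l0 (mY n) (YB n) (mH n) (H0 n)).2; congr (_ * _).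
  exact: (expect_subordination h1 he h3 hH l0 (mYr n n (leqnn n)) (YB n)
    (measurable_arr_rects (leqnn n)) (fun w => arr_ge0 n w he)).
have eb n : \int[mu]_t (ew l (fk 1) t * b n t) = l^-1 * (q * Qop theta e s n F x).
  rewrite (laplace_after l0 (mY n) (YB n) (mH n.+1) (H0 n.+1)).2; congr (_ * _).
  rewrite -(expect_next x n c0 s0 h1 he h3 mF FB).
  exact: (expect_subordination h1 he h3 hH l0 (mYr n n.+1 (leqnSn n)) (YB n)
    (measurable_arr_rects (leqnn n.+1)) (fun w => arr_ge0 n.+1 w he)).
have iD n : intg mu (fun t => ew l (fk 1) t * (a n t - b n t)).
  by apply: eq_intg (intgB (ia n) (ib n)) => t; rewrite mulrBr.
have [iS eS] := Rint_sum N iD.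
have {}eS : \int[mu]_t (ew l (fk 1) t * \sum_(n < N) (a n t - b n t)) =
    (1 - q) / l * \sum_(n < N) Qop theta e s n F x.
  transitivity (\int[mu]_t (\sum_(n < N) (ew l (fk 1) t * (a n t - b n t)))).
    by apply: eq_Rintegral => t _; rewrite mulr_sumr.
  rewrite eS mulr_sumr; apply: eq_bigr => n _.
  transitivity (\int[mu]_t (ew l (fk 1) t * a n t - ew l (fk 1) t * b n t)).
    by apply: eq_Rintegral => t _; rewrite mulrBr.
  have e1 := RintegralB measurableT (ia n) (ib n).
  rewrite [LHS]e1; have -> := ea n; have -> := eb n; ring.
have {}iS : intg mu (fun t => ew l (fk 1) t * \sum_(n < N) (a n t - b n t)).
  by apply: eq_intg iS => t; rewrite mulr_sumr.
have mV := measurable_flight_mean theta x he hH mF.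
have VB t := flight_mean_le theta t x he hH mF FB.
have iV : intg mu (fun t => ew l (fk 1) t * flight_mean theta e H F t x).
  exact: (intgMbd (intg_fk1 l0) mV (fun t _ => VB t)).
have BB (w : Om) : `|B| <= B by rewrite ger0_norm.
have [iR eR] := laplace_after l0 (measurable_cst B) BB (mH N) (H0 N).
have rest t : 0 < t -> `|flight_mean theta e H F t x - \sum_(n < N) (a n t - b n t)| <=
    \int[P]_w (B * (Hn N w <= t)%R%:R).
  move=> t0.
  pose D n w := Y n w * (Hn n w <= t)%R%:R - Y n w * (Hn n.+1 w <= t)%R%:R.
  have mi n : measurable_fun setT (fun w => (Hn n w <= t)%R%:R : R).
    by apply: measurable_ind; exact: measurable_le_fun.
  have bi n w : `|(Hn n w <= t)%R%:R : R| <= 1 by case: (Hn n w <= t)%R; rewrite ?normr1 ?normr0.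
  have iYi n k : intg P (fun w => Y n w * (Hn k w <= t)%R%:R).
    exact: (intgMbd (Rint_bounded P (mY n) (YB n)) (mi k) (fun w _ => bi k w)).
  have iDw n : intg P (D n) by exact: intgB.
  have [iSD eSD] := Rint_sum N iDw.
  have iZ : intg P (fun w => F (x + walk theta e (cnt e H t w) w)).
    apply: (@Rint_bounded _ _ _ _ _ B) => //; apply: (measurableT_comp mF).
    by apply: measurable_funD => //; exact: measurable_flight_path he hH.
  have -> : \sum_(n < N) (a n t - b n t) = \int[P]_w \sum_(n < N) D n w.
    by rewrite eSD; apply: eq_bigr => n _; rewrite RintegralB.
  rewrite -RintegralB//; apply: le_trans (le_normr_Rintegral _ _) _ => //.
    exact: intgB.
  apply: le_Rintegral => //.
  - by apply: intg_norm; exact: intgB.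
  - by apply: intgZ; apply: (@Rint_bounded _ _ _ _ _ 1).
  (* Before the N-th jump exactly one index, the current count m, contributes; after it all N
     differences cancel and only the bound B on F remains. *)
  move=> w _; have [tN|Nt] := ltP t (Hn N w).
    have [mN /andP[m1 m2]] := cnt_lt he hH (ltW t0) tN; set m := cnt e H t w in mN m1 m2 *.
    rewrite (bigD1 (Ordinal mN))//= big1.
      have n1 : (Hn m w <= t) = true := m1.
      have n2 : (Hn m.+1 w <= t) = false by apply/negbTE; rewrite -ltNge.
      by rewrite /D /= n1 n2 mulr0 mulr1 subr0 addr0 subrr normr0 mulr0.
    move=> n nm; rewrite /D -mulrBr.
    have /orP[nlt|ngt] : (n < m)%N || (m < n)%N by rewrite -neq_ltn.
      have h1' := le_trans (Harr_mono w he hH nlt) m1.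
      have h2' := le_trans (Harr_mono w he hH (ltnW nlt)) m1.
      by rewrite h1' h2' subrr mulr0.
    have h1' := lt_le_trans m2 (Harr_mono w he hH ngt).
    have h2' := lt_le_trans m2 (Harr_mono w he hH (leqW ngt)).
    have n1 : (Hn n w <= t) = false by apply/negbTE; rewrite -ltNge.
    have n2 : (Hn n.+1 w <= t) = false by apply/negbTE; rewrite -ltNge.
    by rewrite n1 n2 subrr mulr0.
  rewrite big1 ?subr0 ?mulr1// => n _; rewrite /D.
  have h1' := le_trans (Harr_mono w he hH (ltn_ord n)) Nt.
  have h2' := le_trans (Harr_mono w he hH (ltnW (ltn_ord n))) Nt.
  by rewrite h1' h2' subrr.
rewrite -eS -RintegralB//; apply: le_trans (le_normr_Rintegral _ _) _ => //.
  exact: intgB.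
have -> : B / l * q ^+ N = \int[mu]_t (ew l (fk 1) t * \int[P]_w (B * (Hn N w <= t)%R%:R)).
  rewrite eR RintZ; first by rewrite (Harr_laplace N c0 l0 h1 he h3 hH) -/s -/q; ring.
  apply: (@Rint_bounded _ _ _ _ _ 1); first exact: (measurableT_comp (measurable_expRl l)).
  by move=> w; rewrite ger0_norm ?expR_ge0// expR_le1 oppr_le0 mulr_ge0// (ltW l0).
apply: le_Rintegral => //.
  by apply: intg_norm; exact: intgB.
move=> t _; rewrite -mulrBr normrM ew1E; have [t0|t0] := ltP 0 t; last by rewrite !mul0r normr0 mul0r.
by rewrite mul1r ger0_norm ?expR_ge0// ler_wpM2l ?expR_ge0// rest.
Qed.

(** Complement of the event H(T_1) <= t, whose transform is q / l; the resulting (1 - q)/l is the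
    factor in the renewal equation. *)
Lemma Harr_tail_laplace theta e H (c alpha l : R) : 0 < c -> 0 < l ->
  iid_signs theta -> exponential_times e c -> independent_families theta e H ->
  stable_subordinator H alpha ->
  let p t := fine (P [set w | t < subordinated_arrival e H 1 w]) in
  [/\ measurable_fun setT p, forall t, `|p t| <= 1 &
      \int[mu]_t (ew l (fk 1) t * p t) = (1 - c / (c + l `^ alpha)) / l].
Proof.
move=> c0 l0 h1 he h3 hH p.
have mH := measurable_Harr 1 he hH.
have H0 w : 0 <= H (arr e 1 w) w := subordinator_ge0 w hH (arr_ge0 1 w he).
have n1 (w : Om) : `|1 : R| <= 1 by rewrite normr1.
have [iA eA] := laplace_after l0 (measurable_cst (1 : R)) n1 mH H0.
pose b (z : R * Om) : R := (H (arr e 1 z.2) z.2 <= z.1)%R%:R.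
have mb : measurable_fun setT b.
  apply: measurable_ind; apply: measurable_le_fun; last exact: measurable_fst.
  by apply: (measurableT_comp mH); exact: measurable_snd.
have mbt t : measurable_fun setT (fun w => b (t, w)).
  by apply: measurableT_comp => //; exact: measurable_pair1.
have b1 z : `|b z| <= 1 by rewrite /b; case: (H (arr e 1 z.2) z.2 <= z.1)%R; rewrite ?normr1 ?normr0.
have pE t : p t = 1 - \int[P]_w b (t, w).
  have mt : measurable [set w | t < H (arr e 1 w) w] by exact: measurable_lt_fun.
  transitivity (\int[P]_w (t < H (arr e 1 w) w)%R%:R).
    rewrite Rint_prob// /p; congr (fine (P _)); apply/seteqP; split => w /=;
      by rewrite /subordinated_arrival (arrivalE _ _ he).
  rewrite -[X in X - _](Rint_cst_prob P) -RintegralB//.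
  - by apply: eq_Rintegral => w _; rewrite /b/= ltNge; case: (_ <= _)%R; rewrite ?subrr ?subr0.
  - exact: finite_measure_integrable_cst.
  - exact: (@Rint_bounded _ _ _ _ _ 1).
have mp : measurable_fun setT p.
  rewrite (_ : p = fun t => 1 - \int[P]_w b (t, w)); last exact/funext.
  by apply: measurable_funB => //; exact: (measurable_Rint2 P).
split => // [t|].
  rewrite pE; have : 0 <= \int[P]_w b (t, w).
    by apply: Rintegral_ge0 => w _; rewrite /b.
  have := @Rint_le_bound _ _ _ P _ _ (mbt t) (fun w => b1 (t, w)).
  rewrite !ler_norml; move: (\int[P]_w b (t, w)) => I /andP[_ I1] I0; apply/andP.
  by split; [rewrite lerBrDr (le_trans _ I1)// gerDr oppr_le0 | rewrite lerBlDr lerDl].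
transitivity (\int[mu]_t (ew l (fk 1) t - ew l (fk 1) t * \int[P]_w (1 * (H (arr e 1 w) w <= t)%R%:R))).
  apply: eq_Rintegral => t _; rewrite pE mulrBr mulr1; congr (_ - _ * _).
  by apply: eq_Rintegral => w _; rewrite mul1r.
rewrite RintegralB//; last exact: intg_fk1.
rewrite eA laplace_fk1//; under eq_Rintegral do rewrite mul1r.
by rewrite (Harr_laplace 1 c0 l0 h1 he h3 hH) expr1; ring.
Qed.

(** Along almost every path t lies strictly below the next arrival, so the count is constant on an
    interval to the right of t. *)
Lemma flight_mean_right_cont theta e H (c alpha B t x : R) F : 0 < c ->
  iid_signs theta -> exponential_times e c -> independent_families theta e H ->
  stable_subordinator H alpha -> measurable_fun setT F -> (forall y, `|F y| <= B) -> 0 <= t ->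
  flight_mean theta e H F s x @[s --> t^'+] --> flight_mean theta e H F t x.
Proof.
move=> c0 h1 he h3 hH mF FB t0; apply/cvg_at_rightP => u [ut uc].
have mZ r : measurable_fun setT (fun w => F (x + walk theta e (cnt e H r w) w)).
  apply: (measurableT_comp mF); apply: measurable_funD => //; exact: measurable_flight_path he hH.
apply: (@Rint_dominated_cvg _ _ _ P _ _ (fun=> B)) => //.
- exact: finite_measure_integrable_cst.
- have unb := ae_unbounded c0 h1 he h3 hH; apply: (aeS unb) => w hw.
  have [N hN] := hw t; have [_ /andP[c1 c2]] := cnt_lt he hH t0 hN.
  apply: cvg_near_cst; near=> k; congr (F (x + walk theta e _ w)).
  apply: cntP he hH _; rewrite (le_trans c1 (ltW (ut k)))/=.
  by near: k; exact: (cvgr_lt t uc).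
Unshelve. all: end_near. Qed.

End Flight.

(** * Identification of the solution *)

Section Identification.
Context {d : measure_display} {Om : measurableType d} {R : realType}
  {P : probability Om R}.
Local Notation mu := (@lebesgue_measure R).
Implicit Types (theta e : nat -> {RV P >-> R}) (H : R -> {RV P >-> R}) (f p rho phi : R -> R).

(** For every N both sides are within a multiple of q^N of the same partial sum of the renewal
    series. *)
Lemma mol_eq_laplace theta e H (c l alpha : R) uh f rho x : 0 < c -> 0 < l ->
  iid_signs theta -> exponential_times e c -> independent_families theta e H ->
  stable_subordinator H alpha ->
  L2_bounded uh -> L2_bounded f ->
  (forall phi, test_function phi ->
        \int[mu]_y (uh y * derive1n 2 phi y) -
          (1 - c / (c + l `^ alpha)) / l * \int[mu]_y (f y * derive1n 2 phi y) =
        (c * l `^ alpha + (l `^ alpha) ^+ 2) *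
          (\int[mu]_y (uh y * phi y) - l^-1 * \int[mu]_y (f y * phi y))) ->
  test_function rho ->
  mol uh rho x = \int[mu]_t (ew l (fk 1) t * flight_mean theta e H (mol f rho) t x).
Proof.
move=> c0 l0 h1 he h3 hH lu lf W tr.
have s0 : 0 < l `^ alpha by exact: powR_gt0.
have [mr nr] := (test_measurable tr, test_N2 tr).
have [MU MU0 hMU] := mol_bounded lu mr nr.
have [MF MF0 hMF] := mol_bounded lf mr nr.
have mU := measurable_mol lu.1 mr; have mF := measurable_mol lf.1 mr.
have ren n y := mol_renewal n y c0 l0 h1 he h3 lu lf W tr.
set q := c / (c + l `^ alpha) in W ren *; set Vh := \int[mu]_t _.
have q0 : 0 <= q by rewrite divr_ge0 ?addr_ge0 ?(ltW c0) ?(ltW s0).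
have q1 : q < 1 by rewrite /q ltr_pdivrMr ?addr_gt0// mul1r ltrDl.
have bd N : `|mol uh rho x - Vh| <= (MU + MF / l) * q ^+ N.
  have h := renewal_iterate x N c0 s0 h1 he h3 mF (fun y => (hMF y).2) mU (fun y => (hMU y).2) ren.
  have h' := flight_mean_laplace x N c0 l0 h1 he h3 hH mF (fun y => (hMF y).2).
  rewrite mulrDl; apply: le_trans (lerD h h').
  rewrite -/Vh; move: (\sum_(n < N) _) => S; rewrite -/q [X in _ <= _ + X]distrC.
  by apply: le_trans (ler_normD _ _); rewrite addrA subrK.
apply/eqP; rewrite -subr_eq0 -normr_eq0 eq_le normr_ge0 andbT.
have lim : (MU + MF / l) * q ^+ N @[N --> \oo] --> (0 : R).
  rewrite -[X in _ --> X](mulr0 (MU + MF / l)); apply: cvgM; first exact: cvg_cst.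
  by apply: cvg_expr; rewrite ger0_norm.
rewrite -(cvg_lim (@Rhausdorff R) lim); apply: limr_ge; first by apply/cvg_ex; exists 0.
by near=> N; exact: bd.
Unshelve. all: end_near. Qed.

(** The mollifier is reflected about x so that the pairing is a convolution at x. The transforms
    agree for l > beta/2, the range in which the weighted bounds make that of u converge. *)
Lemma Umean_eq_flight_mean theta e H (c alpha beta : R) f u q G rho x :
  0 < alpha -> alpha <= 1 -> 0 < c -> 0 < beta ->
  iid_signs theta -> exponential_times e c -> independent_families theta e H ->
  stable_subordinator H alpha ->
  measurable_fun setT f -> (N2 f < +oo)%E ->
  pde_rep alpha c beta f (fun t => fine (P [set w | t < subordinated_arrival e H 1 w])) u q G ->
  test_function rho -> forall t, 0 < t ->
  Umean f q (fun y => rho (x - y)) t = flight_mean theta e H (mol f rho) t x.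
Proof.
move=> a0 a1 c0 b0 h1 he h3 hH mf ff rep tr.
have lf := L2_bounded_N2 mf ff.
have [mr nr] := (test_measurable tr, test_N2 tr).
have [MF MF0 hMF] := mol_bounded lf mr nr.
have mF := measurable_mol lf.1 mr.
have tx := test_reflect x tr.
pose D t := Umean f q (fun y => rho (x - y)) t - flight_mean theta e H (mol f rho) t x.
have key l : beta / 2 < l -> intg mu (fun t => expR (- (l * t)) * ((0 < t)%R%:R * D t)) /\
    \int[mu]_t (expR (- (l * t)) * ((0 < t)%R%:R * D t)) = 0.
  move=> bl; have l0 : 0 < l by apply: lt_trans bl; rewrite divr_gt0.
  have b2l : beta < 2 * l by rewrite mulrC -ltr_pdivrMr.
  have [mp p1 pl] := Harr_tail_laplace c0 l0 h1 he h3 hH.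
  have [muh huh hU W] := pde_laplace a0 a1 mf ff mp p1 rep l0 b2l.
  rewrite pl in W.
  have [iU eU] := hU _ tx.
  have mV := measurable_flight_mean theta x he hH mF.
  have VB t := flight_mean_le theta t x he hH mF (fun y => (hMF y).2).
  have iV : intg mu (fun t => ew l (fk 1) t * flight_mean theta e H (mol f rho) t x).
    exact: (intgMbd (intg_fk1 l0) mV (fun t _ => VB t)).
  have E t : expR (- (l * t)) * ((0 < t)%R%:R * D t) =
      ew l (fk 1) t * Umean f q (fun y => rho (x - y)) t - ew l (fk 1) t * flight_mean theta e H (mol f rho) t x.
    by rewrite -mulrBr ew1E /D; ring.
  split; first by apply: eq_intg (intgB iU iV) => t; rewrite E.
  under eq_Rintegral do rewrite E.
  have e1 := RintegralB measurableT iU iV; rewrite [LHS]e1.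
  have -> := eU.
  have -> := esym (mol_eq_laplace x c0 l0 h1 he h3 hH (conj muh huh) lf W tr).
  exact: subrr.
move=> t t0; apply/eqP; rewrite -subr_eq0; apply/eqP.
(* The factor (0 < t) makes the difference causal, as [laplace_injective] requires, and equals 1 at
   the times of interest. *)
rewrite -/(D t); have <- : (0 < t)%R%:R * D t = D t by rewrite t0 mul1r.
apply: (laplace_injective (phi := fun t => (0 < t)%R%:R * D t) (l0 := beta / 2)) t0 => //.
- by move=> r; rewrite leNgt => /negbTE ->; rewrite mul0r.
- by move=> l /key[].
- by move=> l /key[].
move=> r r0; rewrite r0.
have c1 := Umean_right_cont mf ff rep tx r0.
have c2 : flight_mean theta e H (mol f rho) s x @[s --> r^'+] --> flight_mean theta e H (mol f rho) r x.
  exact: flight_mean_right_cont c0 h1 he h3 hH mF (fun y => (hMF y).2) (ltW r0).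
have c3 : D s @[s --> r^'+] --> D r by exact: cvgB.
rewrite mul1r; apply: cvg_trans c3; apply: near_eq_cvg; near=> s.
suff -> : 0 < s by rewrite mul1r.
by near: s; apply: filterS (nbhs_right_gt r) => s; exact: lt_trans.
Unshelve. all: end_near. Qed.

Lemma N2_indic_compact (K : set R) : compact K ->
  measurable_fun setT (\1_K : R -> R) /\ (N2 (\1_K : R -> R) < +oo)%E.
Proof.
move=> cK; have mI : measurable_fun setT (\1_K : R -> R).
  by apply: measurable_indic; exact: compact_measurable.
split => //; apply: (N2_of_bounded (B := 1)) => [x|].
  by rewrite indicE; case: (x \in K); rewrite ?normr1 ?normr0.
apply/integrableP; split; first by apply/measurable_EFinP.
under eq_integral => x _ do rewrite /= ger0_norm//.
rewrite integral_indic//; last exact: compact_measurable.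
by rewrite setIT; exact: compact_finite_measure.
Qed.

(** The indicator of a compact set has finite L^2 norm, and pairing with it gives the integral over
    that set. *)
Lemma L2_locally_integrable (z : R -> R) : measurable_fun setT z ->
  (forall phi, measurable_fun setT phi -> (N2 phi < +oo)%E -> intg mu (fun y => z y * phi y)) ->
  locally_integrable setT z.
Proof.
move=> mz h; split => // [|K _ cK]; first exact: openT.
have [mI fK] := N2_indic_compact cK.
have [_ hz] := (intgP _ _).1 (h _ mI fK).
rewrite integral_mkcond; apply: le_lt_trans hz; rewrite le_eqVlt; apply/orP; left; apply/eqP.
apply: eq_integral => x _; rewrite patchE indicE; case: (x \in K).
  by rewrite mulr1.
by rewrite mulr0 normr0.
Qed.

Section Translation.
Variables (Z : Om -> R) (f : R -> R).
Hypotheses (mZ : measurable_fun setT Z) (mf : measurable_fun setT f) (ff : (N2 f < +oo)%E).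

Let mfZ : measurable_fun setT (fun z : R * Om => f (z.1 + Z z.2)).
Proof.
apply: (measurableT_comp mf); apply: measurable_funD => //.
by apply: (measurableT_comp mZ); exact: measurable_snd.
Qed.

(** Cauchy-Schwarz for each w, with a bound independent of w because translation preserves the L^2
    norm of f. *)
Lemma intg_translate phi : measurable_fun setT phi -> (N2 phi < +oo)%E ->
  intg (mu \x P)%E (fun z : R * Om => f (z.1 + Z z.2) * phi z.1).
Proof.
move=> mphi fphi.
have mk : measurable_fun setT (fun z : R * Om => f (z.1 + Z z.2) * phi z.1).
  by apply: measurable_funM => //; apply: (measurableT_comp mphi); exact: measurable_fst.
apply: prod_intgP2 => //.
have nf : (N2 f \is a fin_num)%E by rewrite ge0_fin_numE// N2_ge0.
have np : (N2 phi \is a fin_num)%E by rewrite ge0_fin_numE// N2_ge0.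
apply: (@le_lt_trans _ _ (\int[P]_w (fine (N2 f) * fine (N2 phi))%:E)%E).
  apply: ge0_le_integral => //.
  - by move=> w _; apply: integral_ge0 => y _.
  - apply: (measurable_integral2 mu (f := fun z : Om * R => (`|f (z.2 + Z z.1) * phi z.2|)%:E)).
    apply/measurable_EFinP; apply: measurableT_comp => //.
    exact: (measurableT_comp mk (@measurable_swap _ _ _ _)).
  move=> w _; rewrite EFinM !fineK// -(N2_shift (Z w) mf).
  apply: cauchy_schwarz => //; apply: (measurableT_comp mf).
  exact: (measurable_funD (@measurable_id _ _ setT) (measurable_cst (Z w))).
have := finite_measure_integrable_cst P (fine (N2 f) * fine (N2 phi)) measurableT.
by move/integrable_lty; apply.
Qed.

(** Square integrability of f gives integrability of f(y + Z) for almost every y; the indicators of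
    [-n, n], taken as test functions, reach every y. *)
Lemma ae_intg_translate : {ae mu, forall y, intg P (fun w => f (y + Z w))}.
Proof.
have ck n := @segment_compact R (- n%:R) n%:R.
have all n := prod_intg_ae (intg_translate (N2_indic_compact (ck n)).1 (N2_indic_compact (ck n)).2).
have hall := ae_foralln all; apply: (aeS hall) => y hy.
have := hy (Num.truncn `|y|).+1; apply: eq_intg => w.
rewrite indicE mem_setE in_itv/= -ler_norml (ltW (truncnS_gt _)) mulr1//.
Qed.

Let av y := \int[P]_w f (y + Z w).

Lemma intg_average phi : measurable_fun setT phi -> (N2 phi < +oo)%E ->
  intg mu (fun y => av y * phi y) /\
  \int[P]_w \int[mu]_y (f (y + Z w) * phi y) = \int[mu]_y (av y * phi y).
Proof.
move=> mphi fphi; have iT := intg_translate mphi fphi; have i1 := intg_Rint2 iT.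
have eq1 y : \int[P]_w (f (y + Z w) * phi y) = av y * phi y.
  by rewrite RintMr//; exact: (measurableT_comp mfZ (measurable_pair1 y)).
split; first by apply: eq_intg i1 => y; rewrite -eq1.
by rewrite -(Rint_fubini iT); apply: eq_Rintegral => y _; rewrite -eq1.
Qed.

(** Mollifying commutes with averaging over translates, so the mean of the mollified f is the
    mollified mean of f. *)
Lemma mol_translate rho x : test_function rho ->
  \int[P]_w mol f rho (x + Z w) = \int[mu]_y (av y * rho (x - y)).
Proof.
move=> tr; have tx := test_reflect x tr.
have [_ <-] := intg_average (test_measurable tx) (test_N2 tx).
apply: eq_Rintegral => w _; rewrite /mol -(Rint_shift (Z w)).
  by apply: eq_Rintegral => y _; congr (_ * rho _); ring.
apply: measurable_funM => //; apply: measurable_reflect; exact: test_measurable.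
Qed.

End Translation.

(** For fixed t the difference z of the two sides pairs to 0 with every rescaled bump by
    [Umean_eq_flight_mean]; [mollified_eq0] then removes the mollifier without a limit inside the
    expectation. *)
Lemma flight_representation theta e H (c alpha beta t : R) f u q G :
  0 < alpha -> alpha <= 1 -> 0 < c -> 0 < beta ->
  iid_signs theta -> exponential_times e c -> independent_families theta e H ->
  stable_subordinator H alpha ->
  measurable_fun setT f -> (N2 f < +oo)%E ->
  pde_rep alpha c beta f (fun t => fine (P [set w | t < subordinated_arrival e H 1 w])) u q G ->
  0 < t ->
  {ae mu, forall x, intg P (fun w => f (x + walk theta e (cnt e H t w) w)) /\
    u t x = \int[P]_w f (x + walk theta e (cnt e H t w) w)}.
Proof.
move=> a0 a1 c0 b0 h1 he h3 hH mf ff rep t0.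
pose Z w := walk theta e (cnt e H t w) w.
have mZ : measurable_fun setT Z := measurable_flight_path theta t he hH.
pose w y := \int[P]_w f (y + Z w).
pose z y := f y + jconv (fk 1) q (t, y) - w y.
have [[mq _ _ _] uE _ _ _] := rep.
have mw : measurable_fun setT w.
  apply: (measurable_Rint2 P (f := fun z : R * Om => f (z.1 + Z z.2))).
  apply: (measurableT_comp mf); apply: measurable_funD => //.
  by apply: (measurableT_comp mZ); exact: measurable_snd.
have mJ : measurable_fun setT (fun y => jconv (fk 1) q (t, y)).
  apply: (measurableT_comp (measurable_jconv (measurable_fk 1) mq)).
  exact: measurable_pair1.
have mz : measurable_fun setT z by apply: measurable_funB => //; exact: measurable_funD.
have iw phi mphi fphi := (@intg_average Z f mZ mf ff phi mphi fphi).1.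
have lz : locally_integrable setT z.
  apply: L2_locally_integrable => // phi mphi fphi.
  have i1 := N2_mul_intg mf mphi ff fphi.
  have i2 := intg_jconv_fk1 t rep mphi fphi.
  by apply: eq_intg (intgB (intgD i1 i2) (iw phi mphi fphi)) => y; rewrite -mulrDl -mulrBl.
have z0 eps x : 0 < eps -> \int[mu]_y (z y * sbump eps x y) = 0.
  move=> eps0; pose rho (y : R) := bump (eps^-1 * y + 0).
  have tr : test_function rho by apply: test_affine test_bump; rewrite invr_eq0 gt_eqF.
  have rhoE y : sbump eps x y = rho (x - y) by rewrite /sbump /rho; congr bump; ring.
  have tx := test_reflect x tr; have mx := test_measurable tx; have nx := test_N2 tx.
  have := Umean_eq_flight_mean x a0 a1 c0 b0 h1 he h3 hH mf ff rep tr t0.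
  rewrite /flight_mean (mol_translate mZ mf ff x tr) => eU.
  have iU : intg mu (fun y => (f y + jconv (fk 1) q (t, y)) * rho (x - y)).
    have i1 := N2_mul_intg mf mx ff nx; have i2 := intg_jconv_fk1 t rep mx nx.
    by apply: eq_intg (intgD i1 i2) => y; ring.
  have e1 := RintegralB measurableT iU (iw _ mx nx).
  rewrite -[RHS](subrr (Umean f q (fun y => rho (x - y)) t)) [X in _ - X]eU -[RHS]e1.
  by apply: eq_Rintegral => y _; rewrite rhoE -mulrBl.
have zae := mollified_eq0 lz z0.
have intae := ae_intg_translate mZ mf ff.
apply: (aeS3 uE zae intae) => y uy zy iy; split => //.
by rewrite uy//; apply/eqP; rewrite -subr_eq0; apply/eqP.
Qed.

End Identification.

Theorem theorem1 (R : realType) (d : measure_display) (Om : measurableType d)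
    (P : probability Om R)
    (alpha sigma eta zeta beta : R)
    (theta e : nat -> {RV P >-> R}) (H : R -> {RV P >-> R})
    (f : R -> R) (u : R -> R -> R) :
  0 < alpha -> alpha <= 1 ->
  0 < sigma -> 0 < eta ->
  0 < beta -> -1 < zeta ->
  iid_signs theta ->
  exponential_times e (sigma / eta) ->
  stable_subordinator H alpha ->
  independent_families theta e H ->
  sobolev 2 f ->
  anisotropic (2 * alpha) zeta beta u ->
  solves_equation alpha (sigma / eta) f
    (fun t => fine (P [set w | t < subordinated_arrival e H 1 w])) u ->
  initial_conditions alpha f u ->
  forall t : R, 0 < t ->
    {ae (@lebesgue_measure R), forall x : R,
      (u t x)%:E = ('E_P[fun w => f (x + random_flight theta e H t w)%R])%E}.
Proof.
move=> a0 a1 s0 n0 b0 z1 h1 he hH h3 [/andP[fm fn] _] hu hpde hinit t t0.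
have c0 : 0 < sigma / eta by rewrite divr_gt0.
have mf : measurable_fun setT f by move: fm; rewrite inE.
have ff : (N2 f < +oo)%E by move: fn; rewrite inE.
have [q [G rep]] := pde_representation a0 a1 z1 mf hu hpde hinit.
have h := flight_representation (t := t) a0 a1 c0 b0 h1 he h3 hH mf ff rep t0.
apply: (aeS h) => x [ix ->].
(* Inside the expectation the flight is exchanged for its measurable version, to which it is almost
   surely equal. *)
rewrite unlock (EFin_Rint ix); apply: integral_ae.
have hf := ae_random_flight c0 h1 he h3 hH.
by apply: (aeS hf) => w -> //; exact: ltW.
Qed.
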